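(* Let $\alpha>0$. For each $n$, let $\kappa$ be chosen uniformly at random from the set $\mathcal{P}_n$ of all partitions of $n$. Then, as $n\to\infty$, $$c\,n^{-3/2}\lambda_\kappa-\log\frac{\sqrt n}{c}$$ converges weakly to the Gumbel distribution with cumulative distribution function $G(x)=\exp\big(-e^{-(x+K)}\big)$, $x\in\mathbb{R}$, where $c=\frac{\pi}{\sqrt6}$ and $K=\frac{6\zeta(3)}{\pi^2}(1-\alpha)$, with $\zeta$ the Riemann zeta function.
   Context: A partition of $n$ is written $\kappa=(k_1,\dots,k_m)$ with $k_1\ge\cdots\ge k_m>0$ and $\sum_i k_i=n$, so that $m=m(\kappa)$ is the number of parts of $\kappa$. $\kappa'$ denotes the transpose (conjugate) partition, with parts $k_i'$, and $a(\kappa)=\sum_{i=1}^m(i-1)k_i=\sum_{i\ge1}\binom{k_i'}{2}$. The eigenvalue associated with $\kappa$ is $$\lambda_\kappa=n(m-1)+a(\kappa')\alpha-a(\kappa).$$ *)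

(* Defs.v *)
From HB Require Import structures.
From mathcomp Require Import all_boot all_order all_algebra.
From mathcomp Require Import all_classical all_reals all_analysis.

Set Implicit Arguments.
Unset Strict Implicit.
Unset Printing Implicit Defensive.

Import Order.TTheory GRing.Theory Num.Theory.
Import numFieldNormedType.Exports.

Local Open Scope classical_set_scope.
Local Open Scope ring_scope.

Definition is_partition (n : nat) (s : seq nat) : bool :=
  [&& sorted geq s, all (leq 1) s & sumn s == n].

Record intpart (n : nat) := IntPart {
  parts :> seq nat;
  partsP : is_partition n parts }.

HB.instance Definition _ n := [isSub for @parts n].
HB.instance Definition _ n := [Countable of intpart n by <:].

(* k'_j = #{i : k_i >= j}, for 1 <= j <= k_1; the index j below starts at 0. *)
Definition conj_parts (s : seq nat) : seq nat :=
  mkseq (fun j => count (fun k => j < k)%N s) (head 0%N s).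

(* a(kappa) = sum_(i >= 1) (i - 1) k_i, with i shifted to start at 0. *)
Definition part_a (s : seq nat) : nat := (\sum_(i < size s) i * nth 0 s i)%N.

Definition partition_eigenvalue (R : realType) (alpha : R) (n : nat)
    (kappa : intpart n) : R :=
  n%:R * ((size kappa)%:R - 1)
  + (part_a (conj_parts kappa))%:R * alpha - (part_a kappa)%:R.

Section intpart_finite.
Variable n : nat.

Definition intpart_encode (k : intpart n) : n.-tuple 'I_n.+1 :=
  [tuple inord (nth 0%N k i) | i < n].

Definition intpart_decode (t : n.-tuple 'I_n.+1) : option (intpart n) :=
  insub [seq x <- map val t | (0 < x)%N].

Lemma intpart_size_le (k : intpart n) : (size k <= n)%N.
Proof.
case: k => s /= /and3P[_ /allP s1 /eqP <-].
elim: s s1 => //= a s IH s1; rewrite -add1n leq_add ?s1 ?mem_head//.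
by apply: IH => x xs; rewrite s1// inE xs orbT.
Qed.

Lemma intpart_nth_le (k : intpart n) i : (nth 0%N k i <= n)%N.
Proof.
case: k => s /= /and3P[_ _ /eqP <-].
elim: s i => [|a s IH] [|i] //=; first exact: leq_addr.
exact: leq_trans (IH i) (leq_addl _ _).
Qed.

Lemma intpart_encodeK : pcancel intpart_encode intpart_decode.
Proof.
move=> k; rewrite /intpart_decode.
have -> : [seq x <- map val (intpart_encode k) | (0 < x)%N] = k.
  have -> : map val (intpart_encode k) = mkseq (nth 0%N k) n.
    rewrite /= -map_comp /mkseq -val_enum_ord -map_comp.
    by apply: eq_map => i /=; rewrite inordK // ltnS intpart_nth_le.
  have -> : mkseq (nth 0%N k) n = parts k ++ nseq (n - size k) 0%N.
    apply: (@eq_from_nth _ 0%N) => [|i].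
      by rewrite size_mkseq size_cat size_nseq subnKC ?intpart_size_le.
    rewrite size_mkseq => ltin; rewrite nth_mkseq// nth_cat nth_nseq.
    by case: ltnP => // ?; rewrite nth_default ?if_same.
  rewrite filter_cat.
  have -> : [seq x <- nseq (n - size k) 0%N | (0 < x)%N] = [::].
    by elim: (n - size k)%N.
  rewrite cats0; apply/all_filterP.
  by case: k => s /= /and3P[].
by rewrite valK.
Qed.

HB.instance Definition _ := fintype.isFinite.Build (intpart n) (pcan_enumP intpart_encodeK).

Lemma nseq_is_partition : is_partition n (nseq n 1%N).
Proof.
rewrite /is_partition sumn_nseq mul1n eqxx all_nseq leqnn orbT !andbT /=.
by case: n => //= m; elim: m => //= m ->.
Qed.

HB.instance Definition _ := isPointed.Build (intpart n) (IntPart nseq_is_partition).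

HB.instance Definition _ := @isMeasurable.Build default_measure_display
  (intpart n) discrete_measurable discrete_measurable0
  discrete_measurableC discrete_measurableU.

End intpart_finite.

Section uniform_partition.
Variables (R : realType) (n : nat).

Definition uniform_part : set (intpart n) -> \bar R :=
  mscale (#|{: intpart n}|%:R^-1)%:nng (@counting (intpart n) R).

HB.instance Definition _ := Measure.on uniform_part.

Lemma uniform_partE (p : pred (intpart n)) :
  uniform_part [set k | p k] = (#|p|%:R / #|{: intpart n}|%:R)%:E.
Proof.
rewrite /uniform_part /mscale /= /counting asboolT; last exact: finite_finset.
rewrite -EFinM mulrC; congr ((_ %:R / _)%:E).
rewrite -(card_uniqP (finmap.fset_uniq _)); apply: eq_card => k.
rewrite in_fset_set; last exact: finite_finset.
by rewrite [RHS]unfold_in; apply/idP/idP; rewrite inE.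
Qed.

Let uniform_part_setT : uniform_part [set: _] = 1%E.
Proof.
have -> : [set: intpart n] = [set k | predT k] by apply/seteqP.
rewrite uniform_partE divff// pnatr_eq0 -lt0n.
by apply/card_gt0P; exists point.
Qed.

HB.instance Definition _ :=
  Measure_isProbability.Build _ _ _ uniform_part uniform_part_setT.

End uniform_partition.

Section partition_statistic.
Variables (R : realType) (n : nat) (f : intpart n -> R).

(* Alias of f carrying its measurability for the discrete sigma-algebra. *)
Definition part_stat : intpart n -> R := f.

Let measurable_part_stat : measurable_fun [set: intpart n] part_stat.
Proof. by []. Qed.

HB.instance Definition _ :=
  isMeasurableFun.Build _ _ _ _ part_stat measurable_part_stat.

Definition part_RV : {RV (uniform_part R (n:=n)) >-> R} := part_stat.

End partition_statistic.

(* Weak convergence of laws, as convergence of the distribution functions at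
   every continuity point of the limit; the X n may live on different spaces. *)
Definition converges_weakly (R : realType) (d : nat -> measure_display)
    (T : forall n, measurableType (d n)) (P : forall n, probability (T n) R)
    (X : forall n, {RV (P n) >-> R}) (G : cumulativeBounded (0 : R) (1 : R)) : Prop :=
  forall x : R, {for x, continuous G} ->
    cdf (X n) x @[n --> \oo] --> (G x)%:E.

(* riemannR s is the sequence n |-> (n + 1)^(-s), so this is only meaningful for
   s > 1. *)
Definition zeta (R : realType) (s : R) : R := limn (series (riemannR s)).

Section gumbel.
Variables (R : realType) (K : R).

Definition gumbel_cdf (x : R) : R := expR (- expR (- (x + K))).

Let gumbel_nd : {homo gumbel_cdf : x y / x <= y}.
Proof.
by move=> x y xy; rewrite /gumbel_cdf ler_expR lerN2 ler_expR lerN2 lerD2r.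
Qed.

Let gumbel_continuous : continuous gumbel_cdf.
Proof.
move=> x; apply: continuous_comp; last exact: continuous_expR.
apply: continuousN; apply: continuous_comp; last exact: continuous_expR.
by apply: continuousN; apply: cvgD; [exact: cvg_id|exact: cvg_cst].
Qed.

Let gumbel_rc : forall x, gumbel_cdf @ x^'+ --> gumbel_cdf x.
Proof. exact: right_continuousW. Qed.

HB.instance Definition _ := isCumulative.Build R _ R gumbel_cdf gumbel_nd gumbel_rc.

Let gumbel_Ny0 : gumbel_cdf @ -oo --> (0 : R).
Proof.
apply: (@cvg_comp _ _ _ (fun x => expR (- (x + K))) (fun y => expR (- y)) _
  (pinfty_nbhs R) _ _ (@cvgr_expR R)).
apply/cvgryPge => A; near=> x.
apply: le_trans (expR_ge1Dx _).
rewrite -lerBlDl lerNr opprB -lerBrDr.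
by near: x; apply: nbhs_ninfty_le; exact: num_real.
Unshelve. all: by end_near. Qed.

Let gumbel_y1 : gumbel_cdf @ +oo --> (1 : R).
Proof.
rewrite -(@expR0 R) -[X in expR X]oppr0.
apply: (@cvg_comp _ _ _ (fun x => - expR (- (x + K))) expR);
  last exact: continuous_expR.
apply: cvgN; under eq_fun do rewrite (addrC _ K).
exact: (cvg_comp _ _ (cvg_addrl K) (@cvgr_expR R)).
Qed.

HB.instance Definition _ :=
  isCumulativeBounded.Build R 0 1 gumbel_cdf gumbel_Ny0 gumbel_y1.

End gumbel.

(* Main.v *)
Require Import Defs.
From mathcomp Require Import all_boot all_order all_algebra.
From mathcomp Require Import all_classical all_reals all_analysis.
From mathcomp Require Import ring lra zify.

Set Implicit Arguments.
Unset Strict Implicit.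
Unset Printing Implicit Defensive.

Import Order.TTheory GRing.Theory Num.Theory.
Import numFieldNormedType.Exports.

Local Open Scope classical_set_scope.
Local Open Scope ring_scope.

(** Write p(n) for the number of partitions of n, c = pi / sqrt 6 and
    t = c / sqrt n.  Up to a negligible term the statistic is
    (t m - log (1/t)) + t^3 (alpha a(kappa') - a(kappa)) / c^2.  The first
    summand is the Erdos-Lehner statistic, with limit law exp (-e^(-x)); the
    quantities t^3 a(kappa) and t^3 a(kappa') both tend to zeta(3) in
    probability.  The law of m - log is therefore only shifted, by -K.

    Both facts are statements about ratios p(n - s) / p(n), because the
    partitions of n that contain a given multiset of parts of sum s are p(n - s)
    in number (card_contains).  The analytic core is npart_ratio: uniformly for
    s well below n^(3/4), p(n - s) = (1 + o(1)) e^(-ts) p(n), and for all s the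
    upper half of this estimate persists.

    The proof of npart_ratio is elementary.  Let
    h(y) = p(n - y) e^(-t (n - y)) and let v_s = sigma(s) e^(-ts), of sum V.
    Euler's recursion n p(n) = sum_s sigma(s) p(n - s) reads
    (n - y) h(y) = sum_s v_s h(y + s).  With the tails T_x = v_{x+1} + v_{x+2} +
    ... as weights, the smoothed sequence B(y) = sum_x T_x h(y + x) satisfies
    the exact identity B(y) - B(y + 1) = (y - (n - V)) h(y).  So B is unimodal,
    its peak n - V is O(sqrt n log n) because zeta(2) = c^2
    (zeta2_part_le, zeta2_part_ge), and it is flat on the scale n^(3/4).  At a
    maximiser of h the recursion forces h to be close to its maximum on average;
    comparing this average with B, and using that p is nondecreasing, h is close
    to its maximum at every y well below n^(3/4)
    (euler_sequence_flat).
    (euler_sequence_flat).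
    Given the ratios, inclusion-exclusion over the part sizes exceeding a bound
    compares the proportion of partitions without such parts with a product of
    factors 1 - e^(-tj) (erdos_lehner), conjugation turns the largest part into
    the number of parts, and a second moment computation gives the law of large
    numbers for a(kappa') = sum_i binom(k_i, 2) (triangle_sum_lln). *)

(** * Partitions containing a given multiset of parts *)

Section partition_counting.
Local Open Scope nat_scope.

Definition npart n := #|{: intpart n}|.

Definition npart_sub n s := if s <= n then npart (n - s) else 0.

Definition contains (mu s : seq nat) :=
  all (fun j => count_mem j mu <= count_mem j s) mu.

Lemma npart_gt0 n : 0 < npart n.
Proof. by apply/card_gt0P; exists point. Qed.

Lemma is_partition_sort s :
  all (leq 1) s -> is_partition (sumn s) (sort geq s).
Proof.
move=> s1; rewrite /is_partition sort_sorted; last first.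
  by move=> x y; rewrite /geq /= leq_total.
rewrite all_sort s1 /=; apply/eqP/perm_sumn.
by rewrite perm_sort.
Qed.

Lemma contains_perm mu s : contains mu s -> exists s', perm_eq s (mu ++ s').
Proof.
elim: mu s => [|j mu IH] s; first by exists s.
move=> /allP muS.
have count_le i : count_mem i (j :: mu) <= count_mem i s.
  have [/muS//|] := boolP (i \in j :: mu).
  by move/count_memPn ->.
have js : j \in s.
  have := count_le j; rewrite /= eqxx -has_pred1 has_count => lt.
  exact: leq_trans lt.
have sE := perm_to_rem js.
have [|s' s'E] := IH (rem j s).
  apply/allP => i _; have := count_le i.
  by rewrite (permP sE) /= leq_add2l.
by exists s'; rewrite (perm_trans sE)//= perm_cons.
Qed.

Lemma perm_contains mu s s' : perm_eq s (mu ++ s') -> contains mu s.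
Proof.
move=> sE; apply/allP => j _.
by rewrite (permP sE) count_cat leq_addr.
Qed.

Lemma intpart_eq n (k l : intpart n) : perm_eq k l -> k = l.
Proof.
case: k l => [s sP] [u uP] /= su; apply: val_inj => /=.
have tr : transitive geq by move=> x y z; rewrite /geq/= => /[swap]; exact: leq_trans.
apply: (sorted_eq tr) => //.
- by move=> x y; rewrite /geq /= => /andP[yx xy]; apply/eqP; rewrite eqn_leq xy yx.
- by case/and3P: sP.
- by case/and3P: uP.
Qed.

Lemma intpart_pos n (k : intpart n) : all (leq 1) k.
Proof. by case: k => s /= /and3P[]. Qed.

Lemma sumn_intpart n (k : intpart n) : sumn k = n.
Proof. by case: k => s /= /and3P[_ _ /eqP]. Qed.

(** Adjoining the parts of mu to a partition of n - |mu| is a bijection onto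
    the partitions of n that contain mu with multiplicity. *)
Lemma card_contains n mu : all (leq 1) mu ->
  #|[pred k : intpart n | contains mu k]| = npart_sub n (sumn mu).
Proof.
move=> mu1; rewrite /npart_sub; case: leqP => [le|gt]; last first.
  apply: eq_card0 => k; rewrite inE; apply/negP => /contains_perm[s sE].
  have := sumn_intpart k; rewrite (perm_sumn sE) sumn_cat => nE.
  by move: gt; rewrite -nE ltnNge leq_addr.
have fP (k : intpart (n - sumn mu)) : is_partition n (sort geq (mu ++ k)).
  have := @is_partition_sort (mu ++ k).
  rewrite all_cat mu1 intpart_pos sumn_cat sumn_intpart subnKC//.
  exact.
pose f k := IntPart (fP k).
have f_inj : injective f.
  move=> k l /(congr1 (@parts n)) /= kl; apply: intpart_eq.
  rewrite -(perm_cat2l mu) -(perm_sort geq) perm_sym -(perm_sort geq) perm_sym.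
  by rewrite kl.
rewrite /npart -(card_codom f_inj); apply: eq_card => k; rewrite inE.
apply/idP/idP => [/contains_perm[s sE]|/codomP[l ->]]; last first.
  by rewrite /= (@perm_contains _ _ l) // perm_sort.
have s1 : all (leq 1) s.
  by have := intpart_pos k; rewrite (perm_all _ sE) all_cat => /andP[].
have sumE : sumn s = n - sumn mu.
  by rewrite -(sumn_intpart k) (perm_sumn sE) sumn_cat addKn.
have := is_partition_sort s1; rewrite sumE => lP.
apply/codomP; exists (IntPart lP); apply: intpart_eq => /=.
rewrite perm_sym perm_sort perm_sym (perm_trans sE)// perm_cat2l perm_sym.
by rewrite perm_sort.
Qed.

Lemma contains_nseq l j (s : seq nat) :
  contains (nseq l j) s = (l <= count_mem j s).
Proof.
rewrite /contains all_nseq count_nseq /= eqxx mul1n.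
by case: l.
Qed.

Lemma contains_nseq2 l j l' j' (s : seq nat) : j != j' ->
  contains (nseq l j ++ nseq l' j') s =
  (l <= count_mem j s) && (l' <= count_mem j' s).
Proof.
move=> jj'; have j'j : (j' == j) = false by rewrite eq_sym (negbTE jj').
rewrite /contains all_cat !all_nseq !count_cat !count_nseq /= !eqxx.
rewrite ?(negbTE jj') ?j'j !mul1n !mul0n addn0 add0n.
by case: l l' => [|l] [|l'].
Qed.

Lemma sum_count_ge n j l : 0 < j ->
  \sum_(k : intpart n) (l <= count_mem j k : nat) = npart_sub n (j * l).
Proof.
move=> j0; have := @card_contains n (nseq l j).
rewrite all_nseq j0 orbT sumn_nseq => /(_ isT) <-.
rewrite -sum1_card [RHS]big_mkcond /=; apply: eq_bigr => k _.
by rewrite !inE contains_nseq; case: (_ <= _).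
Qed.

Lemma sum_count_ge2 n j l j' l' : 0 < j -> 0 < j' -> j != j' ->
  \sum_(k : intpart n) ((l <= count_mem j k) && (l' <= count_mem j' k) : nat)
  = npart_sub n (j * l + j' * l').
Proof.
move=> j0 j'0 jj'.
have := @card_contains n (nseq l j ++ nseq l' j').
rewrite all_cat !all_nseq j0 j'0 !orbT sumn_cat !sumn_nseq => /(_ isT) <-.
rewrite -sum1_card [RHS]big_mkcond /=; apply: eq_bigr => k _.
by rewrite !inE contains_nseq2//; case: (_ && _).
Qed.

Lemma intpart_mem_le n (k : intpart n) j : j \in (k : seq nat) -> 0 < j <= n.
Proof.
move=> jk; rewrite (allP (intpart_pos k))//=.
by rewrite -(nth_index 0 jk) intpart_nth_le.
Qed.

Lemma sum_parts n N (k : intpart n) (F : nat -> nat) : n <= N ->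
  \sum_(x <- k) F x = \sum_(1 <= j < N.+1) F j * count_mem j k.
Proof.
move=> nN.
have : {in (k : seq nat), forall j, 0 < j <= N}.
  by move=> j /intpart_mem_le /andP[-> jn]; exact: leq_trans nN.
elim: (k : seq nat) => [|x s IH] sn.
  by rewrite big_nil big1// => j _; rewrite muln0.
rewrite big_cons IH; last by move=> j js; apply: sn; rewrite inE js orbT.
have /andP[x0 xn] : 0 < x <= N by apply: sn; rewrite mem_head.
transitivity (\sum_(1 <= j < N.+1) (F j * (x == j) + F j * count_mem j s)).
  rewrite big_split/=; congr (_ + _).
  rewrite (bigD1_seq x) ?iota_uniq//=; last by rewrite mem_index_iota x0.
  rewrite eqxx muln1 big1 ?addn0// => j; rewrite eq_sym => /negbTE ->.
  by rewrite muln0.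
by apply: eq_bigr => j _; rewrite -mulnDr.
Qed.

Lemma count_intpart_le n (k : intpart n) j : count_mem j k <= n.
Proof. exact: leq_trans (count_size _ _) (intpart_size_le k). Qed.

Lemma sum_leq_count m n : m <= n -> \sum_(1 <= l < n.+1) (l <= m : nat) = m.
Proof.
move=> mn; rewrite (big_cat_nat (n := m.+1))//=.
rewrite (eq_big_nat _ _ (F2 := fun=> 1)); last first.
  by move=> i /andP[_]; rewrite ltnS => ->.
rewrite sum_nat_const_nat subn1 muln1 /= big_nat_cond big1 ?addn0// => i.
by rewrite andbT => /andP[mi _]; rewrite leqNgt mi.
Qed.

Lemma count_intpartE n N (k : intpart n) j : n <= N ->
  count_mem j k = \sum_(1 <= l < N.+1) (l <= count_mem j k : nat).
Proof. by move=> nN; rewrite sum_leq_count// (leq_trans (count_intpart_le _ _)). Qed.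

(** Counting pairs (kappa, part) with multiplicity gives Euler's recursion, in
    the form where the divisor sum is not yet collected. *)
Lemma npart_rec n N : n <= N ->
  n * npart n =
  \sum_(1 <= j < N.+1) \sum_(1 <= l < N.+1) j * npart_sub n (j * l).
Proof.
move=> nN; rewrite /npart -sum1_card big_distrr/=.
transitivity (\sum_(k : intpart n) \sum_(1 <= j < N.+1) j * count_mem j k).
  apply: eq_bigr => k _; rewrite muln1 -(sum_parts k id nN) -[LHS](sumn_intpart k).
  by rewrite sumnE.
rewrite exchange_big/=; apply: eq_big_nat => j /andP[j0 _].
rewrite -big_distrr -big_distrr/=; congr (_ * _).
under eq_bigr do rewrite (count_intpartE _ _ nN).
rewrite exchange_big/=; apply: eq_bigr => l _; exact: sum_count_ge.
Qed.

Lemma npart_le m n : m <= n -> npart m <= npart n.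
Proof.
move=> mn; have := @card_contains n (nseq (n - m) 1).
rewrite all_nseq orbT sumn_nseq mul1n => /(_ isT).
by rewrite /npart_sub leq_subr subKn// => <-; exact: max_card.
Qed.

End partition_counting.

(** * Conjugate partitions *)

Section conjugation.
Local Open Scope nat_scope.

Lemma geq_trans : transitive geq.
Proof. by move=> x y z; rewrite /geq/= => /[swap]; exact: leq_trans. Qed.

Lemma ltn_count_nth s i j : sorted geq s ->
  (i < count (fun k => j < k) s) = (j < nth 0 s i).
Proof.
elim: s i => [|x s IH] i //= xs; first by rewrite nth_nil.
have s_sorted := path_sorted xs.
have [jx|xj] := ltnP j x.
  by rewrite add1n; case: i => [|i] /=; rewrite ?jx ?ltnS ?IH.
have sx : all (fun y => y <= x) s.
  by have := order_path_min geq_trans xs.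
rewrite add0n (eq_in_count (a2 := pred0)); last first.
  by move=> y /(allP sx) yx /=; rewrite ltnNge (leq_trans yx).
rewrite count_pred0 ltn0; apply/esym/negbTE; rewrite -leqNgt.
case: i => [|i] //=; have [si|si] := ltnP i (size s); last by rewrite nth_default.
by apply: leq_trans xj; apply: (allP sx); exact: mem_nth.
Qed.

Lemma le_head s x : sorted geq s -> x \in s -> x <= head 0 s.
Proof.
case: s => //= y s ys; rewrite inE => /predU1P[->//|].
by move=> xs; have /allP/(_ x xs) := order_path_min geq_trans ys.
Qed.

(** Both sides count the cells of the Young diagram of s, a cell in column j with
    weight F j. *)
Lemma conj_parts_weighted s (F : nat -> nat) : sorted geq s ->
  \sum_(j < size (conj_parts s)) F j * nth 0 (conj_parts s) j =
  \sum_(x <- s) \sum_(j < x) F j.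
Proof.
move=> s_sorted; rewrite size_mkseq.
transitivity (\sum_(j < head 0 s) \sum_(x <- s) F j * (j < x)).
  apply: eq_bigr => j _; rewrite nth_mkseq// -big_distrr/=; congr (_ * _).
  by rewrite -sum1_count big_mkcond/=; apply: eq_bigr => x _; case: ltnP.
rewrite exchange_big/= big_seq [RHS]big_seq; apply: eq_bigr => x xs.
rewrite (big_ord_widen _ F (le_head s_sorted xs)) [RHS]big_mkcond /=.
by apply: eq_bigr => j _; case: ltnP; rewrite ?muln1 ?muln0.
Qed.

Lemma conj_is_partition n s : is_partition n s -> is_partition n (conj_parts s).
Proof.
move=> /and3P[s_sorted s1 /eqP sE]; apply/and3P; split.
- rewrite /conj_parts; apply: (homo_sorted (e := leq)); last exact: iota_sorted.
  move=> i j ij; rewrite /geq/=; apply: sub_count => k /=.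
  exact: leq_ltn_trans.
- apply/allP => x /mapP[j]; rewrite mem_iota add0n /= => js ->.
  rewrite -has_count; apply/hasP; exists (head 0 s) => //.
  by case: (s) js => //= y u _; exact: mem_head.
- rewrite -sE; apply/eqP; rewrite !sumnE.
  rewrite (big_nth 0 _ _ (r := conj_parts s)) big_mkord.
  transitivity (\sum_(j < size (conj_parts s)) 1 * nth 0 (conj_parts s) j).
    by apply: eq_bigr => j _; rewrite mul1n.
  rewrite (conj_parts_weighted (fun=> 1))//; apply: eq_bigr => x _.
  by rewrite sum1_card card_ord.
Qed.

Definition conj_part n (k : intpart n) : intpart n :=
  IntPart (conj_is_partition (partsP k)).

Lemma head_conj_part n (k : intpart n) : head 0 (conj_part k) = size k.
Proof.
case: k => s /= /and3P[s_sorted s1 _]; rewrite /conj_parts /mkseq.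
case: s s1 {s_sorted} => //= x s /andP[x0 s1]; case: x x0 => //= x _.
rewrite add1n; congr _.+1; apply/eqP; rewrite -all_count.
exact: s1.
Qed.

Lemma conj_partK n : involutive (@conj_part n).
Proof.
move=> k; apply: val_inj => /=.
apply: (@eq_from_nth _ 0) => [|i].
  by rewrite [LHS]size_mkseq (head_conj_part k).
rewrite [X in i < X]size_mkseq => ik; rewrite nth_mkseq// {ik}.
have /and3P[] := partsP k; move: (parts k) => s s_sorted _ _.
rewrite /conj_parts /mkseq count_map.
rewrite (eq_count (a2 := fun j => j < nth 0 s i)); last first.
  by move=> j /=; rewrite -ltn_count_nth.
rewrite -sum1_count big_mkcond /=.
have le : nth 0 s i <= head 0 s.
  have [si|si] := ltnP i (size s); last by rewrite nth_default.
  by apply: le_head => //; exact: mem_nth.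
rewrite -[X in iota 0 X]subn0 -/(index_iota 0 (head 0 s)).
rewrite -big_mkcond big_mkord /= -(big_ord_widen _ (fun=> 1) le).
by rewrite sum1_card card_ord.
Qed.

Lemma part_a_conj_part n (k : intpart n) :
  part_a (conj_part k) = \sum_(x <- k) 'C(x, 2).
Proof.
rewrite /part_a /= (conj_parts_weighted (fun j => j)); last by case/and3P: (partsP k).
by apply: eq_bigr => x _; rewrite -bin2_sum big_mkord.
Qed.

Lemma part_aE n (k : intpart n) :
  part_a k = \sum_(x <- conj_part k) 'C(x, 2).
Proof. by rewrite -part_a_conj_part conj_partK. Qed.

End conjugation.

(** * The sum of the inverse squares *)

Section basel.
Variable R : realType.
Implicit Types x : R.

Lemma sin_le_id x : 0 <= x -> sin x <= x.
Proof.
move=> x0; have [|z _] := @MVT_segment R sin cos 0 x x0.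
  exact/continuous_subspaceT/continuous_sin.
by rewrite sin0 !subr0 => ->; rewrite ler_piMl// cos_le1.
Qed.

Lemma id_le_tan x : 0 <= x < pi / 2 -> x <= tan x.
Proof.
move=> /andP[x0 xpi].
have cos_gt0 y : y \in `[0, x] -> 0 < cos y.
  move=> /itvP yx; apply: cos_gt0_pihalf.
  by rewrite (lt_le_trans _ (_ : 0 <= y)) ?yx ?oppr_lt0 ?divr_gt0 ?pi_gt0//=
    (le_lt_trans _ xpi) ?yx.
have tan_derive y : y \in `]0, x[ -> is_derive y 1 (@tan R) ((cos y) ^- 2).
  move=> /itvP yx; apply: is_derive_tan; rewrite gt_eqF// cos_gt0// in_itv/=.
  by rewrite !ltW ?yx.
have tan_cont : {within `[0, x], continuous (@tan R)}.
  apply/continuous_in_subspaceT => y -/[!(@mem_setE R)] yx.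
  by apply: continuous_tan; rewrite gt_eqF// cos_gt0.
have [z zx] := MVT_segment x0 tan_derive tan_cont.
rewrite tan0 !subr0 => ->; rewrite ler_peMl//.
rewrite -[X in X <= _]invr1 lef_pV2 ?posrE ?exprn_gt0 ?cos_gt0//.
Qed.
(** The two sides come from sin x <= x <= tan x. *)
Lemma inv_sin2_bounds x : 0 < x < pi / 2 ->
  x ^- 2 <= (sin x) ^- 2 <= x ^- 2 + 1.
Proof.
move=> /andP[x0 xpi].
have s0 : 0 < sin x by apply: sin_gt0_pihalf; rewrite x0.
have c0 : 0 < cos x.
  by apply: cos_gt0_pihalf; rewrite xpi (lt_trans _ x0)// oppr_lt0 divr_gt0 ?pi_gt0.
have sx := sin_le_id (ltW x0).
have xt : x <= tan x by apply: id_le_tan; rewrite ltW.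
apply/andP; split.
  rewrite lef_pV2 ?posrE ?exprn_gt0//.
  by apply: lerXn2r => //; rewrite nnegrE ltW.
have -> : (sin x) ^- 2 = (tan x) ^- 2 + 1.
  have := cos2Dsin2 x; move: s0 c0; rewrite /tan.
  set s := sin x; set c := cos x => s0 c0 sc.
  have -> : (s / c) ^- 2 + 1 = (c ^+ 2 + s ^+ 2) / s ^+ 2.
    by field; rewrite !gt_eqF.
  by rewrite sc mul1r.
rewrite lerD2r lef_pV2 ?posrE ?exprn_gt0//; last exact: lt_le_trans xt.
by apply: lerXn2r => //; rewrite nnegrE ltW// (lt_le_trans x0).
Qed.

Let angle n k : R := (k.*2.+1)%:R * pi / 2 ^+ n.+2.

Let angle_bounds n k : (k < 2 ^ n)%N -> 0 < angle n k < pi / 2.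
Proof.
have p0 := pi_gt0 R; have q0 : 0 < 2 ^+ n.+2 :> R by rewrite exprn_gt0.
move=> kn; rewrite /angle; apply/andP; split.
  by apply: divr_gt0 q0; rewrite mulr_gt0 ?ltr0n.
rewrite ltr_pdivrMr; last exact: q0.
have -> : pi / 2 * 2 ^+ n.+2 = 2 ^+ n.+1 * pi :> R.
  by rewrite [2 ^+ n.+2]exprS mulrA divfK// mulrC.
rewrite ltr_pM2r ?pi_gt0// -natrX ltr_nat expnS; lia.
Qed.

(** Iterating 4 / sin(2y)^2 = 1 / sin(y)^2 + 1 / sin(pi/2 - y)^2 from the single
    angle pi/4. *)
Let sum_inv_sin2 n :
  \sum_(0 <= k < 2 ^ n) (sin (angle n k)) ^- 2 = 2 * 4 ^+ n.
Proof.
elim: n => [|n IH].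
  rewrite big_nat1 /angle expr0 mulr1 double0 mul1r.
  have -> : pi / 2 ^+ 2 = pi / 2 / 2 :> R by rewrite expr2 invfM mulrA.
  have s2 : (sin (pi / 2 / 2) : R) ^+ 2 = 2^-1.
    have := cos_mulr2n (pi / 2 / 2 : R).
    rewrite -[pi / 2 / 2 *+ 2]mulr_natr divfK// cos_pihalf cos2sin2 => h; lra.
  by rewrite s2 invrK.
rewrite expnS mul2n -addnn (big_cat_nat (n := 2 ^ n)) ?leq_addr//=.
have shift F : \sum_(2 ^ n <= k < 2 ^ n + 2 ^ n) F k =
    \sum_(0 <= k < 2 ^ n) F (2 ^ n - k.+1 + 2 ^ n)%N :> R.
  by rewrite -{1}(add0n (2 ^ n)%N) big_addn addnK big_nat_rev /= add0n.
rewrite shift -big_split/= exprS mulrCA -IH mulr_sumr.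
apply: eq_big_nat => k /andP[_ kn].
set y := angle n.+1 k.
have xE : angle n k = y *+ 2.
  have : 2 ^+ n.+2 != 0 :> R by rewrite expf_neq0.
  rewrite /y /angle [2 ^+ n.+3]exprS -mulr_natr; set q : R := 2 ^+ n.+2 => q0.
  by field.
have -> : angle n.+1 (2 ^ n - k.+1 + 2 ^ n) = pi / 2 - y.
  rewrite /y /angle.
  have -> : ((2 ^ n - k.+1 + 2 ^ n).*2.+1)%:R = 2 ^+ n.+2 - k.*2.+1%:R :> R.
    apply/eqP; rewrite -natrX eq_sym subr_eq -natrD eqr_nat; apply/eqP.
    rewrite !expnS; lia.
  have : 2 ^+ n.+2 != 0 :> R by rewrite expf_neq0.
  by rewrite [2 ^+ n.+3]exprS; set q : R := 2 ^+ n.+2 => q0; field.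
have -> : sin (pi / 2 - y) = cos y by rewrite -cosBpihalf addrAC subrr sub0r cosN.
rewrite xE sin_mulr2n.
have := angle_bounds kn; rewrite xE => /andP[y0 ypi].
have sy : 0 < sin y.
  by apply: sin_gt0_pihalf; apply/andP; split; rewrite mulr2n in y0 ypi; lra.
have cy : 0 < cos y.
  by apply: cos_gt0_pihalf; apply/andP; split; rewrite mulr2n in y0 ypi; lra.
have := cos2Dsin2 y; move: sy cy; set s := sin y; set c := cos y => s0 c0 sc.
have -> : s ^- 2 + c ^- 2 = (c ^+ 2 + s ^+ 2) / (c ^+ 2 * s ^+ 2).
  by field; rewrite !gt_eqF.
rewrite sc; field; by rewrite !gt_eqF.
Qed.

Let odd_part n : R := \sum_(0 <= k < n) (k.*2.+1)%:R ^- 2.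

Let odd_part_bounds n :
  pi ^+ 2 / 8 - pi ^+ 2 / 16 / 2 ^+ n <= odd_part (2 ^ n) <= pi ^+ 2 / 8.
Proof.
have p0 : 0 < pi :> R := pi_gt0 R.
have q0 : 0 < 2 ^+ n :> R by rewrite exprn_gt0.
have E : \sum_(0 <= k < 2 ^ n) (angle n k) ^- 2 =
    16 * 4 ^+ n / pi ^+ 2 * odd_part (2 ^ n).
  rewrite mulr_sumr; apply: eq_bigr => k _; rewrite /angle.
  have -> : 16 * 4 ^+ n = (2 ^+ n.+2) ^+ 2 :> R.
    have -> : 4 = 2 ^+ 2 :> R by ring.
    by rewrite -exprM mulnC exprM !exprS; ring.
  have : 2 ^+ n.+2 != 0 :> R by rewrite expf_neq0.
  have : k.*2.+1%:R != 0 :> R by rewrite pnatr_eq0.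
  have : pi != 0 :> R by rewrite gt_eqF.
  set q : R := 2 ^+ n.+2; set m : R := _%:R => p' m' q'.
  clearbody q m; move: (pi : R) p' => P P0.
  by field; rewrite P0 m' q'.
have h1 : \sum_(0 <= k < 2 ^ n) (angle n k) ^- 2 <= 2 * 4 ^+ n.
  rewrite -sum_inv_sin2; apply: ler_sum_nat => k /andP[_ /angle_bounds kn].
  by have /andP[] := inv_sin2_bounds kn.
have h2 : 2 * 4 ^+ n <= \sum_(0 <= k < 2 ^ n) (angle n k) ^- 2 + 2 ^+ n.
  rewrite -sum_inv_sin2.
  have -> : 2 ^+ n = \sum_(0 <= k < 2 ^ n) (1 : R).
    by rewrite sumr_const_nat subn0 natrX.
  rewrite -big_split/=; apply: ler_sum_nat => k /andP[_ /angle_bounds kn].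
  by have /andP[] := inv_sin2_bounds kn.
rewrite E in h1 h2.
have q4 : 4 ^+ n = 2 ^+ n * 2 ^+ n :> R by rewrite -exprMn; congr (_ ^+ _); ring.
rewrite q4 in h1 h2; set q := 2 ^+ n in q0 h1 h2 *.
set o := odd_part _ in h1 h2 *.
have pp0 : 0 < pi ^+ 2 :> R by rewrite exprn_gt0.
set P := pi ^+ 2 in pp0 h1 h2 *.
have a0 : 0 < 16 * (q * q) / P by rewrite divr_gt0// !mulr_gt0.
apply/andP; split; rewrite -(ler_pM2l a0).
- have -> : 16 * (q * q) / P * (P / 8 - P / 16 / q) = 2 * (q * q) - q.
    by field; rewrite !gt_eqF.
  by rewrite lerBlDr.
- have -> : 16 * (q * q) / P * (P / 8) = 2 * (q * q) by field; rewrite !gt_eqF.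
  exact: h1.
Qed.

Definition zeta2_part n : R := \sum_(1 <= l < n.+1) l%:R ^- 2.

Let zeta2_partS n : zeta2_part n.+1 = zeta2_part n + n.+1%:R ^- 2.
Proof. by rewrite /zeta2_part big_nat_recr. Qed.

Lemma zeta2_part_ndecr m n : (m <= n)%N -> zeta2_part m <= zeta2_part n.
Proof.
move=> mn; rewrite /zeta2_part [leRHS](big_cat_nat (n := m.+1))//=.
by rewrite lerDl sumr_ge0// => i _; rewrite invr_ge0 exprn_ge0.
Qed.

Lemma zeta2_part_tail m n : (0 < m)%N -> (m <= n)%N ->
  zeta2_part n <= zeta2_part m + m%:R^-1.
Proof.
move=> m0 mn; rewrite /zeta2_part [leLHS](big_cat_nat (n := m.+1))//= lerD2l.
have : \sum_(m.+1 <= i < n.+1) (i%:R : R) ^- 2 <= m%:R^-1 - n%:R^-1.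
  have -> : (m%:R^-1 - n%:R^-1 : R) = - \sum_(m <= i < n) (i.+1%:R^-1 - i%:R^-1).
    by rewrite (telescope_sumr (fun i : nat => i%:R^-1 : R))// opprB.
  rewrite big_add1/= -sumrN; apply: ler_sum_nat => i /andP[mi _].
  have i0 : 0 < i%:R :> R by rewrite ltr0n (leq_trans m0).
  rewrite -subr_ge0 -(natr1 i); set x : R := i%:R in i0 *.
  have -> : - ((x + 1)^-1 - x^-1) - (x + 1) ^- 2 = (x * (x + 1) ^+ 2)^-1.
    by field; rewrite !gt_eqF// ltr_wpDl// ltW.
  by rewrite invr_ge0 mulr_ge0// ?exprn_ge0 ?addr_ge0// ltW.
by move=> /le_trans; apply; rewrite lerBlDr lerDl.
Qed.

Let zeta2_part_double n :
  zeta2_part n.*2 = odd_part n + zeta2_part n / 4.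
Proof.
elim: n => [|n IH]; first by rewrite /zeta2_part /odd_part !big_geq// mul0r addr0.
rewrite doubleS !zeta2_partS IH /odd_part big_nat_recr//=.
rewrite mulrDl [RHS]addrACA -!addrA; congr (_ + _); congr (_ + _); congr (_ + _).
have -> : n.*2.+2%:R = 2 * n.+1%:R :> R by rewrite -natrM; congr (_ %:R); lia.
have n0 : n.+1%:R != 0 :> R by rewrite pnatr_eq0.
by field.
Qed.

Let pow2_ge n : (n <= 2 ^ n)%N. Proof. exact/ltnW/ltn_expl. Qed.

(** Basel, upper half: odd_part n = zeta2_part n.*2 - zeta2_part n / 4 stays
    below pi^2/8. *)
Lemma zeta2_part_le n : zeta2_part n <= pi ^+ 2 / 6.
Proof.
have o_le : odd_part n <= pi ^+ 2 / 8.
  have /andP[_] := odd_part_bounds n; apply: le_trans.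
  rewrite /odd_part [leRHS](big_cat_nat (n := n)) ?pow2_ge//=.
  by rewrite lerDl sumr_ge0// => i _; rewrite invr_ge0 exprn_ge0.
have := zeta2_part_ndecr (leq_addr n n); rewrite addnn zeta2_part_double.
move: o_le; lra.
Qed.

Lemma zeta2_part_ge n : (0 < n)%N -> pi ^+ 2 / 6 - 8 / n%:R <= zeta2_part n.
Proof.
move=> n0; set m := (2 ^ n)%N.
have m0 : (0 < m)%N by rewrite expn_gt0.
have nm : (n <= m)%N := pow2_ge n.
have h1 : zeta2_part m <= zeta2_part n + n%:R^-1 by exact: zeta2_part_tail.
have h2 : zeta2_part m.*2 <= zeta2_part m + m%:R^-1.
  by apply: zeta2_part_tail => //; lia.
rewrite zeta2_part_double in h2.
have /andP[h3 _] := odd_part_bounds n; rewrite -natrX -/m in h3.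
have mnV : m%:R^-1 <= n%:R^-1 :> R by rewrite lef_pV2 ?posrE ?ltr0n// ler_nat.
have m'0 : 0 < m%:R^-1 :> R by rewrite invr_gt0 ltr0n.
have p16 : pi ^+ 2 <= 16 :> R.
  have -> : 16 = 4 ^+ 2 :> R by ring.
  rewrite lerXn2r ?nnegrE ?pi_ge0//.
  by have := pihalf_lt2 R; lra.
have : pi ^+ 2 / 16 / m%:R <= n%:R^-1 :> R.
  apply: le_trans mnV; apply: ler_piMl; [exact: ltW | move: p16; lra].
lra.
Qed.

End basel.

(** * Truncated exponential sums *)

Section exponential_sums.
Variable R : realType.
Implicit Types (x y q : R) (r D n : nat).

(** This is sinh (x / 2) >= x / 2. The exponent x / 2 is what later bounds
    e^x / (e^x - 1)^2 by x^(-2) without any error term. *)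
Lemma expR_sub1_ge x : 0 <= x -> x * expR (x / 2) <= expR x - 1.
Proof.
move=> x0; set y := x / 2; have y0 : 0 <= y by rewrite divr_ge0.
have xE : x = y + y by rewrite /y -splitr.
have key : 2 * y <= expR y - expR (- y).
  pose f (z : R) := expR z - expR (- z).
  have f_derive (z : R) : is_derive z 1 f (expR z + expR (- z)).
    rewrite /f; apply: is_derive_eq; rewrite /GRing.scale/=; ring.
  have f_cont : {within `[0, y], continuous f}.
    apply: continuous_subspaceT => z; rewrite /f.
    apply: continuousB; first exact: continuous_expR.
    apply: continuous_comp; last exact: continuous_expR.
    exact: opp_continuous.
  have [z _] := MVT_segment y0 (fun z _ => f_derive z) f_cont.
  rewrite /f oppr0 subrr !subr0 => ->.
  rewrite addr0 ler_wpM2r//.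
  have := expR_gt0 z; rewrite expRN; set a := expR z => a0.
  rewrite -subr_ge0; have -> : a + a^-1 - 2 = (a - 1) ^+ 2 / a.
    by field; rewrite gt_eqF.
  by rewrite divr_ge0 ?sqr_ge0 ?ltW.
have a0 := expR_gt0 y; have := ler_wpM2r (ltW a0) key.
have -> : expR x = expR y * expR y by rewrite xE expRD.
rewrite -/y expRN mulrBl mulVf ?gt_eqF// xE.
by set a := expR y => h; move: h; lra.
Qed.

Lemma powM_expRN_le u k : 0 <= u -> u ^+ k * expR (- u) <= k`!%:R :> R.
Proof.
move=> u0; rewrite expRN ler_pdivrMr ?expR_gt0//.
case: k => [|k]; first by rewrite expr0 mul1r -[leLHS]expR0 ler_expR.
rewrite mulrC -ler_pdivrMr ?ltr0n ?fact_gt0//.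
by apply: le_trans (expR_ge1Dxn _ u0); rewrite ler_wpDl.
Qed.

Lemma expRN_le_pow u k : 0 < u -> expR (- u) <= k`!%:R / u ^+ k :> R.
Proof.
move=> u0; rewrite ler_pdivlMr ?exprn_gt0// mulrC.
exact/powM_expRN_le/ltW.
Qed.

Lemma geometric_expR_le y D : 0 < y ->
  \sum_(1 <= d < D) expR (- (y * d%:R)) <= y^-1.
Proof.
move=> y0; case: D => [|D]; first by rewrite big_geq// invr_ge0 ltW.
rewrite -[leRHS]mul1r ler_pdivlMr// big_add1/= mulr_suml.
have h d : expR (- (y * d.+1%:R)) * y <=
    - (expR (- (y * d.+1%:R)) - expR (- (y * d%:R))).
  rewrite opprB -(natr1 d) mulrDr mulr1 opprD expRD.
  set a := expR (- (y * d%:R)).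
  have a0 : 0 <= a by rewrite expR_ge0.
  rewrite -mulrA -[X in _ <= X - _]mulr1 -mulrBr ler_wpM2l//.
  rewrite expRN -subr_ge0 [X in 0 <= X](_ : _ = (expR y - 1 - y) / expR y).
    by rewrite divr_ge0 ?expR_ge0// -addrA -opprD subr_ge0 expR_ge1Dx.
  by field; rewrite gt_eqF ?expR_gt0.
apply: le_trans (ler_sum _ (fun d _ => h d)) _.
rewrite sumrN (telescope_sumr (fun d : nat => expR (- (y * d%:R))))//.
by rewrite opprB mulr0 oppr0 expR0 gerBl expR_ge0.
Qed.

(** Half of the exponential absorbs the power of d, the other half is summed. *)
Lemma pow_expR_sum_le x r D : 0 < x ->
  \sum_(1 <= d < D) d%:R ^+ r * expR (- (x * d%:R)) <=
  2 ^+ r.+1 * r`!%:R / x ^+ r.+1.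
Proof.
move=> x0; have x20 : 0 < x / 2 by rewrite divr_gt0.
have xr0 : 0 < (x / 2) ^+ r by rewrite exprn_gt0.
have h d : d%:R ^+ r * expR (- (x * d%:R)) <=
    r`!%:R / (x / 2) ^+ r * expR (- (x / 2 * d%:R)).
  have -> : x * d%:R = x / 2 * d%:R + x / 2 * d%:R by rewrite -mulrDl -splitr.
  rewrite opprD expRD mulrA ler_wpM2r ?expR_ge0// ler_pdivlMr//.
  rewrite mulrAC -exprMn [d%:R * _]mulrC.
  by apply: powM_expRN_le; rewrite mulr_ge0// ltW.
apply: le_trans (ler_sum _ (fun d _ => h d)) _; rewrite -mulr_sumr.
apply: le_trans (ler_wpM2l _ (geometric_expR_le D x20)) _.
  by rewrite divr_ge0// ltW.
rewrite le_eqVlt; apply/orP; left; apply/eqP.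
rewrite expr_div_n !exprS; have : 2 ^+ r != 0 :> R by rewrite expf_neq0.
have : x ^+ r != 0 by rewrite expf_neq0 ?gt_eqF.
set a := x ^+ r; set b : R := 2 ^+ r; clearbody a b => a0 b0.
by field; rewrite a0 b0 gt_eqF.
Qed.

Lemma leq_bin_exp n k : ('C(n, k) <= n ^ k)%N.
Proof.
elim: n k => [|n IH] [|k]; rewrite ?bin0 ?expn0 ?bin0n//.
rewrite binS (leq_trans (leq_add (IH _) (IH _)))// expnS [(n.+1 ^ k.+1)%N]expnS.
rewrite -mulSnr leq_mul2l/=; case: k => // k; by rewrite leq_exp2r.
Qed.

(** Pascal's rule, summed by parts; the last term is the truncation error. *)
Lemma binomial_gen_rec q r D :
  (1 - q) * \sum_(0 <= j < D.+1) 'C(j, r.+1)%:R * q ^+ j =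
  q * \sum_(0 <= j < D) 'C(j, r)%:R * q ^+ j - 'C(D, r.+1)%:R * q ^+ D.+1.
Proof.
elim: D => [|D IH].
  by rewrite big_nat1 big_geq// bin0n mulr0 !mul0r mulr0 subr0.
rewrite big_nat_recr//= mulrDr IH [in RHS]big_nat_recr//= binS natrD.
rewrite !exprS; ring.
Qed.

(** Truncations of sum_j binom(j, r) q^j = q^r / (1 - q)^(r+1). *)
Lemma binomial_gen_le q r D : 0 <= q <= 1 ->
  (1 - q) ^+ r.+1 * \sum_(0 <= j < D) 'C(j, r)%:R * q ^+ j <= q ^+ r.
Proof.
move=> /andP[q0 q1]; have q1' : 0 <= 1 - q by rewrite subr_ge0.
elim: r D => [|r IH] D.
  under eq_bigr do rewrite bin0 mul1r.
  elim: D => [|D IH]; first by rewrite big_geq// mulr0.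
  rewrite expr1 big_nat_recl//= expr0; under eq_bigr do rewrite exprS.
  rewrite -mulr_sumr mulrDr mulr1 mulrCA; move: IH; rewrite expr1 expr0 => IH.
  by have := ler_wpM2l q0 IH; rewrite mulr1; lra.
case: D => [|D]; first by rewrite big_geq// mulr0 exprn_ge0.
rewrite exprSr -mulrA binomial_gen_rec.
apply: (@le_trans _ _ (q * ((1 - q) ^+ r.+1 * 
  \sum_(0 <= j < D) 'C(j, r)%:R * q ^+ j))).
  rewrite [leRHS]mulrCA; apply: ler_wpM2l; first by rewrite exprn_ge0.
  by rewrite gerBl mulr_ge0// exprn_ge0.
by rewrite [leRHS]exprS; apply: ler_wpM2l.
Qed.

Lemma binomial_gen_ge q r D : 0 <= q <= 1 ->
  q ^+ r - r.+1%:R * D.+1%:R ^+ r * q ^+ D.+1 <=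
  (1 - q) ^+ r.+1 * \sum_(0 <= j < D.+1) 'C(j, r)%:R * q ^+ j.
Proof.
move=> /andP[q0 q1]; have q1' : 0 <= 1 - q by rewrite subr_ge0.
elim: r D => [|r IH] D.
  rewrite !expr0 !mul1r expr1; under eq_bigr do rewrite bin0 mul1r.
  elim: D => [|D IH]; first by rewrite big_nat1 expr0 mulr1 expr1.
  by rewrite big_nat_recr//= mulrDr [q ^+ D.+2]exprS; move: IH; lra.
case: D => [|D].
  rewrite big_nat1 bin0n mul0r mulr0 expr1n mulr1 expr1 subr_le0 exprS mulrC.
  by rewrite ler_wpM2r// (le_trans (exprn_ile1 _ q0 q1))// ler1n.
rewrite [X in _ <= X * _]exprSr -[leRHS]mulrA binomial_gen_rec mulrBr.
have Sr : ('C(D.+1, r.+1) + r.+1 * D.+1 ^ r <= r.+2 * D.+2 ^ r.+1)%N.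
  rewrite [X in (_ <= X)%N]mulSn; apply: leq_add.
    by apply: leq_trans (leq_bin_exp _ _) _; rewrite leq_exp2r.
  rewrite leq_mul2l/= expnS; case: r {IH} => [|r]; first by rewrite !expn0.
  by rewrite (leq_trans (_ : _ <= D.+2 ^ r.+1)%N) ?leq_exp2r// leq_pmull.
have {Sr} : 'C(D.+1, r.+1)%:R + r.+1%:R * D.+1%:R ^+ r <=
    r.+2%:R * D.+2%:R ^+ r.+1 :> R.
  by rewrite -!natrX -!natrM -natrD ler_nat.
have Q0 : 0 <= q ^+ D.+2 by rewrite exprn_ge0.
move=> /(ler_wpM2r Q0) Sr.
have h1 := ler_wpM2l q0 (IH D).
have h2 : (1 - q) ^+ r.+1 * ('C(D.+1, r.+1)%:R * q ^+ D.+2) <=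
    'C(D.+1, r.+1)%:R * q ^+ D.+2.
  apply: ler_piMl; first exact: mulr_ge0.
  by apply: exprn_ile1 => //; rewrite gerBl.
rewrite [X in _ <= X - _]mulrCA.
move: h1 Sr h2; rewrite !exprS; lra.
Qed.

End exponential_sums.

(** * Sums over pairs and over divisors *)

Section double_sums.
Variable R : realType.
Implicit Types (x t u : R) (r D n k : nat).

Lemma binomial_expR_le x r D : 0 < x -> (0 < r)%N ->
  \sum_(0 <= j < D) 'C(j, r)%:R * expR (- (x * j%:R)) <= x ^- r.+1.
Proof.
move=> x0 r0; set q := expR (- x).
have qj j : expR (- (x * j%:R)) = q ^+ j by rewrite /q -expRM_natr mulNr.
under eq_bigr do rewrite qj.
have q0 : 0 < q := expR_gt0 _.
have q1 : q < 1 by rewrite /q expR_lt1 oppr_lt0.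
have q1' : 0 < 1 - q by rewrite subr_gt0.
have q01 : 0 <= q <= 1 by rewrite !ltW.
have h := binomial_gen_le r D q01.
have key : x * expR (- x / 2) <= 1 - q.
  have := ler_wpM2r (ltW q0) (expR_sub1_ge (ltW x0)).
  rewrite -mulrA -expRD mulrBl mul1r /q expRxMexpNx_1.
  by rewrite (_ : x / 2 - x = - x / 2)//; lra.
rewrite -[leRHS]mul1r ler_pdivlMr ?exprn_gt0//.
set S := \sum_(_ <= _ < _) _ in h *.
have S0 : 0 <= S by apply: sumr_ge0 => j _; rewrite mulr_ge0// exprn_ge0// ltW.
have y0 : 0 <= x * expR (- x / 2) by rewrite mulr_ge0 ?expR_ge0// ltW.
have h1 : (x * expR (- x / 2)) ^+ r.+1 * S <= q ^+ r.
  apply: le_trans h; apply: ler_wpM2r => //.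
  by apply: lerXn2r; rewrite ?nnegrE// (le_trans y0).
have h2 : q ^+ r <= expR (- x / 2) ^+ r.+1.
  rewrite /q -!expRM_natr ler_expR -!mulrA mulNr mulNr lerN2.
  rewrite ler_wpM2l ?(ltW x0)// -[r.+1]addn1 natrD.
  by have : 1 <= r%:R :> R; [rewrite ler1n|lra].
have := le_trans h1 h2; rewrite exprMn mulrAC -[leRHS]mul1r.
by rewrite ler_pM2r ?exprn_gt0 ?expR_gt0// mulrC.
Qed.

Lemma binomial_expR_ge x r D : 0 < x ->
  (1 - r%:R * x - r.+1%:R * D.+1%:R ^+ r * expR (- (x * D.+1%:R))) * x ^- r.+1
  <= \sum_(0 <= j < D.+1) 'C(j, r)%:R * expR (- (x * j%:R)).
Proof.
move=> x0; set q := expR (- x).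
have qj j : expR (- (x * j%:R)) = q ^+ j by rewrite /q -expRM_natr mulNr.
under eq_bigr do rewrite qj.
have q0 : 0 < q := expR_gt0 _.
have q1 : q < 1 by rewrite /q expR_lt1 oppr_lt0.
have q1' : 0 < 1 - q by rewrite subr_gt0.
have q01 : 0 <= q <= 1 by rewrite !ltW.
have h := binomial_gen_ge r D q01.
set S := \sum_(_ <= _ < _) _ in h *.
have S0 : 0 <= S by apply: sumr_ge0 => j _; rewrite mulr_ge0// exprn_ge0// ltW.
rewrite ler_pdivrMr ?exprn_gt0// qj.
have q1x : 1 - q <= x by rewrite /q; have := expR_ge1Dx (- x); lra.
have h1 : (1 - q) ^+ r.+1 * S <= S * x ^+ r.+1.
  rewrite mulrC; apply: ler_wpM2l => //.
  by apply: lerXn2r; rewrite ?nnegrE// ltW.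
apply: le_trans (le_trans h h1); rewrite lerD2r.
rewrite /q -expRM_natr; apply: le_trans (expR_ge1Dx _).
by rewrite mulNr mulrC.
Qed.

Lemma binomial_pairs_le t r n D : 0 < t -> (0 < r)%N ->
  \sum_(1 <= l < n.+1) \sum_(0 <= j < D)
    'C(j, r)%:R * expR (- (t * l%:R * j%:R))
  <= t ^- r.+1 * \sum_(1 <= l < n.+1) l%:R ^- r.+1.
Proof.
move=> t0 r0; rewrite mulr_sumr; apply: ler_sum_nat => l /andP[l0 _].
rewrite -invfM -exprMn; apply: binomial_expR_le => //.
by rewrite mulr_gt0// ltr0n.
Qed.

Lemma binomial_pairs_ge t r n : 0 < t ->
  t ^- r.+1 * ((1 - r.+1%:R * n.+1%:R ^+ r * expR (- (t * n%:R)))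
      * (\sum_(1 <= l < n.+1) l%:R ^- r.+1)
    - r%:R * t * (\sum_(1 <= l < n.+1) l%:R ^- r))
  <= \sum_(1 <= l < n.+1) \sum_(0 <= j < n.+1)
    'C(j, r)%:R * expR (- (t * l%:R * j%:R)).
Proof.
move=> t0; rewrite !mulr_sumr -sumrB mulr_sumr.
apply: ler_sum_nat => l /andP[l0 _].
have l1 : 1 <= l%:R :> R by rewrite ler1n.
have l0' : 0 < l%:R :> R by rewrite ltr0n.
apply: le_trans (binomial_expR_ge r n (mulr_gt0 t0 l0')).
rewrite [in leRHS]exprMn invfM [leRHS]mulrC -[leRHS]mulrA.
rewrite ler_wpM2l ?invr_ge0 ?exprn_ge0 ?(ltW t0)//.
have -> : l%:R ^- r = l%:R * l%:R ^- r.+1 :> R.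
  by rewrite exprS invfM mulrA divff ?mul1r// gt_eqF.
set a := l%:R ^- r.+1.
have a0 : 0 <= a by rewrite invr_ge0 exprn_ge0// ltW.
have -> : r%:R * t * (l%:R * a) = a * (r%:R * (t * l%:R)) by ring.
rewrite [X in X - _]mulrC -mulrBr ler_wpM2l// addrAC lerD2l lerN2.
rewrite ler_wpM2l ?mulr_ge0 ?exprn_ge0// ler_expR lerN2 -mulrA.
rewrite ler_wpM2l ?(ltW t0)//.
apply: (@le_trans _ _ (1 * n.+1%:R)); first by rewrite mul1r ler_nat.
by rewrite ler_wpM2r.
Qed.

Lemma harmonic_sum_le n : (0 < n)%N ->
  \sum_(1 <= l < n.+1) l%:R^-1 <= 1 + ln n%:R :> R.
Proof.
case: n => // n _; elim: n => [|n IH]; first by rewrite big_nat1 invr1 ln1 addr0.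
rewrite big_nat_recr//=; apply: le_trans (lerD IH (lexx _)) _.
rewrite -addrA lerD2l addrC -lerBrDr.
have n1 : 0 < n.+1%:R :> R by rewrite ltr0n.
have n2 : 0 < n.+2%:R :> R by rewrite ltr0n.
have := @le_ln1Dx R (- n.+2%:R^-1).
rewrite ltrN2 invf_lt1// ltr1n => /(_ isT).
have -> : 1 - n.+2%:R^-1 = n.+1%:R / n.+2%:R :> R.
  rewrite -[n.+2]addn1 natrD; move: n1; set a : R := n.+1%:R; clearbody a => a0.
  by field; rewrite gt_eqF// ltr_wpDr.
rewrite ln_div ?posrE// => h; rewrite -lerN2 opprB; exact: h.
Qed.

Definition divsum n s :=
  (\sum_(1 <= j < n.+1) \sum_(1 <= l < n.+1) j * (j * l == s))%N.

Lemma sum_divsum n (G : nat -> R) :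
  \sum_(1 <= s < n.+1) (divsum n s)%:R * G s =
  \sum_(1 <= l < n.+1) \sum_(1 <= j < n.+1 | (j * l <= n)%N)
    j%:R * G (j * l)%N.
Proof.
transitivity (\sum_(1 <= s < n.+1) \sum_(1 <= j < n.+1) \sum_(1 <= l < n.+1)
    j%:R * ((j * l)%N == s)%:R * G s).
  apply: eq_bigr => s _; rewrite /divsum natr_sum mulr_suml.
  apply: eq_bigr => j _; rewrite natr_sum mulr_suml; apply: eq_bigr => l _.
  by rewrite natrM.
rewrite exchange_big/= [RHS](exchange_big_dep_nat xpredT)//=.
apply: eq_big_nat => j /andP[j0 _].
rewrite exchange_big/= [RHS]big_mkcond/=; apply: eq_big_nat => l /andP[l0 _].
case: ifP => [jln|jln].
  rewrite (bigD1_seq (j * l)%N) ?iota_uniq//=; last first.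
    by rewrite mem_index_iota ltnS jln muln_gt0 j0 l0.
  rewrite eqxx mulr1 big1 ?addr0// => s; rewrite eq_sym => /negbTE ->.
  by rewrite mulr0 mul0r.
rewrite big_nat big1// => s /andP[_ sn]; case: eqP => [e|]; last by rewrite mulr0 mul0r.
by rewrite -e ltnS jln in sn.
Qed.

Lemma divsum_ge n s : (0 < s <= n)%N -> (s <= divsum n s)%N.
Proof.
move=> /andP[s0 sn]; rewrite /divsum (bigD1_seq s) ?iota_uniq//=; last first.
  by rewrite mem_index_iota s0 ltnS sn.
rewrite (bigD1_seq 1%N) ?iota_uniq//=; last first.
  by rewrite mem_index_iota /=; exact: leq_trans s0 sn.
by rewrite muln1 eqxx muln1 -addnA leq_addr.
Qed.

(** The weights sigma(s) e^(-ts) of Euler's recursion; divsum n s is the divisor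
    sum of s as long as s <= n. *)
Definition wt n t s : R := (divsum n s)%:R * expR (- (t * s%:R)).

Lemma wt_ge0 n t s : 0 <= wt n t s.
Proof. by rewrite mulr_ge0 ?expR_ge0. Qed.

Lemma wt_moment_le n t k : 0 < t ->
  \sum_(1 <= s < n.+1) s%:R ^+ k * wt n t s <=
  2 ^+ k.+2 * (k.+1)`!%:R * (pi ^+ 2 / 6) / t ^+ k.+2.
Proof.
move=> t0.
under eq_bigr do rewrite mulrCA.
rewrite sum_divsum.
apply: (@le_trans _ _ (\sum_(1 <= l < n.+1)
   2 ^+ k.+2 * (k.+1)`!%:R / t ^+ k.+2 * l%:R ^- 2)); last first.
  rewrite -mulr_sumr.
  rewrite [leRHS]mulrAC ler_wpM2l//; last exact: zeta2_part_le.
  by rewrite divr_ge0// exprn_ge0// ltW.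
apply: ler_sum_nat => l /andP[l0 _].
have l0' : 0 < l%:R :> R by rewrite ltr0n.
have h := @pow_expR_sum_le R (t * l%:R) k.+1 n.+1 (mulr_gt0 t0 l0').
have {h} := ler_wpM2l (exprn_ge0 k (ltW l0')) h.
rewrite mulr_sumr exprMn invfM.
have -> : l%:R ^+ k * (2 ^+ k.+2 * k.+1`!%:R * (t ^- k.+2 * l%:R ^- k.+2)) =
   2 ^+ k.+2 * k.+1`!%:R / t ^+ k.+2 * l%:R ^- 2 :> R.
  have : l%:R ^+ k != 0 :> R by rewrite expf_neq0// gt_eqF.
  have : t ^+ k != 0 by rewrite expf_neq0// gt_eqF.
  move: (gt_eqF l0') (gt_eqF t0); rewrite !exprS; set L : R := l%:R.
  set a := L ^+ k; set b := t ^+ k; set p : R := 2 ^+ k.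
  clearbody L a b p => /negbT L0 /negbT T0 a0 b0; field.
  by rewrite L0 T0 a0 b0.
apply: le_trans; rewrite big_mkcond; apply: ler_sum_nat => j _.
case: ifP => _; last by rewrite !mulr_ge0 ?exprn_ge0 ?expR_ge0.
have -> : t * (j * l)%:R = t * l%:R * j%:R by rewrite natrM; ring.
rewrite natrM exprMn exprS.
by rewrite [leLHS](_ : _ = l%:R ^+ k *
  (j%:R * j%:R ^+ k * expR (- (t * l%:R * j%:R))))//; ring.
Qed.

(** Sharp, with no error term: this is what makes n - V nonnegative for
    t = c / sqrt n. *)
Lemma wt_sum_le n t : 0 < t ->
  \sum_(1 <= s < n.+1) wt n t s <= pi ^+ 2 / 6 / t ^+ 2.
Proof.
move=> t0; rewrite sum_divsum.
apply: (@le_trans _ _ (t ^- 2 * zeta2_part R n)); last first.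
  by rewrite mulrC ler_wpM2r ?zeta2_part_le// invr_ge0 exprn_ge0// ltW.
apply: le_trans (binomial_pairs_le (r := 1) n n.+1 t0 isT).
apply: ler_sum_nat => l /andP[l0 _].
rewrite big_mkcond [leRHS]big_ltn// bin0n mul0r add0r.
apply: ler_sum_nat => j _; case: ifP => _; last by rewrite mulr_ge0 ?expR_ge0.
have -> : t * (j * l)%:R = t * l%:R * j%:R by rewrite natrM; ring.
by rewrite bin1.
Qed.

(** Exponential Markov inequality, with the tilt u at our disposal. *)
Lemma wt_sum_trunc_le n t u z : 0 < t -> 0 < u -> (z <= n)%N ->
  \sum_(1 <= s < z.+1) wt n t s <=
  expR (u * z%:R) * (pi ^+ 2 / 6 / (t + u) ^+ 2).
Proof.
move=> t0 u0 zn.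
apply: (@le_trans _ _ (expR (u * z%:R) * \sum_(1 <= s < n.+1) wt n (t + u) s)).
  rewrite [X in _ <= _ * X](big_cat_nat (n := z.+1))//= mulrDr mulr_sumr.
  rewrite ler_wpDr ?mulr_ge0 ?expR_ge0 ?sumr_ge0// => [s _|]; first exact: wt_ge0.
  apply: ler_sum_nat => s /andP[_ sz].
  rewrite /wt mulrCA ler_wpM2l// -expRD ler_expR mulrDl opprD addrCA lerDl.
  by rewrite subr_ge0 ler_wpM2l ?(ltW u0)// ler_nat.
by rewrite ler_wpM2l ?expR_ge0// wt_sum_le// addr_gt0.
Qed.

(** The pairs j l > n lost by truncation cost half of the exponent. *)
Lemma wt_sum_ge n t : 0 < t ->
  t ^- 2 * ((1 - 2 * n.+1%:R * expR (- (t * n%:R))) * zeta2_part R n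
    - t * (\sum_(1 <= l < n.+1) l%:R^-1))
  - expR (- (t / 2 * n%:R)) * (pi ^+ 2 / 6 / (t / 2) ^+ 2)
  <= \sum_(1 <= s < n.+1) wt n t s.
Proof.
move=> t0; rewrite sum_divsum lerBlDr.
have := binomial_pairs_ge 1 n t0; rewrite mul1r expr1 => /le_trans; apply.
have t20 : 0 < t / 2 by rewrite divr_gt0.
apply: (@le_trans _ _ (\sum_(1 <= l < n.+1) \sum_(1 <= j < n.+1 | (j * l <= n)%N)
    j%:R * expR (- (t * (j * l)%:R)) + expR (- (t / 2 * n%:R)) *
   \sum_(1 <= l < n.+1) \sum_(0 <= j < n.+1)
    'C(j, 1)%:R * expR (- (t / 2 * l%:R * j%:R)))); last first.
  rewrite lerD2l ler_wpM2l ?expR_ge0//.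
  apply: le_trans (binomial_pairs_le (r := 1) n n.+1 t20 isT) _.
  by rewrite mulrC ler_wpM2r ?zeta2_part_le// invr_ge0 exprn_ge0// ltW.
rewrite mulr_sumr -big_split/=; apply: ler_sum_nat => l _.
rewrite big_ltn// bin0n mul0r add0r mulr_sumr [in leRHS]big_mkcond/=.
rewrite [X in _ <= _ + X]big_ltn// bin0n mul0r mulr0 add0r -big_split/=.
apply: ler_sum_nat => j _; rewrite bin1.
have E : t * (j * l)%:R = t * l%:R * j%:R by rewrite natrM; ring.
case: ifP => [_|jln].
  by rewrite E lerDl !mulr_ge0 ?expR_ge0.
rewrite add0r mulrCA ler_wpM2l// -expRD ler_expR -opprD lerN2 -E.
have -> : t / 2 * l%:R * j%:R = t / 2 * (j * l)%:R by rewrite natrM; ring.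
rewrite [leRHS](_ : _ = t / 2 * (j * l)%:R + t / 2 * (j * l)%:R); last first.
  by rewrite -mulrDl -splitr.
by rewrite lerD2r ler_wpM2l ?(ltW t20)// ler_nat ltnW// ltnNge jln.
Qed.

End double_sums.

(** * Flatness of the solutions of Euler's recursion *)

Section smoothing.
Variable R : realType.

Definition tail n (v : nat -> R) x : R := \sum_(x.+1 <= s < n.+1) v s.

Definition smoothed n (v h : nat -> R) y : R :=
  \sum_(0 <= x < n.+1) tail n v x * h (y + x)%N.

(** What the flatness argument uses of h y = p(n - y) e^(-t (n - y)) and
    v s = sigma(s) e^(-ts), with r standing for sqrt n and ys for a maximiser of
    h. The constants C and eta must not depend on n. *)
Record euler_sequence (C eta : R) n (r t : R) (v h : nat -> R) (M : R) ys : Prop :=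
  EulerSequence {
  es_r : 1 <= r;
  es_n : n%:R = r ^+ 2;
  es_t : 0 <= t;
  es_tr : t * r <= 2;
  es_v0 : forall s, 0 <= v s;
  es_h0 : forall y, 0 <= h y;
  es_rec : forall y,
    \sum_(1 <= s < n.+1) v s * h (y + s)%N = (n%:R - y%:R) * h y;
  es_mono : forall y i, h (y + i)%N <= expR (t * i%:R) * h y;
  es_V : r ^+ 2 / 2 <= \sum_(1 <= s < n.+1) v s <= r ^+ 2;
  es_tau1 : \sum_(1 <= s < n.+1) s%:R * v s <= C * r ^+ 3;
  es_tau2 : \sum_(1 <= s < n.+1) s%:R ^+ 2 * v s <= C * r ^+ 4;
  es_vlow : forall s, (0 < s <= n)%N -> s%:R * expR (- (t * s%:R)) <= v s;
  es_trunc : forall z, (z <= n)%N -> z%:R <= eta * r ->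
    \sum_(1 <= s < z.+1) v s <= r ^+ 2 / 4;
  es_M : 0 < M;
  es_max : forall y, h y <= M;
  es_ys : h ys = M }.

Section fixed_sequence.
Variables (C eta : R) (n : nat) (r t : R) (v h : nat -> R) (M : R) (ys : nat).
Hypothesis eta01 : 0 < eta <= 1.
Hypothesis C0 : 0 < C.
Hypothesis es : euler_sequence C eta n r t v h M ys.

Let V := \sum_(1 <= s < n.+1) v s.
Let e := n%:R - V.
Let T := tail n v.
Let B := smoothed n v h.
Let tau1 := \sum_(0 <= x < n.+1) T x.

Let r1 : 1 <= r := es_r es.
Let r0 : 0 < r. Proof. exact: lt_le_trans r1. Qed.
Let v0 s : 0 <= v s := es_v0 es s.
Let h0 y : 0 <= h y := es_h0 es y.
Let M0 : 0 < M := es_M es.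
Let hM y : h y <= M := es_max es y.

Let T0 x : 0 <= T x. Proof. by rewrite sumr_ge0. Qed.

Let TV x : T x <= V.
Proof.
rewrite /V; have [xn|nx] := leqP x n.
  by rewrite [leRHS](big_cat_nat (n := x.+1))//= lerDr sumr_ge0.
by rewrite /T /tail big_geq ?ltnS 1?ltnW// sumr_ge0.
Qed.

Let Tr x : T x <= r ^+ 2.
Proof. by apply: le_trans (TV x) _; case/andP: (es_V es). Qed.

Let e_ge0 : 0 <= e.
Proof. by rewrite subr_ge0 (es_n es); case/andP: (es_V es). Qed.

Let tailS x : (x < n)%N -> T x = v x.+1 + T x.+1.
Proof. by move=> xn; rewrite /T /tail big_ltn. Qed.

Let T_n : T n = 0. Proof. by rewrite /T /tail big_geq. Qed.

(** Summation by parts turns the recursion of h into this exact first-order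
    recursion, so that the smoothed sequence peaks near y = e. *)
Let smoothed_step y : B y - B y.+1 = (y%:R - e) * h y.
Proof.
have E1 : B y.+1 = \sum_(0 <= x < n) T x * h (y + x.+1)%N.
  rewrite /B /smoothed big_nat_recr//= -/T T_n mul0r addr0.
  by apply: eq_bigr => x _; rewrite addSnnS.
have E2 : B y = V * h y + \sum_(0 <= x < n) T x.+1 * h (y + x.+1)%N.
  by rewrite /B /smoothed big_nat_recl//= addn0.
have := es_rec es y; rewrite big_add1/= => E3.
rewrite E1 E2 -addrA -sumrB.
have -> : \sum_(0 <= x < n) (T x.+1 * h (y + x.+1)%N - T x * h (y + x.+1)%N) =
    - \sum_(0 <= x < n) v x.+1 * h (y + x.+1)%N.
  rewrite -sumrN; apply: eq_big_nat => x /andP[_ xn].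
  by rewrite (tailS xn); ring.
by rewrite E3 /e; ring.
Qed.

Let smoothed_telescope y k :
  B y - B (y + k)%N = \sum_(0 <= i < k) ((y + i)%:R - e) * h (y + i)%N.
Proof.
elim: k => [|k IH]; first by rewrite addn0 subrr big_geq.
by rewrite big_nat_recr//= -IH -smoothed_step addnS; ring.
Qed.

(** Summed over x >= z, the tail counts each v_s once for every x in [z, s). *)
Let tail_sum z : \sum_(z <= x < n.+1) T x = \sum_(1 <= s < n.+1) v s * (s - z)%:R.
Proof.
transitivity (\sum_(z <= x < n.+1) \sum_(1 <= s < n.+1) v s * (x < s)%N%:R).
  apply: eq_big_nat => x /andP[_ xn].
  rewrite /T /tail [RHS](big_cat_nat (n := x.+1))//=.
  have -> : \sum_(1 <= s < x.+1) v s * (x < s)%N%:R = 0.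
    by rewrite big_nat big1// => s /andP[_ sx]; rewrite ltnNge -ltnS sx mulr0.
  rewrite add0r.
  by apply: eq_big_nat => s /andP[xs _]; rewrite xs mulr1.
rewrite exchange_big/=; apply: eq_big_nat => s /andP[_ sn].
rewrite -mulr_sumr; congr (_ * _); rewrite -natr_sum; congr (_%:R).
have [sz|zs] := leqP s z.
  rewrite (eqP (_ : s - z == 0)%N) ?subn_eq0//.
  by rewrite big_nat big1// => x /andP[zx _]; rewrite ltnNge (leq_trans sz).
rewrite (big_cat_nat (n := s))//=; [|exact: ltnW|exact: ltnW].
rewrite (eq_big_nat _ _ (F2 := fun=> 1%N)); last first.
  by move=> x /andP[_ xs]; rewrite xs.
rewrite sum_nat_const_nat muln1 big_nat big1 ?addn0// => x /andP[sx _].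
by rewrite ltnNge sx.
Qed.

Let tau1_le : tau1 <= C * r ^+ 3.
Proof.
rewrite /tau1 tail_sum; apply: le_trans (es_tau1 es); rewrite le_eqVlt.
by apply/orP; left; apply/eqP/eq_bigr => s _; rewrite subn0 mulrC.
Qed.

Let tail_sum_le z : (0 < z)%N ->
  \sum_(z <= x < n.+1) T x <= C * r ^+ 4 / z%:R.
Proof.
move=> z0; rewrite tail_sum ler_pdivlMr ?ltr0n// mulr_suml.
apply: le_trans (es_tau2 es); apply: ler_sum => s _.
rewrite -mulrA mulrC ler_wpM2r// -natrM -natrX ler_nat.
have [sz|zs] := leqP s z; first by rewrite (eqP (_ : s - z == 0)%N) ?subn_eq0.
by rewrite expnS expn1 leq_mul// ?leq_subr// ltnW.
Qed.

Let tail_low z x : (z <= n)%N -> z%:R <= eta * r -> (x <= z)%N ->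
  r ^+ 2 / 4 <= T x.
Proof.
move=> zn zr xz; have /andP[V1 _] := es_V es.
have xn : (x <= n)%N := leq_trans xz zn.
have -> : T x = V - \sum_(1 <= s < x.+1) v s.
  by rewrite /V (big_cat_nat (n := x.+1))//= addrAC subrr add0r.
have xr : x%:R <= eta * r by apply: le_trans zr; rewrite ler_nat.
have := es_trunc es xn xr; move: V1; rewrite -/V; lra.
Qed.

Let head_sum_ge z : (z <= n)%N -> z%:R <= eta * r ->
  z.+1%:R * (r ^+ 2 / 4) <= \sum_(0 <= x < z.+1) T x.
Proof.
move=> zn zr; rewrite mulr_natl -[X in _ *+ X]subn0 -sumr_const_nat.
by apply: ler_sum_nat => x /andP[_ xz]; apply: (tail_low zn zr).
Qed.

Let head_sum_le z : \sum_(0 <= x < z) T x <= z%:R * r ^+ 2.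
Proof.
rewrite mulr_natl -[X in _ *+ X]subn0 -sumr_const_nat.
by apply: ler_sum_nat => x _.
Qed.

Let smoothed_le y : B y <= tau1 * M.
Proof.
rewrite /B /smoothed /tau1 mulr_suml; apply: ler_sum => x _.
by rewrite ler_wpM2l.
Qed.

Let e_le_ys : e <= ys%:R.
Proof.
have := es_rec es ys; rewrite (es_ys es) => E.
have : (n%:R - ys%:R) * M <= V * M.
  by rewrite -E mulr_suml; apply: ler_sum => s _; rewrite ler_wpM2l.
by rewrite ler_pM2r// /e; lra.
Qed.

Let Delta := ys%:R - e.

Let defect_v : \sum_(1 <= s < n.+1) v s * (M - h (ys + s)%N) = Delta * M.
Proof.
under eq_bigr do rewrite mulrBr.
by rewrite sumrB -mulr_suml (es_rec es) (es_ys es) /Delta /e -/V; ring.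
Qed.

Let Phi y := tau1 * M - B y.

Let PhiE y : Phi y = \sum_(0 <= x < n.+1) T x * (M - h (y + x)%N).
Proof.
by under [RHS]eq_bigr do rewrite mulrBr; rewrite sumrB -mulr_suml.
Qed.

Let smoothed_decr y k : e <= y%:R -> B (y + k)%N <= B y.
Proof.
move=> ey; rewrite -subr_ge0 smoothed_telescope sumr_ge0// => i _.
by rewrite mulr_ge0// subr_ge0 (le_trans ey)// ler_nat leq_addr.
Qed.

Let nat_floor (x : R) : 0 <= x -> exists k : nat, k%:R <= x < k.+1%:R.
Proof. by move=> x0; exists (Num.truncn x); exact: truncn_itv. Qed.

Let expRt_le z K : z%:R <= K * r -> expR (t * z%:R) <= expR (2 * K).
Proof.
move=> zK; rewrite ler_expR; apply: (@le_trans _ _ (t * (K * r))).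
  by rewrite ler_wpM2l ?(es_t es).
have K0 : 0 <= K.
  by rewrite -(pmulr_lge0 _ r0); apply: le_trans zK.
by rewrite mulrCA [leRHS]mulrC ler_wpM2l ?(es_tr es).
Qed.

Definition low_const (C beta : R) : R :=
  beta / 2 / ((2 * C / beta + 1) * expR (2 * (2 * C / beta + 1))).

(** Weights beyond K r carry little mass, and before K r the values of h exceed
    h y by at most the factor e^(2K). So h y is of order M as soon as B y has
    its full order r^3 M. *)
Let low_of_smoothed y beta : 0 < beta ->
  beta * r ^+ 3 * M <= B y -> low_const C beta * M <= h y.
Proof.
move=> b0 By; rewrite /low_const; set K := 2 * C / beta.
have K0 : 0 < K by rewrite divr_gt0// mulr_gt0.
have [k /andP[kr rk]] := @nat_floor (K * r) (ltW (mulr_gt0 K0 r0)).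
set z := k.+1 in rk.
have zK : z%:R <= (K + 1) * r.
  by rewrite /z -natr1 mulrDl mul1r lerD.
have Bsplit : B y <= \sum_(0 <= x < z) T x * h (y + x)%N
    + \sum_(z <= x < n.+1) T x * h (y + x)%N.
  have Th x : 0 <= T x * h (y + x)%N by rewrite mulr_ge0.
  rewrite /B /smoothed -/T; have [zn|nz] := leqP z n.+1.
    by rewrite (big_cat_nat (n := z)).
  rewrite [X in _ + X]big_geq ?(ltnW nz)// addr0.
  by rewrite [leRHS](big_cat_nat (n := n.+1)) ?(ltnW nz)//= lerDl sumr_ge0.
have h1 : \sum_(0 <= x < z) T x * h (y + x)%N <=
    (K + 1) * r ^+ 3 * (expR (2 * (K + 1)) * h y).
  apply: (@le_trans _ _ (\sum_(0 <= x < z) T x * (expR (2 * (K + 1)) * h y))).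
    apply: ler_sum_nat => x /andP[_ xz]; rewrite ler_wpM2l//.
    apply: le_trans (es_mono es y x) _; rewrite ler_wpM2r// expRt_le//.
    by apply: le_trans zK; rewrite ler_nat ltnW.
  rewrite -mulr_suml ler_wpM2r ?mulr_ge0 ?expR_ge0//.
  apply: le_trans (head_sum_le z) _.
  by rewrite [r ^+ 3]exprS mulrA ler_wpM2r// exprn_ge0// ltW.
have h2 : \sum_(z <= x < n.+1) T x * h (y + x)%N <= beta / 2 * r ^+ 3 * M.
  apply: (@le_trans _ _ ((\sum_(z <= x < n.+1) T x) * M)).
    by rewrite mulr_suml; apply: ler_sum => x _; rewrite ler_wpM2l.
  rewrite ler_wpM2r ?(ltW M0)//; apply: le_trans (tail_sum_le _) _ => //.
  rewrite ler_pdivrMr ?ltr0n//.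
  apply: (@le_trans _ _ (beta / 2 * r ^+ 3 * (K * r))).
    rewrite le_eqVlt; apply/orP; left; apply/eqP.
    by rewrite /K exprSr; field; rewrite gt_eqF.
  by rewrite ler_wpM2l ?(ltW rk)// mulr_ge0 ?exprn_ge0 ?divr_ge0 ?(ltW b0) ?(ltW r0).
have r30 : 0 < r ^+ 3 by rewrite exprn_gt0.
have h3 : beta / 2 * M <= (K + 1) * expR (2 * (K + 1)) * h y.
  rewrite -(ler_pM2l r30); move: (le_trans By Bsplit) h1 h2; lra.
have d0 : 0 < (K + 1) * expR (2 * (K + 1)).
  by rewrite mulr_gt0 ?expR_gt0// addr_gt0.
by rewrite mulrAC ler_pdivrMr// [h y * _]mulrC.
Qed.

Definition peak_const (C eta : R) : R := low_const C (expR (- 2) * eta / 4).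

Let beta0_gt0 : 0 < expR (- 2) * eta / 4.
Proof. by rewrite divr_gt0// mulr_gt0 ?expR_gt0//; case/andP: eta01. Qed.

Let peak_const_le : peak_const C eta <= expR (- 2).
Proof.
rewrite /peak_const /low_const; set b := _ / 4; set K := _ / b.
have K0 : 0 < K by rewrite divr_gt0// mulr_gt0.
have K1 : 1 <= K + 1 by rewrite lerDr ltW.
have E1 : 1 <= expR (2 * (K + 1)).
  by rewrite -[leLHS]expR0 ler_expR mulr_ge0// (le_trans ler01).
rewrite ler_pdivrMr; last by rewrite mulr_gt0 ?expR_gt0// (lt_le_trans ltr01).
have /andP[_ eta1] := eta01; have e20 := expR_gt0 (- 2 : R).
apply: (@le_trans _ _ (expR (- 2) * 1)).
  rewrite /b -!mulrA ler_wpM2l ?(ltW e20)//; lra.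
by rewrite ler_wpM2l ?(ltW e20)// mulr_ege1.
Qed.

Let eta_floor z : z%:R <= eta * r -> (z <= n)%N.
Proof.
move=> zr; rewrite -(ler_nat R) (es_n es); apply: le_trans zr _.
have /andP[_ eta1] := eta01.
by rewrite expr2 ler_wpM2r ?(ltW r0)// (le_trans eta1).
Qed.

(** Near ys the sequence h is of order M, hence B is of order r^3 M just before
    ys; as B decreases from e on, it is so on all of [e, ys]. *)
Let peak_lower y : e <= y%:R -> (y <= ys)%N -> peak_const C eta * M <= h y.
Proof.
move=> ey yys; have /andP[eta0 eta1] := eta01.
have [z /andP[zr rz]] := @nat_floor (eta * r) (ltW (mulr_gt0 eta0 r0)).
have zE : expR (t * z%:R) <= expR 2.
  by have := expRt_le zr => /le_trans; apply; rewrite ler_expR; lra.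
have near i : (i <= z)%N -> (i <= ys)%N -> expR (- 2) * M <= h (ys - i)%N.
  move=> iz iys; rewrite expRN ler_pdivrMl ?expR_gt0//.
  have := es_mono es (ys - i) i; rewrite subnK// (es_ys es).
  move=> /le_trans; apply; rewrite ler_wpM2r//; apply: le_trans zE.
  by rewrite ler_expR ler_wpM2l ?(es_t es)// ler_nat.
have [yz|zy] := leqP (ys - y) z.
  have := near _ yz (leq_subr _ _); rewrite subKn//; apply: le_trans.
  by rewrite ler_wpM2r ?(ltW M0)// peak_const_le.
apply: low_of_smoothed => //.
have zys : (z <= ys)%N by rewrite (leq_trans (ltnW zy))// leq_subr.
have yzys : (y <= ys - z)%N by rewrite leq_subRL// addnC -leq_subRL// ltnW.
have := smoothed_decr (ys - z - y) ey; rewrite subnKC// => /(le_trans _); apply.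
have zn := eta_floor zr.
apply: (@le_trans _ _ (\sum_(0 <= x < z.+1) T x * h (ys - z + x)%N)); last first.
  rewrite /B /smoothed [leRHS](big_cat_nat (n := z.+1))//= lerDl.
  by apply: sumr_ge0 => x _; rewrite mulr_ge0.
apply: (@le_trans _ _ ((\sum_(0 <= x < z.+1) T x) * (expR (- 2) * M))); last first.
  rewrite mulr_suml; apply: ler_sum_nat => x /andP[_ xz]; rewrite ler_wpM2l//.
  rewrite ltnS in xz.
  have -> : (ys - z + x = ys - (z - x))%N by rewrite subnBA// addnBAC.
  by apply: near; rewrite ?leq_subr// (leq_trans (leq_subr _ _)).
apply: (@le_trans _ _ (z.+1%:R * (r ^+ 2 / 4) * (expR (- 2) * M))); last first.
  by rewrite ler_wpM2r ?head_sum_ge// mulr_ge0 ?expR_ge0 ?ltW.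
apply: (@le_trans _ _ (eta * r * (r ^+ 2 / 4) * (expR (- 2) * M))).
  by rewrite le_eqVlt; apply/orP; left; apply/eqP; rewrite !exprS; field.
rewrite ler_wpM2r ?mulr_ge0 ?expR_ge0 ?(ltW M0)//.
by rewrite ler_wpM2r ?(ltW rz)// divr_ge0// exprn_ge0// ltW.
Qed.

Let peak_const_gt0 : 0 < peak_const C eta.
Proof.
rewrite /peak_const /low_const; set b := _ / 4; set K := _ / b.
have b0 : 0 < b := beta0_gt0.
have K1 : 0 < K + 1 by rewrite addr_gt0// divr_gt0// mulr_gt0.
by apply: divr_gt0; [exact: divr_gt0|apply: mulr_gt0 => //; exact: expR_gt0].
Qed.

Let Phi_ge0 y : 0 <= Phi y.
Proof. by rewrite subr_ge0. Qed.

Let Delta_ge0 : 0 <= Delta.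
Proof. by rewrite subr_ge0. Qed.

(** B e - B ys is the sum of (y - e) h y over [e, ys], which is of order
    Delta^2 M, and B e is at most tau1 M. *)
Let Delta_sq : peak_const C eta * (Delta ^+ 2 - 16) * M <= 8 * Phi ys.
Proof.
have P0 := Phi_ge0 ys.
have [D4|D4] := ltP Delta 4.
  apply: (@le_trans _ _ 0); last by rewrite mulr_ge0.
  rewrite pmulr_lle0// pmulr_rle0// subr_le0.
  have -> : 16 = 4 ^+ 2 :> R by ring.
  by apply: lerXn2r; rewrite ?nnegrE// ltW.
have [k /andP[kD Dk]] := @nat_floor (Delta / 2) (divr_ge0 Delta_ge0 (ler0n _ 2)).
have {}Dk : Delta / 2 < k%:R + 1 by rewrite natr1.
have kys : (k <= ys)%N.
  by rewrite -(ler_nat R); move: kD e_ge0 D4; rewrite /Delta; lra.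
have ek : e <= (ys - k)%:R by rewrite natrB//; move: kD D4; rewrite /Delta; lra.
have := smoothed_telescope (ys - k) k; rewrite subnK// => E.
have : k%:R * (Delta / 2 * (peak_const C eta * M)) <= B (ys - k) - B ys.
  rewrite E mulr_natl -[X in _ *+ X]subn0 -sumr_const_nat.
  apply: ler_sum_nat => i /andP[_ ik].
  have iy : (ys - k + i <= ys)%N by rewrite -leq_subRL ?leq_subr// subKn// ltnW.
  have le1 : Delta / 2 <= (ys - k + i)%:R - e.
    rewrite natrD natrB//; have := ler0n R i; move: kD; rewrite /Delta; lra.
  apply: ler_pM => //; first by rewrite divr_ge0.
    by rewrite mulr_ge0// ltW.
  apply: peak_lower => //; apply: le_trans ek _.
  by rewrite ler_nat leq_addr.
have := smoothed_le (ys - k); rewrite -/tau1 /Phi => B1 B2.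
have q0 : 0 < peak_const C eta * M by rewrite mulr_gt0.
apply: (@le_trans _ _ (8 * (k%:R * (Delta / 2 * (peak_const C eta * M))))); last first.
  by rewrite ler_pM2l//; lra.
have : 0 <= peak_const C eta * M * (8 * (k%:R * (Delta / 2)) - (Delta ^+ 2 - 16)).
  rewrite mulr_ge0 ?(ltW q0)//; have := sqr_ge0 (Delta - 2).
  have : 0 <= Delta * (k%:R + 1 - Delta / 2).
    by rewrite mulr_ge0// subr_ge0 ltW.
  rewrite !expr2; lra.
lra.
Qed.

(** The recursion at ys says that the defect M - h has total Delta M for the
    weights v. It transfers to the weights T where T is dominated by v, that is
    between the cut-offs z1 and z2; outside, the weights T have small mass. *)
Let Phi_le z1 z2 : (0 < z1)%N -> (0 < z2)%N ->
  Phi ys <= M * (z1%:R * r ^+ 2 + r ^+ 2 * expR (t * z2%:R) / z1%:R * Delta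
    + C * r ^+ 4 / z2%:R).
Proof.
move=> z10 z20; set A := r ^+ 2 * expR (t * z2%:R) / z1%:R.
have z1p : 0 < z1%:R :> R by rewrite ltr0n.
have A0 : 0 <= A by rewrite divr_ge0// mulr_ge0 ?expR_ge0 ?exprn_ge0 ?(ltW r0).
have D0 y : 0 <= M - h y by rewrite subr_ge0.
have DM y : M - h y <= M by rewrite gerBl.
have AD0 x : 0 <= A * (v x * (M - h (ys + x)%N)).
  exact: mulr_ge0 A0 (mulr_ge0 (v0 _) (D0 _)).
rewrite PhiE.
apply: (@le_trans _ _ (\sum_(0 <= x < z1) T x * M +
   (\sum_(1 <= x < n.+1) A * (v x * (M - h (ys + x)%N)) +
    \sum_(z2 <= x < n.+1) T x * M))); last first.
  rewrite -mulr_suml -mulr_sumr -mulr_suml defect_v.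
  have := ler_wpM2r (ltW M0) (head_sum_le z1).
  have := ler_wpM2r (ltW M0) (tail_sum_le z20); lra.
have tm x : (z1 <= x <= n)%N -> T x * (M - h (ys + x)%N) <=
    A * (v x * (M - h (ys + x)%N)) + (if (z2 <= x)%N then T x * M else 0).
  move=> /andP[zx xn]; have [_|xz] := leqP z2 x.
    by rewrite ler_wpDl ?ler_wpM2l//; exact: AD0.
  rewrite addr0 mulrA ler_wpM2r//; apply: le_trans (Tr x) _.
  have x0 : (0 < x <= n)%N by rewrite xn (leq_trans z10).
  apply: le_trans (ler_wpM2l A0 (es_vlow es x0)).
  have -> : A * (x%:R * expR (- (t * x%:R))) =
      r ^+ 2 * ((x%:R * expR (t * z2%:R - t * x%:R)) / z1%:R).
    by rewrite expRD /A; ring.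
  rewrite -[leLHS]mulr1; apply: ler_wpM2l; first by rewrite exprn_ge0// ltW.
  rewrite ler_pdivlMr// mul1r.
  apply: (@le_trans _ _ (x%:R * 1)); first by rewrite mulr1 ler_nat.
  rewrite ler_wpM2l// -[leLHS]expR0 ler_expR subr_ge0.
  by rewrite ler_wpM2l ?(es_t es)// ler_nat ltnW.
have [z1n|nz1] := leqP z1 n.+1; last first.
  rewrite -[leLHS]addr0 lerD//; last first.
    by rewrite addr_ge0// sumr_ge0// => x _; rewrite mulr_ge0// ltW.
  rewrite [leRHS](big_cat_nat (n := n.+1)) ?(ltnW nz1)//= ler_wpDr//.
    by apply: sumr_ge0 => x _; rewrite mulr_ge0// ltW.
  by apply: ler_sum => x _; rewrite ler_wpM2l.
rewrite (big_cat_nat (n := z1))//=; apply: lerD.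
  by apply: ler_sum => x _; rewrite ler_wpM2l.
apply: (@le_trans _ _ (\sum_(z1 <= x < n.+1) (A * (v x * (M - h (ys + x)%N)) +
     (if (z2 <= x)%N then T x * M else 0)))).
  by apply: ler_sum_nat => x /andP[zx xn]; apply: tm; rewrite zx -ltnS.
rewrite big_split/=; apply: lerD.
  rewrite [leRHS](big_cat_nat (n := z1))//= lerDr.
  by apply: sumr_ge0 => x _; exact: AD0.
rewrite [leRHS](@big_nat_widenl _ _ _ z2 0)//= [leRHS]big_mkcond/=.
rewrite [leRHS](big_cat_nat (n := z1))//= lerDr sumr_ge0// => x _.
by case: ifP => // _; rewrite mulr_ge0// ltW.
Qed.

(** Each step of B is at most |i - e| M. *)
Let Phi_near y : Phi y <= Phi ys + (2 * y%:R ^+ 2 + 4 * Delta ^+ 2 + 5 * e ^+ 2) * M.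
Proof.
have key a b : (a <= b)%N -> `|B a - B b| <= (2 * b%:R ^+ 2 + e ^+ 2) * M.
  move=> ab; have := smoothed_telescope a (b - a); rewrite subnKC// => ->.
  apply: le_trans (ler_norm_sum _ _ _) _.
  apply: (@le_trans _ _ (\sum_(0 <= i < b - a) (b%:R + e) * M)).
    apply: ler_sum_nat => i /andP[_ ib].
    rewrite normrM [`|h _|]ger0_norm//; apply: ler_pM => //.
    have : (a + i)%:R <= b%:R :> R by rewrite ler_nat -leq_subRL// ltnW.
    have := ler0n R (a + i); have := e_ge0; rewrite ler_norml; lra.
  rewrite sumr_const_nat subn0 -[_ *+ _]mulr_natl mulrA ler_wpM2r ?(ltW M0)//.
  apply: (@le_trans _ _ (b%:R * (b%:R + e))).
    by apply: ler_wpM2r; [exact: addr_ge0|rewrite ler_nat leq_subr].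
  have := sqr_ge0 (b%:R - e); have := sqr_ge0 e; have := sqr_ge0 (b%:R : R).
  rewrite !expr2; lra.
have ysq : ys%:R ^+ 2 <= 2 * Delta ^+ 2 + 2 * e ^+ 2.
  have := sqr_ge0 (Delta - e); have -> : ys%:R = Delta + e by rewrite /Delta subrK.
  rewrite !expr2; lra.
have M0' := ltW M0.
have e2 := mulr_ge0 (sqr_ge0 e) M0'; have D2 := mulr_ge0 (sqr_ge0 Delta) M0'.
have y2 := mulr_ge0 (sqr_ge0 (y%:R : R)) M0'.
have := ler_wpM2r M0' ysq; rewrite /Phi.
have [yys|ysy] := leqP y ys.
  by have := key _ _ yys; rewrite ler_norml; lra.
by have := key _ _ (ltnW ysy); rewrite ler_norml; lra.
Qed.

(** As h (y + x) <= e^(tx) h y, a small mean defect after y forces h y itself to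
    be close to M. *)
Let flat_of_Phi y eta' kappa : 0 < eta' <= eta -> 0 <= kappa ->
  Phi y <= kappa * r ^+ 3 * M -> (1 - 4 * kappa / eta') * M <= expR (2 * eta') * h y.
Proof.
move=> /andP[eta'0 eta'eta] k0 Py.
have [z /andP[zr rz]] := @nat_floor (eta' * r) (ltW (mulr_gt0 eta'0 r0)).
have zr' : z%:R <= eta * r by apply: le_trans zr _; rewrite ler_wpM2r ?(ltW r0).
have zn := eta_floor zr'.
set S := \sum_(0 <= x < z.+1) T x.
have SS : eta' * r * (r ^+ 2 / 4) <= S.
  apply: le_trans (head_sum_ge zn zr').
  by rewrite ler_wpM2r ?(ltW rz)// divr_ge0// exprn_ge0// ltW.
have S1 : S * M - kappa * r ^+ 3 * M <= S * (expR (2 * eta') * h y).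
  rewrite lerBlDr -lerBlDl; apply: le_trans Py; rewrite PhiE.
  rewrite [leRHS](big_cat_nat (n := z.+1))//= ler_wpDr ?sumr_ge0// => [x _|].
    by rewrite mulr_ge0// subr_ge0.
  rewrite /S !mulr_suml -sumrB; apply: ler_sum_nat => x /andP[_ xz].
  rewrite -mulrBr ler_wpM2l// lerD2l lerN2.
  apply: le_trans (es_mono es y x) _; rewrite ler_wpM2r// expRt_le//.
  by apply: le_trans zr; rewrite ler_nat -ltnS.
have Q0 : 0 < eta' * r * (r ^+ 2 / 4).
  by rewrite !mulr_gt0// ?divr_gt0// exprn_gt0.
have Sp : 0 < S := lt_le_trans Q0 SS.
rewrite -(ler_pM2l Sp); apply: le_trans S1.
have : 4 * kappa / eta' * (eta' * r * (r ^+ 2 / 4)) <= 4 * kappa / eta' * S.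
  by rewrite ler_wpM2l// divr_ge0 ?mulr_ge0 ?(ltW eta'0).
have -> : 4 * kappa / eta' * (eta' * r * (r ^+ 2 / 4)) = kappa * r ^+ 3.
  by rewrite !exprS; field; rewrite gt_eqF.
move=> /(ler_wpM2r (ltW M0)); lra.
Qed.

(** Bootstrap: the trivial bound Phi <= C r^3 M gives Delta = O(r^(3/2)), whence
    Phi = o(r^3) M by Phi_le, whence Delta = o(r^(3/2)) by Delta_sq; so the whole
    range of y is close enough to ys for Phi to stay small. *)
Lemma euler_sequence_flat_quant eta' kappa phi y :
  0 < eta' <= eta -> 0 < kappa -> 0 < phi ->
  256 * phi <= kappa * peak_const C eta ->
  512 <= kappa * r -> 3 <= phi * r ->
  16 + 8 * C / peak_const C eta <=
    (phi ^+ 2 / (18 * expR (2 * (3 * C / phi + 1)))) ^+ 2 * r ->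
  28 * e ^+ 2 <= kappa * r ^+ 3 -> 28 * y%:R ^+ 2 <= kappa * r ^+ 3 ->
  (1 - 4 * kappa / eta') * M <= expR (2 * eta') * h y.
Proof.
move=> eta'P k0 p0 phiP kr pr; set K := 3 * C / phi; set E := expR _.
set A := phi ^+ 2 / _ => Ar eP yP.
set d := peak_const C eta in phiP Ar.
have d0 : 0 < d := peak_const_gt0.
have d1 : d <= 1.
  by apply: le_trans peak_const_le _; rewrite -[leRHS]expR0 ler_expR; lra.
have K0 : 0 < K by rewrite divr_gt0// mulr_gt0.
have E0 : 0 < E := expR_gt0 _.
have A0 : 0 < A by rewrite divr_gt0 ?exprn_gt0// mulr_gt0.
have r30 : 0 < r ^+ 3 by rewrite exprn_gt0.
have r3r : r <= r ^+ 3 by rewrite -[leLHS]expr1 ler_weXn2l.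
(* a priori bound, from Phi <= tau1 M *)
have D1 : Delta ^+ 2 <= (16 + 8 * C / d) * r ^+ 3.
  have P1 : Phi ys <= C * r ^+ 3 * M.
    apply: (@le_trans _ _ (tau1 * M)).
      rewrite gerBl; apply: sumr_ge0 => x _; exact: mulr_ge0.
    by rewrite ler_wpM2r ?(ltW M0).
  have := le_trans Delta_sq (ler_wpM2l (ler0n R 8) P1).
  rewrite -/d mulrA ler_pM2r// => h1.
  have h2 : Delta ^+ 2 - 16 <= 8 * (C * r ^+ 3) / d.
    by rewrite ler_pdivlMr// mulrC.
  have E1 : (16 + 8 * C / d) * r ^+ 3 = 16 * r ^+ 3 + 8 * (C * r ^+ 3) / d.
    by ring.
  by rewrite E1; move: h2 r3r r1; lra.
have D2 : Delta <= A * r ^+ 2.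
  have AR : 0 <= A * r ^+ 2 by apply: mulr_ge0; [exact: ltW|rewrite exprn_ge0 // ltW].
  rewrite -(@ler_pXn2r _ 2) //.
  apply: le_trans D1 _; rewrite exprMn -exprM.
  have -> : A ^+ 2 * r ^+ (2 * 2) = A ^+ 2 * r * r ^+ 3 by rewrite !exprS; ring.
  by rewrite ler_wpM2r ?(ltW r30).
have P2 : Phi ys <= phi * r ^+ 3 * M.
  have [z1 /andP[z1r rz1]] := @nat_floor (phi * r / 3) (ltac:(by rewrite divr_ge0// mulr_ge0 ?ltW)).
  have [k /andP[kr' rk]] := @nat_floor (K * r) (ltW (mulr_gt0 K0 r0)).
  have {}rz1 : phi * r / 3 < z1%:R + 1 by rewrite natr1.
  have z10 : (0 < z1)%N.
    rewrite lt0n; apply/eqP => z1E; move: rz1 pr; rewrite z1E; lra.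
  have z1n : 1 <= z1%:R :> R by rewrite ler1n.
  apply: le_trans (Phi_le z10 (ltn0Sn k)) _.
  rewrite mulrC ler_wpM2r ?(ltW M0)//.
  have t1 : z1%:R * r ^+ 2 <= phi / 3 * r ^+ 3.
    apply: (@le_trans _ _ (phi * r / 3 * r ^+ 2)).
      by rewrite ler_wpM2r ?exprn_ge0 ?(ltW r0).
    by rewrite le_eqVlt; apply/orP; left; apply/eqP; rewrite !exprS; field.
  have t3 : C * r ^+ 4 / k.+1%:R <= phi / 3 * r ^+ 3.
    rewrite ler_pdivrMr ?ltr0n//.
    apply: (@le_trans _ _ (phi / 3 * r ^+ 3 * (K * r))).
      rewrite le_eqVlt; apply/orP; left; apply/eqP.
      by rewrite /K !exprS; field; rewrite gt_eqF.
    by rewrite ler_wpM2l ?(ltW rk)// mulr_ge0 ?divr_ge0 ?(ltW p0) ?(ltW r30).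
  have t2 : r ^+ 2 * expR (t * k.+1%:R) / z1%:R * Delta <= phi / 3 * r ^+ 3.
    have ek : expR (t * k.+1%:R) <= E.
      by apply: expRt_le; rewrite -natr1 mulrDl mul1r lerD.
    have z1V : z1%:R^-1 <= 6 / (phi * r).
      rewrite -[leRHS]invrK lef_pV2 ?posrE ?ltr0n ?invr_gt0 ?divr_gt0 ?mulr_gt0//.
      rewrite invf_div; move: rz1 z1n; lra.
    apply: (@le_trans _ _ (r ^+ 2 * E * (6 / (phi * r)) * (A * r ^+ 2))).
      have r20 : 0 <= r ^+ 2 by rewrite exprn_ge0// ltW.
      apply: ler_pM; [|exact: Delta_ge0| |exact: D2].
        by rewrite divr_ge0// mulr_ge0 ?expR_ge0.
      apply: ler_pM => //; first by rewrite mulr_ge0 ?expR_ge0.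
      by rewrite ler_wpM2l.
    rewrite le_eqVlt; apply/orP; left; apply/eqP.
    rewrite /A !exprS; clearbody E; field.
    by rewrite !gt_eqF.
  have -> : phi * r ^+ 3 = phi / 3 * r ^+ 3 + phi / 3 * r ^+ 3 + phi / 3 * r ^+ 3.
    by field.
  by apply: lerD t3; apply: lerD t1 t2.
have D3 : 4 * Delta ^+ 2 <= kappa / 4 * r ^+ 3.
  have := le_trans Delta_sq (ler_wpM2l (ler0n R 8) P2); rewrite -/d mulrA ler_pM2r//.
  have := ler_wpM2r (ltW r30) phiP.
  move=> h1 h2.
  have h3 : d * (Delta ^+ 2 - 16) <= d * (kappa / 32 * r ^+ 3).
    by apply: le_trans h2 _; move: h1; lra.
  move: h3; rewrite ler_pM2l// => h3.
  have : kappa * r <= kappa * r ^+ 3 by rewrite ler_wpM2l ?(ltW k0).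
  move: h3 kr; lra.
apply: flat_of_Phi => //; first exact: ltW.
apply: le_trans (Phi_near y) _.
have {}eP := ler_wpM2r (ltW M0) eP; have {}yP := ler_wpM2r (ltW M0) yP.
have {}D3 := ler_wpM2r (ltW M0) D3.
have : phi * r ^+ 3 * M <= kappa / 2 * r ^+ 3 * M.
  rewrite ler_wpM2r ?(ltW M0)// ler_wpM2r ?(ltW r30)//.
  have : kappa * d <= kappa * 1 by rewrite ler_wpM2l ?(ltW k0).
  move: phiP k0; lra.
move: P2 eP yP D3; move: (Phi ys) (Delta ^+ 2) (e ^+ 2) (y%:R ^+ 2) (r ^+ 3).
move=> P DD ee yy rr; lra.
Qed.

End fixed_sequence.

(** Here eta' is the width, in units of r, of the window over which h is
    averaged, and kappa the mean defect that is allowed there. *)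
Lemma euler_sequence_flat (C eta eps : R) : 0 < C -> 0 < eta <= 1 -> 0 < eps <= 1 ->
  exists2 delta : R, 0 < delta & exists rho : R,
  forall n r t v h M ys, euler_sequence C eta n r t v h M ys -> rho <= r ->
    (n%:R - \sum_(1 <= s < n.+1) v s) ^+ 2 <= delta * r ^+ 3 ->
    forall y, y%:R ^+ 2 <= delta * r ^+ 3 -> (1 - eps) * M <= h y.
Proof.
move=> C0 eta01 /andP[eps0 eps1].
have /andP[eta0 eta1] := eta01.
pose eta' := Num.min eta (eps / 8).
have eta'0 : 0 < eta' by rewrite /eta' lt_min eta0 divr_gt0.
have eta'1 : eta' <= eta by rewrite /eta' ge_min lexx.
have eta'2 : eta' <= eps / 8 by rewrite /eta' ge_min lexx orbT.
pose kappa := eps * eta' / 16.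
have k0 : 0 < kappa by rewrite divr_gt0// mulr_gt0.
pose d := peak_const C eta.
have d0 : 0 < d.
  rewrite /d /peak_const /low_const; set b := _ / 4; set K := _ / b.
  have b0 : 0 < b by rewrite divr_gt0// mulr_gt0 ?expR_gt0.
  have K1 : 0 < K + 1 by rewrite addr_gt0// divr_gt0// mulr_gt0.
  by apply: divr_gt0; [exact: divr_gt0|apply: mulr_gt0 => //; exact: expR_gt0].
pose phi := kappa * d / 256.
have p0 : 0 < phi by apply: divr_gt0; [exact: mulr_gt0|rewrite ltr0n].
pose A := phi ^+ 2 / (18 * expR (2 * (3 * C / phi + 1))).
have A0 : 0 < A by rewrite divr_gt0 ?exprn_gt0// mulr_gt0// expR_gt0.
have A20 : 0 < A ^+ 2 by rewrite exprn_gt0.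
have q0 : 0 < 16 + 8 * C / d by rewrite addr_gt0// divr_gt0// mulr_gt0.
exists (kappa / 28); first by rewrite divr_gt0.
exists (512 / kappa + 3 / phi + (16 + 8 * C / d) / A ^+ 2).
move=> n r t v h M ys es rho ee y yy.
have a1 : 0 < 512 / kappa by apply: divr_gt0; [rewrite ltr0n|exact: k0].
have a2 : 0 < 3 / phi by rewrite divr_gt0.
have a3 : 0 < (16 + 8 * C / d) / A ^+ 2 by rewrite divr_gt0.
have M0 := es_M es.
have := @euler_sequence_flat_quant C eta n r t v h M ys eta01 C0 es eta' kappa phi y.
rewrite eta'0 eta'1 -/d -/A => /(_ isT k0 p0) H.
have {H}: (1 - 4 * kappa / eta') * M <= expR (2 * eta') * h y.
  apply: H.
  - by rewrite /phi [leLHS]mulrC divfK ?pnatr_eq0.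
  - by rewrite mulrC -ler_pdivrMr//; move: rho a1 a2 a3; lra.
  - by rewrite mulrC -ler_pdivrMr//; move: rho a1 a2 a3; lra.
  - rewrite -(ler_pdivrMl _ _ A20) [leLHS]mulrC.
    apply: le_trans rho; rewrite lerDr; exact/ltW/addr_gt0.
  - by move: ee; lra.
  - by move: yy; lra.
have -> : 4 * kappa / eta' = eps / 4 by rewrite /kappa; field; rewrite gt_eqF.
rewrite -ler_pdivrMl ?expR_gt0// -expRN; apply: le_trans.
rewrite mulrA ler_wpM2r ?(ltW M0)//.
have := expR_ge1Dx (- (2 * eta')) => h1.
have h2 : 1 - eps / 4 <= expR (- (2 * eta')) by move: h1 eta'2; lra.
apply: (@le_trans _ _ ((1 - eps / 4) * (1 - eps / 4))).
  have := sqr_ge0 eps; rewrite !expr2; lra.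
by rewrite ler_wpM2r//; lra.
Qed.
End smoothing.

(** * Ratios of partition numbers *)

Section partition_ratio.
Variable R : realType.

(** The square root of zeta(2). *)
Definition pconst : R := pi / Num.sqrt 6.

Lemma pconst_gt0 : 0 < pconst.
Proof. by rewrite divr_gt0 ?pi_gt0// sqrtr_gt0. Qed.

Lemma pconst_sqr : pconst ^+ 2 = pi ^+ 2 / 6.
Proof. by rewrite expr_div_n sqr_sqrtr. Qed.

Lemma pconst_sqr_bounds : 2 / 3 <= pconst ^+ 2 <= 8 / 3.
Proof.
rewrite pconst_sqr; have := pi_ge2 R; have := pihalf_lt2 R.
move: (pi : R) => p p4 p2; rewrite expr2; apply/andP; split; nra.
Qed.

Lemma pconst_bounds : 2^-1 <= pconst <= 2.
Proof.
have /andP[h1 h2] := pconst_sqr_bounds; have c0 := pconst_gt0.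
by apply/andP; split; move: h1 h2 c0; move: pconst => c; rewrite expr2; nra.
Qed.

Definition rt n : R := Num.sqrt n%:R.

(** The exponential weight e^(-t |kappa|) on partitions has mean size
    sum_s sigma(s) e^(-ts), which is about c^2 / t^2 = n for this t. *)
Definition temp n : R := pconst / rt n.

Lemma rt_sqr n : rt n ^+ 2 = n%:R.
Proof. by rewrite sqr_sqrtr. Qed.

Lemma rt_ge1 n : (0 < n)%N -> 1 <= rt n.
Proof. by move=> n0; rewrite -[leLHS]sqrtr1 ler_sqrt// ler1n. Qed.

Lemma temp_gt0 n : (0 < n)%N -> 0 < temp n.
Proof. by move=> n0; rewrite divr_gt0 ?pconst_gt0// (lt_le_trans ltr01) ?rt_ge1. Qed.

Lemma temp_rt n : (0 < n)%N -> temp n * rt n = pconst.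
Proof.
by move=> n0; rewrite /temp divfK// gt_eqF// (lt_le_trans ltr01)// rt_ge1.
Qed.

Lemma temp_invsqr n : temp n ^- 2 = n%:R / pconst ^+ 2.
Proof. by rewrite /temp expr_div_n invf_div rt_sqr. Qed.

(** The index y is the distance below n, so that Euler's recursion runs towards
    larger indices. *)
Definition tilted n y : R :=
  (npart_sub n y)%:R * expR (- (temp n * (n%:R - y%:R))).

Lemma tilted_rec n y :
  \sum_(1 <= s < n.+1) wt n (temp n) s * tilted n (y + s) =
  (n%:R - y%:R) * tilted n y.
Proof.
rewrite /tilted /wt; set t := temp n; have [yn|ny] := leqP y n; last first.
  rewrite /npart_sub leqNgt ny/= mul0r mulr0 big1// => s _.
  by rewrite leqNgt (leq_trans ny) ?leq_addr//= mul0r mulr0.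
have nyE s : npart_sub n (y + s) = npart_sub (n - y) s.
  by rewrite /npart_sub -subnDA leq_subRL.
transitivity (expR (- (t * (n%:R - y%:R))) *
   \sum_(1 <= s < n.+1) (divsum n s)%:R * (npart_sub (n - y) s)%:R).
  rewrite mulr_sumr; apply: eq_bigr => s _; rewrite nyE.
  have -> : - (t * (n%:R - y%:R)) = - (t * s%:R) + - (t * (n%:R - (y + s)%:R)).
    by rewrite natrD; ring.
  by rewrite expRD; ring.
rewrite sum_divsum mulrCA mulrA mulrC; congr (_ * _).
have -> : npart_sub n y = npart (n - y) by rewrite /npart_sub yn.
rewrite -natrB// -natrM mulnC (npart_rec (leq_subr y n)) natr_sum.
under [RHS]eq_bigr do rewrite natr_sum.
rewrite [RHS]exchange_big/=; apply: eq_bigr => l _.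
rewrite big_mkcond/=; apply: eq_bigr => j _.
case: ifP => jln; first by rewrite natrM.
by rewrite /npart_sub leqNgt (leq_ltn_trans (leq_subr y n)) ?muln0// ltnNge jln.
Qed.

Lemma tilted_mono n y i : tilted n (y + i) <= expR (temp n * i%:R) * tilted n y.
Proof.
rewrite /tilted mulrCA -expRD.
have -> : temp n * i%:R + - (temp n * (n%:R - y%:R)) =
    - (temp n * (n%:R - (y + i)%:R)) by rewrite natrD; ring.
rewrite ler_wpM2r ?expR_ge0// ler_nat /npart_sub.
case: ifP => // yin; rewrite (leq_trans (leq_addr i y) yin).
by apply: npart_le; rewrite leq_sub2l// leq_addr.
Qed.

Lemma expR1_le4 : expR 1 <= 4 :> R.
Proof.
have h := expR_ge1Dx (- 2^-1 : R); rewrite expRN in h.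
have : expR 2^-1 <= 2 :> R.
  rewrite -[leLHS]invrK -[leRHS]invrK lef_pV2 ?posrE ?invr_gt0 ?expR_gt0//.
  by move: h; lra.
have -> : expR 1 = expR 2^-1 * expR 2^-1 :> R by rewrite -expRD; congr expR; lra.
move=> h2; have := expR_gt0 (2^-1 : R); move: h2.
by move: (expR _) => x; nra.
Qed.

Let V n : R := \sum_(1 <= s < n.+1) wt n (temp n) s.

Let V_le n : (0 < n)%N -> V n <= n%:R.
Proof.
move=> n0; apply: le_trans (wt_sum_le n (temp_gt0 n0)) _.
rewrite -pconst_sqr temp_invsqr mulrCA divff ?mulr1//.
by rewrite expf_neq0// gt_eqF// pconst_gt0.
Qed.

(** The logarithm comes from the harmonic sum in wt_sum_ge. *)
Let V_ge n : (0 < n)%N -> n%:R - V n <= 300 + 2 * rt n * (1 + ln n%:R).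
Proof.
move=> n0; have t0 := temp_gt0 n0.
have := wt_sum_ge n t0; rewrite -/(V n) -pconst_sqr.
have r1 := rt_ge1 n0; have nE := rt_sqr n; have /andP[c1 c2] := pconst_sqr_bounds.
have /andP[c3 c4] := pconst_bounds; have c0 := pconst_gt0.
have Zl := zeta2_part_le R n; have Zg := zeta2_part_ge R n0.
rewrite -pconst_sqr in Zl Zg.
have H := harmonic_sum_le R n0.
set Z := zeta2_part R n in Zl Zg *; set h := \sum_(_ <= _ < _) _^-1 in H *.
have r0 : 0 < rt n by apply: lt_le_trans r1.
have tn : temp n * n%:R = pconst * rt n.
  by rewrite -nE expr2 mulrA temp_rt.
have tn2 : temp n / 2 * n%:R = pconst * rt n / 2 by rewrite mulrAC tn.
rewrite tn tn2.
have E1 : expR (- (pconst * rt n)) <= 24 / (pconst * rt n) ^+ 4.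
  exact: (@expRN_le_pow R _ 4 (mulr_gt0 c0 r0)).
have E2 : expR (- (pconst * rt n / 2)) <= 2 / (pconst * rt n / 2) ^+ 2.
  by apply: (@expRN_le_pow R _ 2); rewrite divr_gt0// mulr_gt0.
set e1 := expR _ in E1 *; set e2 := expR _ in E2 *.
have e10 : 0 <= e1 := expR_ge0 _.
have e20 : 0 <= e2 := expR_ge0 _.
have cr0 : 0 < pconst * rt n by rewrite mulr_gt0.
have cV : (pconst ^+ 2)^-1 <= 3 / 2.
  rewrite -[leRHS]invrK lef_pV2 ?posrE ?exprn_gt0//; move: c1; lra.
have cV0 : 0 < (pconst ^+ 2)^-1 by rewrite invr_gt0 exprn_gt0.
have c1V : pconst^-1 <= 2.
  by rewrite -[leRHS]invrK lef_pV2 ?posrE ?exprn_gt0.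
have n1 : 1 <= n%:R :> R by rewrite ler1n.
have h0 : 0 <= h by apply: sumr_ge0 => l _; rewrite invr_ge0.
rewrite temp_invsqr.
have -> : pconst ^+ 2 / (temp n / 2) ^+ 2 = 4 * n%:R.
  rewrite /temp -nE; move: (gt_eqF r0) (gt_eqF c0).
  by move: (rt n) (pconst) => a b /negbT a0 /negbT b0; field; rewrite a0 b0.
have ta : n%:R - 12 <= n%:R / pconst ^+ 2 * Z.
  apply: (@le_trans _ _ (n%:R / pconst ^+ 2 * (pconst ^+ 2 - 8 / n%:R))); last first.
    by rewrite ler_wpM2l// divr_ge0// exprn_ge0// ltW.
  have -> : n%:R / pconst ^+ 2 * (pconst ^+ 2 - 8 / n%:R) = n%:R - 8 * (pconst ^+ 2)^-1.
    have n'0 : n%:R != 0 :> R by rewrite pnatr_eq0 -lt0n.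
    by field; rewrite n'0 gt_eqF.
  by move: cV; lra.
have tb : n%:R / pconst ^+ 2 * (2 * n.+1%:R * e1 * Z) <= 216.
  apply: (@le_trans _ _ (n%:R / pconst ^+ 2 *
     (2 * (2 * n%:R) * (24 / (pconst * rt n) ^+ 4) * pconst ^+ 2))).
    rewrite ler_wpM2l ?divr_ge0 ?exprn_ge0 ?(ltW c0)//.
    apply: ler_pM => //; [by rewrite !mulr_ge0|exact: sumr_ge0|].
    apply: ler_pM => //; rewrite ler_pM2l// -natr1; move: n1; lra.
  have -> : n%:R / pconst ^+ 2 * (2 * (2 * n%:R) * (24 / (pconst * rt n) ^+ 4) * pconst ^+ 2)
     = 96 * ((pconst ^+ 2)^-1 * (pconst ^+ 2)^-1).
    rewrite -nE; move: (gt_eqF r0) (gt_eqF c0).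
    by move: (rt n) (pconst) => a b /negbT a0 /negbT b0; field; rewrite a0 b0.
  have : (pconst ^+ 2)^-1 * (pconst ^+ 2)^-1 <= 3 / 2 * (3 / 2).
    by apply: ler_pM => //; exact: ltW.
  lra.
have tc : n%:R / pconst ^+ 2 * (temp n * h) <= 2 * rt n * (1 + ln n%:R).
  have -> : n%:R / pconst ^+ 2 * (temp n * h) = pconst^-1 * rt n * h.
    rewrite -nE /temp; move: (gt_eqF r0) (gt_eqF c0).
    by move: (rt n) (pconst) => a b /negbT a0 /negbT b0; field; rewrite a0 b0.
  apply: ler_pM => //; first by rewrite mulr_ge0 ?invr_ge0 ?ltW.
  by rewrite ler_wpM2r// ltW.
have td : e2 * (4 * n%:R) <= 48.
  apply: (@le_trans _ _ (2 / (pconst * rt n / 2) ^+ 2 * (4 * n%:R))).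
    by rewrite ler_wpM2r// mulr_ge0.
  have -> : 2 / (pconst * rt n / 2) ^+ 2 * (4 * n%:R) = 32 * (pconst ^+ 2)^-1.
    rewrite -nE; move: (gt_eqF r0) (gt_eqF c0).
    by move: (rt n) (pconst) => a b /negbT a0 /negbT b0; field; rewrite a0 b0.
  move: cV; lra.
have -> : n%:R / pconst ^+ 2 * ((1 - 2 * n.+1%:R * e1) * Z - temp n * h) =
  n%:R / pconst ^+ 2 * Z - n%:R / pconst ^+ 2 * (2 * n.+1%:R * e1 * Z)
   - n%:R / pconst ^+ 2 * (temp n * h) by ring.
move: ta tb tc td; lra.
Qed.

(** The defect n - V is O(sqrt n log n), well below the scale n^(3/4) at which
    it could matter. *)
Let V_defect (delta : R) : 0 < delta -> exists n0 : nat, forall n, (n0 <= n)%N ->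
  (0 < n)%N -> (n%:R - V n) ^+ 2 <= delta * rt n ^+ 3.
Proof.
move=> d0; pose X : R := 318 ^+ 2 / delta.
have X0 : 0 < X by apply: divr_gt0 d0; apply: exprn_gt0; rewrite ltr0n.
exists (Num.truncn (X ^+ 4)).+1 => n nX n0.
have nXR : X ^+ 4 <= n%:R.
  apply: (@le_trans _ _ (Num.truncn (X ^+ 4)).+1%:R); last by rewrite ler_nat.
  by apply/ltW; rewrite truncnS_gt.
have r1 := rt_ge1 n0; have r0 : 0 < rt n by apply: lt_le_trans r1.
pose w := Num.sqrt (Num.sqrt (rt n)).
have s1 : 1 <= Num.sqrt (rt n) by rewrite -[leLHS]sqrtr1; exact: ler_wsqrtr.
have w1 : 1 <= w by rewrite -[leLHS]sqrtr1; exact: ler_wsqrtr.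
have w0 : 0 < w by apply: lt_le_trans w1.
have w2E : w ^+ 2 = Num.sqrt (rt n) by rewrite sqr_sqrtr.
have w4E : w ^+ 4 = rt n.
  by rewrite (exprM w 2 2) w2E sqr_sqrtr// ltW.
have w2X : X <= w ^+ 2.
  rewrite -(@ler_pXn2r _ 4) ?nnegrE ?exprn_ge0 ?(ltW X0) ?(le_trans ler01)//.
  by rewrite -exprM (_ : 2 * 4 = 4 * 2)%N// exprM w4E rt_sqr.
have lnE : ln n%:R <= 8 * w.
  have -> : n%:R = w ^+ 8 by rewrite -rt_sqr -w4E -exprM.
  by rewrite lnXn// -[leLHS]mulr_natl ler_wpM2l// ltW// ln_sublinear.
have e0 : 0 <= n%:R - V n by rewrite subr_ge0 V_le.
have e1 : n%:R - V n <= 318 * (rt n * w).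
  apply: le_trans (V_ge n0) _.
  have rw : rt n <= rt n * w by rewrite ler_peMr// ltW.
  have := ler_wpM2l (ltW r0) lnE; move: rw r1; lra.
apply: (@le_trans _ _ ((318 * (rt n * w)) ^+ 2)).
  by apply: lerXn2r => //; rewrite nnegrE; exact: le_trans e0 e1.
rewrite -w4E in r0 *; move: w2X; rewrite /X ler_pdivrMr// => w2X.
have -> : (318 * (w ^+ 4 * w)) ^+ 2 = w ^+ 10 * 318 ^+ 2 by ring.
apply: (@le_trans _ _ (w ^+ 10 * (w ^+ 2 * delta))).
  by rewrite ler_wpM2l// exprn_ge0// (le_trans ler01).
by rewrite le_eqVlt; apply/orP; left; apply/eqP; ring.
Qed.

(** The value 1/8 of eta makes 4 c^2 eta^2 at most 1/4 in the bound on the first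
    weights. *)
Let euler_sequence_tilted : exists n0 : nat, forall n, (n0 <= n)%N -> (0 < n)%N ->
  exists M ys, euler_sequence 1000 8^-1 n (rt n) (temp n) (wt n (temp n)) (tilted n) M ys.
Proof.
have [n0 Hn0] := @V_defect (4^-1) (ltac:(by rewrite invr_gt0)).
exists n0 => n n0n n_gt0.
have t0 := temp_gt0 n_gt0; have r1 := rt_ge1 n_gt0.
have r0 : 0 < rt n by apply: lt_le_trans r1.
have c0 := pconst_gt0; have /andP[cl ch] := pconst_bounds.
have /andP[c2l c2h] := pconst_sqr_bounds.
have h0 y : 0 <= tilted n y by rewrite mulr_ge0 ?expR_ge0.
have h00 : 0 < tilted n 0 by rewrite mulr_gt0 ?expR_gt0// ltr0n npart_gt0.
have cV : pconst^-1 <= 2 by rewrite -[leRHS]invrK lef_pV2 ?posrE.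
have cV0 : 0 < pconst^-1 by rewrite invr_gt0.
pose ys := [arg max_(i > (ord0 : 'I_n.+1)) tilted n i]%O.
exists (tilted n ys), ys; split => //.
- by rewrite rt_sqr.
- exact: ltW.
- by rewrite temp_rt.
- by move=> s; exact: wt_ge0.
- exact: tilted_rec.
- exact: tilted_mono.
- rewrite rt_sqr V_le// andbT.
  have := Hn0 n n0n n_gt0; rewrite -[X in _ / 2 <= X]/(V n).
  have e0 : 0 <= n%:R - V n by rewrite subr_ge0 V_le.
  move=> h; suff : n%:R - V n <= n%:R / 2 by lra.
  have q0 : 0 <= n%:R / 2 :> R by rewrite divr_ge0.
  rewrite -(@ler_pXn2r _ 2) ?nnegrE//.
  apply: le_trans h _; rewrite -(rt_sqr n).
  have -> : (rt n ^+ 2 / 2) ^+ 2 = 4^-1 * rt n ^+ 4 by field.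
  by rewrite ler_wpM2l ?invr_ge0// ler_weXn2l.
- have := @wt_moment_le R n (temp n) 1 t0; rewrite -pconst_sqr /=.
  under eq_bigr do rewrite expr1.
  move=> /le_trans; apply.
  have -> : 2 ^+ 3 * 2`!%:R * pconst ^+ 2 / temp n ^+ 3 = 16 * pconst^-1 * rt n ^+ 3.
    rewrite /temp (_ : 2`! = 2)%N//; move: (gt_eqF r0) (gt_eqF c0).
    by move: (rt n) (pconst) => a b /negbT a0 /negbT b0; field; rewrite a0 b0.
  by rewrite ler_wpM2r ?exprn_ge0 ?(ltW r0)//; move: cV; lra.
- have := @wt_moment_le R n (temp n) 2 t0; rewrite -pconst_sqr /=.
  move=> /le_trans; apply.
  have -> : 2 ^+ 4 * 3`!%:R * pconst ^+ 2 / temp n ^+ 4 = 96 * (pconst^-1 * pconst^-1) * rt n ^+ 4.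
    rewrite /temp (_ : 3`! = 6)%N//; move: (gt_eqF r0) (gt_eqF c0).
    by move: (rt n) (pconst) => a b /negbT a0 /negbT b0; field; rewrite a0 b0.
  rewrite ler_wpM2r ?exprn_ge0 ?(ltW r0)//.
  have : pconst^-1 * pconst^-1 <= 2 * 2 by apply: ler_pM => //; exact: ltW.
  lra.
- move=> s /divsum_ge sn; rewrite /wt ler_wpM2r ?expR_ge0// ler_nat.
  exact: sn.
- move=> z zn zr.
  have q0 : 0 < 8^-1 * rt n by rewrite mulr_gt0 ?invr_gt0.
  have u0 : 0 < (8^-1 * rt n)^-1 by rewrite invr_gt0.
  apply: le_trans (wt_sum_trunc_le t0 u0 zn) _; rewrite -pconst_sqr.
  apply: (@le_trans _ _ (4 * (pconst ^+ 2 * (8^-1 * rt n) ^+ 2))).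
    apply: ler_pM; rewrite ?expR_ge0 ?divr_ge0 ?exprn_ge0 ?(ltW c0) ?addr_ge0 ?(ltW t0) ?(ltW u0)//.
      apply: le_trans expR1_le4; rewrite ler_expR mulrC ler_pdivrMr ?mul1r//.
    rewrite ler_wpM2l ?exprn_ge0 ?(ltW c0)//.
    rewrite -[X in _ <= X]invrK lef_pV2 ?posrE ?invr_gt0 ?exprn_gt0 ?addr_gt0//.
    rewrite -exprVn; apply: lerXn2r; rewrite ?nnegrE ?(ltW u0) ?addr_ge0 ?(ltW t0) ?(ltW u0)//.
    by rewrite lerDr ltW.
  have -> : 4 * (pconst ^+ 2 * (8^-1 * rt n) ^+ 2) = pconst ^+ 2 / 16 * rt n ^+ 2.
    by rewrite exprMn; field.
  by rewrite [leRHS]mulrC ler_wpM2r ?exprn_ge0 ?(ltW r0)//; move: c2h; lra.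
- rewrite /ys; case: arg_maxP => // i _ /(_ ord0 isT) /= h.
  exact: lt_le_trans h.
- move=> y; have [yn|ny] := ltnP y n.+1; last first.
    by rewrite {1}/tilted /npart_sub leqNgt ny/= mul0r.
  rewrite /ys; case: arg_maxP => // i _ /(_ (Ordinal yn) isT) /=; exact.
Qed.

(** The ratio of the two sides is h s / h 0 in the notation above; the upper
    estimate holds for every s because h never exceeds its maximum. *)
Lemma npart_ratio (eps : R) : 0 < eps <= 1 ->
  exists2 delta : R, 0 < delta & exists n0 : nat, forall n, (n0 <= n)%N ->
  [/\ forall s, (npart_sub n s)%:R <=
       (1 + eps) * expR (- (temp n * s%:R)) * (npart n)%:R &
     forall s, s%:R ^+ 2 <= delta * rt n ^+ 3 ->
       (1 - eps) * expR (- (temp n * s%:R)) * (npart n)%:R <=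
       (npart_sub n s)%:R :> R].
Proof.
move=> /andP[eps0 eps1].
have e2 : 0 < eps / 2 <= 1 by apply/andP; split; lra.
have eta1 : 0 < (8^-1 : R) <= 1 by rewrite invr_gt0 ltr0n invf_le1// ler1n.
have C0 : 0 < 1000 :> R by rewrite ltr0n.
have [delta d0 [rho H]] := euler_sequence_flat C0 eta1 e2.
exists delta => //.
have [n1 H1] := euler_sequence_tilted; have [n2 H2] := V_defect d0.
exists (n1 + n2 + (Num.truncn (rho ^+ 2)).+1)%N => n nn.
have n_gt0 : (0 < n)%N by apply: leq_trans nn; rewrite addnS.
have [M [ys es]] := H1 n (leq_trans (leq_trans (leq_addr _ _) (leq_addr _ _)) nn) n_gt0.
have ee := H2 n (leq_trans (leq_trans (leq_addl _ _) (leq_addr _ _)) nn) n_gt0.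
have rr : rho <= rt n.
  have [/ltW r0|r0] := ltP rho 0; first exact: le_trans r0 (sqrtr_ge0 _).
  rewrite -(@ler_pXn2r _ 2) ?nnegrE ?sqrtr_ge0// rt_sqr.
  apply: (@le_trans _ _ (Num.truncn (rho ^+ 2)).+1%:R).
    by apply/ltW; rewrite truncnS_gt.
  by rewrite ler_nat (leq_trans (leq_addl _ _) nn).
have {}H := H _ _ _ _ _ _ _ es rr ee.
have M0 := es_M es; have hM := es_max es.
have tE s : (npart_sub n s)%:R = tilted n s * expR (temp n * n%:R) *
    expR (- (temp n * s%:R)).
  rewrite /tilted -!mulrA -!expRD.
  by rewrite (_ : _ + (_ + _) = 0) ?expR0 ?mulr1//; ring.
have h0 : (1 - eps / 2) * M <= tilted n 0.
  by apply: H; rewrite expr0n/= mulr_ge0 ?exprn_ge0 ?sqrtr_ge0// ltW.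
have pE : (npart n)%:R = tilted n 0 * expR (temp n * n%:R).
  have := tE 0%N; rewrite mulr0 oppr0 expR0 mulr1 => <-.
  by rewrite /npart_sub subn0.
have E0 := expR_gt0 (temp n * n%:R).
split=> s.
  rewrite tE pE mulrAC [leRHS](_ : _ =
   (1 + eps) * tilted n 0 * expR (- (temp n * s%:R)) * expR (temp n * n%:R)); last by ring.
  rewrite ler_pM2r// ler_wpM2r ?expR_ge0//.
  apply: le_trans (hM s) _.
  apply: (@le_trans _ _ ((1 + eps) * ((1 - eps / 2) * M))); last first.
    by rewrite ler_wpM2l//; lra.
  rewrite mulrA ler_peMl ?(ltW M0)//; nra.
move=> sd; rewrite tE pE mulrAC [leRHS]mulrAC mulrA.
rewrite [leLHS](_ : _ =
   (1 - eps) * tilted n 0 * expR (- (temp n * s%:R)) * expR (temp n * n%:R)); last by ring.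
rewrite ler_pM2r// ler_wpM2r ?expR_ge0//.
apply: le_trans (H s sd).
apply: (@le_trans _ _ ((1 - eps) * M)); first by rewrite ler_wpM2l//; lra.
by rewrite ler_wpM2r ?(ltW M0)//; lra.
Qed.

End partition_ratio.

(** * Inclusion-exclusion over the part sizes *)

Section inclusion_exclusion.
Variable R : realType.

Lemma card_conj_part n (p : pred (intpart n)) :
  #|[pred k | p (conj_part k)]| = #|p|.
Proof.
rewrite -[RHS](fintype.card_image (inv_inj (@conj_partK n))); apply: eq_card => k.
rewrite !inE/=; apply/idP/fintype.imageP => [pk|[l pl ->]]; last by rewrite conj_partK.
by exists (conj_part k) => //; rewrite conj_partK.
Qed.

Lemma all_le_head (s : seq nat) m : sorted geq s ->
  all (fun k => k <= m)%N s = (head 0%N s <= m)%N.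
Proof.
move=> s_sorted; apply/allP/idP => [h|h x xs].
  by case: s h {s_sorted} => //= x s; apply; rewrite mem_head.
exact: leq_trans (le_head s_sorted xs) h.
Qed.

(** Conjugation exchanges the number of parts with the largest part. *)
Lemma card_size_le n m :
  #|[pred k : intpart n | (size k <= m)%N]| =
  #|[pred k : intpart n | all (fun i => i <= m)%N k]|.
Proof.
rewrite -(card_conj_part [pred k : intpart n | all _ k]).
apply: eq_card => k; rewrite !inE -head_conj_part all_le_head//.
by case/and3P: (partsP (conj_part k)).
Qed.

Lemma sum_subset_prod (I : finType) (x : I -> R) :
  \sum_(J : {set I}) \prod_(j in J) x j = \prod_j (1 + x j).
Proof.
under [RHS]eq_bigr do rewrite addrC.
rewrite bigA_distr; apply: eq_bigr => J _.
by rewrite big_mkcond.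
Qed.

Lemma sum_subset_signed_prod (I : finType) (x : I -> R) :
  \sum_(J : {set I}) (-1) ^+ #|J| * \prod_(j in J) x j = \prod_j (1 - x j).
Proof.
rewrite -sum_subset_prod; apply: eq_bigr => J _.
by rewrite prodrN.
Qed.

(** Expand the indicator that no part exceeds m as a product over the forbidden
    sizes. *)
Lemma card_parts_le n m :
  #|[pred k : intpart n | all (fun i => i <= m)%N k]|%:R =
  \sum_(J : {set 'I_n.+1}) (-1) ^+ #|J| * (\prod_(j in J) (m < j)%N%:R) *
    (npart_sub n (\sum_(j in J) j)%N)%:R :> R.
Proof.
have ind (k : intpart n) : (all (fun i => i <= m)%N k)%:R =
    \prod_(j < n.+1) (1 - ((m < j)%N && (val j \in (k : seq nat)))%:R) :> R.
  case: (boolP (all _ _)) => [/allP h|/allPn[i ik im]].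
    rewrite big1// => j _; case: andP => [[mj jk]|]; last by rewrite subr0.
    by have := h _ jk; rewrite leqNgt mj.
  have /andP[_ iN] := intpart_mem_le ik.
  rewrite (bigD1 (Ordinal (iN : (i < n.+1)%N)))//= ltnNge im ik subrr.
  by rewrite mul0r.
rewrite -sum1_card natr_sum big_mkcond/=.
transitivity (\sum_(k : intpart n) \sum_(J : {set 'I_n.+1}) (-1) ^+ #|J| *
    \prod_(j in J) ((m < j)%N && (val j \in (k : seq nat)))%:R : R).
  apply: eq_bigr => k _; rewrite sum_subset_signed_prod -ind inE.
  by case: (all _ _).
rewrite exchange_big/=; apply: eq_bigr => J _.
rewrite -mulr_sumr -mulrA; congr (_ * _).
have [JM|/forallPn[j]] := boolP [forall j, (j \in J) ==> (m < j)%N]; last first.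
  rewrite negb_imply => /andP[jJ /negbTE jm].
  rewrite [X in _ = X * _](bigD1 j)//= jm !mul0r big1// => k _.
  by rewrite (bigD1 j)//= jm mul0r.
have {}JM j : j \in J -> (m < j)%N by move=> jJ; have /forallP/(_ j)/implyP := JM; apply.
rewrite [X in _ = X * _]big1 ?mul1r => [|j /JM ->//].
pose mu := [seq val j | j <- enum J].
have muP : all (leq 1) mu.
  apply/allP => i /mapP[j]; rewrite mem_enum => /JM mj ->.
  exact: leq_trans mj.
have mu_uniq : uniq mu by rewrite map_inj_uniq ?enum_uniq//; exact: val_inj.
have -> : (\sum_(j in J) j)%N = sumn mu by rewrite sumnE big_map big_enum.
rewrite -(card_contains n muP) -sum1_card natr_sum [RHS]big_mkcond/=.
apply: eq_bigr => k _; rewrite inE.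
have -> : contains mu k = [forall j, (j \in J) ==> (val j \in (k : seq nat))].
  apply/allP/forallP => [h j|h i].
    apply/implyP => jJ; have jmu : val j \in mu by apply/map_f; rewrite mem_enum.
    have := h _ jmu; rewrite (count_uniq_mem _ mu_uniq) jmu -has_pred1 has_count.
    exact.
  move=> /mapP[j]; rewrite mem_enum => jJ ->.
  rewrite (count_uniq_mem _ mu_uniq) (leq_trans (leq_b1 _))//.
  by rewrite -has_count has_pred1; have /implyP := h j; apply.
have [Jk|/forallPn[j]] := boolP [forall j, (j \in J) ==> (val j \in (k : seq nat))].
  rewrite big1// => j jJ; rewrite JM//=.
  by have /forallP/(_ j)/implyP -> := Jk.
rewrite negb_imply => /andP[jJ /negbTE jk].
by rewrite (bigD1 j)//= jk andbF mul0r.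
Qed.

Lemma prod_1D_le_expR (I : finType) (x : I -> R) : (forall j, 0 <= x j) ->
  \prod_j (1 + x j) <= expR (\sum_j x j).
Proof.
move=> x0; rewrite expR_sum; apply: ler_prod => j _.
by rewrite addr_ge0//= expR_ge1Dx.
Qed.

(** The subsets J of total weight s_J behave as under the product measure: their
    mean weight is at most sum_j w_j x_j. *)
Lemma subset_sum_perturbation (I : finType) (x : I -> R) (w : I -> nat)
    (rho : nat -> R) (eps kappa : R) :
  (forall j, 0 <= x j) -> 0 <= eps -> 0 <= kappa ->
  (forall s, `|rho s - 1| <= eps + kappa * s%:R) ->
  `|\sum_(J : {set I}) (-1) ^+ #|J| * (\prod_(j in J) x j) *
      rho (\sum_(j in J) w j)%N - \prod_j (1 - x j)|
  <= (eps + kappa * \sum_j (w j)%:R * x j) * expR (\sum_j x j).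
Proof.
move=> x0 e0 k0 rhoP; rewrite -sum_subset_signed_prod -sumrB.
have px (J : {set I}) : 0 <= \prod_(j in J) x j by apply: prodr_ge0.
apply: le_trans (ler_norm_sum _ _ _) _.
apply: (@le_trans _ _ (\sum_(J : {set I}) ((\prod_(j in J) x j) * eps +
    kappa * ((\prod_(j in J) x j) * \sum_(j in J) (w j)%:R)))).
  apply: ler_sum => J _;
  rewrite -[X in _ - X]mulr1 -mulrBr normrM normrM normrX normrN1 expr1n mul1r.
  rewrite ger0_norm// mulrCA -mulrDr ler_wpM2l//.
  by rewrite -natr_sum.
rewrite big_split/= -mulr_suml -mulr_sumr sum_subset_prod.
have weighted : \sum_(J : {set I}) (\prod_(j in J) x j) * \sum_(j in J) (w j)%:R
    <= (\sum_j (w j)%:R * x j) * \prod_j (1 + x j).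
  have -> : \sum_(J : {set I}) (\prod_(j in J) x j) * \sum_(j in J) (w j)%:R =
      \sum_j (w j)%:R * \sum_(J : {set I} | j \in J) \prod_(i in J) x i.
    under eq_bigr do rewrite mulr_sumr.
    rewrite (exchange_big_dep xpredT)//=; apply: eq_bigr => j _.
    by rewrite mulr_sumr; apply: eq_bigr => J _; rewrite mulrC.
  rewrite mulr_suml; apply: ler_sum => j _; rewrite -mulrA ler_wpM2l//.
  have -> : \sum_(J : {set I} | j \in J) \prod_(i in J) x i =
      \prod_i (x i + (i != j)%:R).
    rewrite bigA_distr [LHS]big_mkcond/=; apply: eq_bigr => J _.
    case: ifP => jJ; last by rewrite (bigD1 j)//= jJ eqxx mul0r.
    rewrite big_mkcond/=; apply: eq_bigr => i _; case: ifP => // iJ.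
    by case: eqP => // ij; rewrite ij jJ in iJ.
  rewrite (bigD1 j)//= eqxx addr0 ler_wpM2l//.
  rewrite [leRHS](bigD1 j)//= -[leLHS]mul1r ler_pM ?prodr_ge0//.
    by move=> i _; rewrite addr_ge0.
    by rewrite lerDl.
  by apply: ler_prod => i /negbTE ->; rewrite addr_ge0//= addrC.
have P := prod_1D_le_expR x0.
apply: (@le_trans _ _ ((eps + kappa * \sum_j (w j)%:R * x j) * \prod_j (1 + x j))).
  rewrite mulrDl [X in X + _]mulrC -mulrA lerD2l.
  by rewrite mulrA -mulrA ler_wpM2l.
rewrite ler_wpM2l// addr_ge0// mulr_ge0// sumr_ge0// => j _.
by rewrite mulr_ge0.
Qed.

End inclusion_exclusion.

(** * The number of parts *)

Section erdos_lehner.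
Variable R : realType.

Let x n m (j : 'I_n.+1) : R := (m < j)%N%:R * expR (- (temp R n * j%:R)).

Let Lambda n m : R := \sum_(m.+1 <= j < n.+1) expR (- (temp R n * j%:R)).

Let sum_ord_gt n m (F : nat -> R) :
  \sum_(j < n.+1) (m < j)%N%:R * F j = \sum_(m.+1 <= j < n.+1) F j.
Proof.
rewrite [RHS](big_nat_widenl _ 0)//= -(big_mkord xpredT (fun j => (m < j)%N%:R * F j)).
rewrite [RHS]big_mkcond/=; apply: eq_bigr => j _.
by case: ifP; rewrite ?mul1r ?mul0r.
Qed.

Definition prob_le n m : R :=
  #|[pred k : intpart n | (size k <= m)%N]|%:R / (npart n)%:R.

(** The ratio p(n - s) / p(n) has relative error eps for s up to
    sqrt (delta n^(3/2)). Beyond that the error is at most 1, which is less than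
    s / sqrt (delta n^(3/2)). *)
Let prob_le_error (eps : R) : 0 < eps <= 1 ->
  exists2 delta : R, 0 < delta & exists n0 : nat, forall n m, (n0 <= n)%N ->
  `|prob_le n m - \prod_(j < n.+1) (1 - x m j)| <=
  (eps + (Num.sqrt (delta * rt R n ^+ 3))^-1 *
     \sum_(m.+1 <= j < n.+1) j%:R * expR (- (temp R n * j%:R))) *
  expR (Lambda n m).
Proof.
move=> eP; have /andP[e0 e1] := eP.
have [delta d0 [n0 H]] := npart_ratio eP.
exists delta => //; exists n0.+1 => n m n0n.
have [H1 H2] := H n (ltnW n0n).
have p0 : 0 < (npart n)%:R :> R by rewrite ltr0n npart_gt0.
have r0 : 0 < rt R n.
  by apply: (lt_le_trans ltr01); rewrite rt_ge1// (leq_trans _ n0n).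
pose rho s : R := (npart_sub n s)%:R / (expR (- (temp R n * s%:R)) * (npart n)%:R).
have -> : prob_le n m = \sum_(J : {set 'I_n.+1}) (-1) ^+ #|J| *
    (\prod_(j in J) x m j) * rho (\sum_(j in J) j)%N.
  rewrite /prob_le card_size_le card_parts_le mulr_suml; apply: eq_bigr => J _.
  rewrite /x big_split/= /rho.
  have -> : \prod_(j in J) expR (- (temp R n * j%:R)) =
      expR (- (temp R n * (\sum_(j in J) j)%N%:R)).
    by rewrite natr_sum mulr_sumr -sumrN expR_sum.
  rewrite invfM; set E := expR _; set p : R := (npart n)%:R.
  have E0 : E != 0 by rewrite gt_eqF// expR_gt0.
  have p'0 : p != 0 by rewrite gt_eqF.
  by clearbody E p; field; rewrite E0 p'0.
have -> : \sum_(m.+1 <= j < n.+1) j%:R * expR (- (temp R n * j%:R)) =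
    \sum_(j < n.+1) (nat_of_ord j)%:R * x m j.
  rewrite -sum_ord_gt; apply: eq_bigr => j _; rewrite /x; ring.
rewrite /Lambda -sum_ord_gt; apply: subset_sum_perturbation => //.
- by move=> j; rewrite mulr_ge0 ?expR_ge0.
- exact: ltW.
move=> s; have E0 := expR_gt0 (- (temp R n * s%:R)).
have q0 : 0 < expR (- (temp R n * s%:R)) * (npart n)%:R by rewrite mulr_gt0.
have rho1 : rho s <= 1 + eps by rewrite ler_pdivrMr// mulrA.
have rho0 : 0 <= rho s by rewrite divr_ge0// ltW.
have dr0 : 0 < delta * rt R n ^+ 3 by rewrite mulr_gt0// exprn_gt0.
have sq0 : 0 < Num.sqrt (delta * rt R n ^+ 3) by rewrite sqrtr_gt0.
have ks0 : 0 <= (Num.sqrt (delta * rt R n ^+ 3))^-1 * s%:R.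
  by rewrite mulr_ge0// invr_ge0 ltW.
have [/H2 h|/ltW h] := leP (s%:R ^+ 2) (delta * rt R n ^+ 3).
  have rho2 : 1 - eps <= rho s by rewrite ler_pdivlMr// mulrA.
  rewrite ler_norml; move: rho1 rho2 ks0; set k := _ * s%:R; lra.
have : 1 <= (Num.sqrt (delta * rt R n ^+ 3))^-1 * s%:R.
  rewrite mulrC ler_pdivlMr// mul1r -[leRHS]ger0_norm// -sqrtr_sqr.
  exact: ler_wsqrtr.
rewrite ler_norml; move: rho1 rho0 e0 e1; set k := _ * s%:R; lra.
Qed.

Let mu n (z : R) : R := (temp R n)^-1 * (ln (temp R n)^-1 + z).

Section bounds.
Variables (n m : nat) (z : R).
Hypothesis n0 : (0 < n)%N.
Hypothesis mP : m%:R <= mu n z < m.+1%:R.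
Let t := temp R n.
Let t0 : 0 < t := temp_gt0 R n0.

Let tmu : expR (- (t * mu n z)) = t * expR (- z).
Proof.
rewrite /mu mulrA divff ?gt_eqF// mul1r opprD expRD lnV ?posrE// opprK.
by rewrite lnK ?posrE.
Qed.

Let y_ge : t * expR (- z) <= expR (- (t * m%:R)).
Proof.
rewrite -tmu ler_expR lerN2 ler_wpM2l ?(ltW t0)//.
by case/andP: mP.
Qed.

Let y_le : expR (- (t * m%:R)) <= t * expR (- z) * expR t.
Proof.
rewrite -tmu -expRD ler_expR.
have : t * mu n z <= t * m.+1%:R.
  by rewrite ler_wpM2l ?(ltW t0)//; case/andP: mP => _ /ltW.
rewrite -natr1; lra.
Qed.

Let shift_sum (F : nat -> R) : \sum_(m.+1 <= j < n.+1) F j =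
  \sum_(1 <= i < (n - m).+1) F (m + i)%N.
Proof.
have [mn|nm] := leqP m n; last first.
  by rewrite !big_geq// ltnS ?(ltnW nm)// leqn0 subn_eq0 ltnW.
rewrite -{1}(add1n m) -{1}(subnK mn) -addSn big_addn addnK.
by apply: eq_bigr => i _; rewrite addnC.
Qed.

Let LambdaE : Lambda n m =
  expR (- (t * m%:R)) * \sum_(1 <= i < (n - m).+1) expR (- (t * i%:R)).
Proof.
rewrite /Lambda shift_sum mulr_sumr; apply: eq_bigr => i _.
by rewrite natrD mulrDr opprD expRD.
Qed.

Let Lambda_le : Lambda n m <= expR (- z) * expR t.
Proof.
rewrite LambdaE.
apply: (@le_trans _ _ (t * expR (- z) * expR t * t^-1)).
  apply: ler_pM => //; rewrite ?expR_ge0//; last exact: geometric_expR_le.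
  by apply: sumr_ge0 => i _; rewrite expR_ge0.
by rewrite le_eqVlt; apply/orP; left; apply/eqP; field; rewrite gt_eqF.
Qed.

Let Lambda_ge : expR (- t) * (expR (- z) - expR (- (t * n%:R)) / t) <= Lambda n m.
Proof.
have key : expR (- (t * m%:R)) - expR (- (t * n%:R)) <= t * expR t * Lambda n m.
  have [mn|nm] := leqP m n; last first.
    rewrite /Lambda big_geq ?ltnS ?(ltnW nm)// mulr0 subr_le0 ler_expR lerN2.
    by rewrite ler_wpM2l ?(ltW t0)// ler_nat ltnW.
  have -> : expR (- (t * m%:R)) - expR (- (t * n%:R)) =
     - \sum_(m <= j < n) (expR (- (t * j.+1%:R)) - expR (- (t * j%:R))).
    by rewrite (telescope_sumr (fun j : nat => expR (- (t * j%:R))))// opprB.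
  rewrite /Lambda big_add1/= mulr_sumr -sumrN; apply: ler_sum => j _.
  have -> : expR (- (t * j%:R)) = expR (- (t * j.+1%:R)) * expR t.
    by rewrite -expRD -natr1; congr expR; ring.
  set a := expR (- _); rewrite opprB -[X in _ - X]mulr1 -mulrBr mulrC.
  rewrite ler_wpM2r ?expR_ge0//.
  have := expR_ge1Dx (- t); rewrite expRN => h.
  have := ler_wpM2r (expR_ge0 t) h; rewrite mulVf ?gt_eqF ?expR_gt0//.
  lra.
rewrite expRN ler_pdivrMl ?expR_gt0// -(ler_pM2l t0) mulrBr.
rewrite [t * (_ / t)]mulrC divfK ?gt_eqF//; move: y_ge key.
by rewrite -/t mulrA; lra.
Qed.

Let weight_le : \sum_(m.+1 <= j < n.+1) j%:R * expR (- (t * j%:R)) <=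
  expR (- z) * expR t * (mu n z + 4 / t).
Proof.
have -> : \sum_(m.+1 <= j < n.+1) j%:R * expR (- (t * j%:R)) =
    expR (- (t * m%:R)) *
    (m%:R * \sum_(1 <= i < (n - m).+1) expR (- (t * i%:R)) +
     \sum_(1 <= i < (n - m).+1) i%:R ^+ 1 * expR (- (t * i%:R))).
  rewrite shift_sum mulr_sumr -big_split/= mulr_sumr; apply: eq_bigr => i _.
  by rewrite natrD mulrDr opprD expRD expr1; ring.
apply: (@le_trans _ _ (t * expR (- z) * expR t * (mu n z / t + 4 / t ^+ 2))).
  apply: ler_pM => //; rewrite ?expR_ge0//.
    apply: addr_ge0.
      by rewrite mulr_ge0// sumr_ge0// => i _; exact: expR_ge0.
    by apply: sumr_ge0 => i _; apply: mulr_ge0; rewrite ?expR_ge0.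
  apply: lerD.
    apply: ler_pM => //; [|by case/andP: mP|exact: geometric_expR_le].
    by apply: sumr_ge0 => i _; rewrite expR_ge0.
  have := @pow_expR_sum_le R t 1 (n - m).+1 t0 => /le_trans; apply.
  rewrite ler_wpM2r ?invr_ge0 ?exprn_ge0 ?(ltW t0)//.
  by rewrite (_ : 1`! = 1)%N// !exprS expr0; lra.
rewrite le_eqVlt; apply/orP; left; apply/eqP.
by move: (mu n z) => M; field; rewrite gt_eqF.
Qed.

Let prod_le : \prod_(j < n.+1) (1 - x m j) <= expR (- Lambda n m).
Proof.
rewrite /Lambda -sum_ord_gt -sumrN expR_sum; apply: ler_prod => j _.
rewrite expR_ge1Dx andbT subr_ge0 mulr_ile1 ?expR_ge0// ?lern1 ?leq_b1//.
by rewrite -[leRHS]expR0 ler_expR oppr_le0 mulr_ge0// ltW.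
Qed.

Let prod_ge (Y : R) : t * expR (- z) * expR t <= Y < 1 ->
  expR (- (Lambda n m / (1 - Y))) <= \prod_(j < n.+1) (1 - x m j).
Proof.
move=> /andP[yY Y1]; rewrite /Lambda -sum_ord_gt mulr_suml -sumrN expR_sum.
apply: ler_prod => j _; rewrite expR_ge0/= -/(x m j).
have Y1' : 0 < 1 - Y by rewrite subr_gt0.
have xj0 : 0 <= x m j by rewrite mulr_ge0 ?expR_ge0.
have xY : x m j <= Y.
  rewrite /x; case: ltnP => mj; last first.
    rewrite mul0r; apply: le_trans yY.
    by apply: mulr_ge0 (expR_ge0 _); apply: mulr_ge0 (expR_ge0 _); exact: ltW.
  rewrite mul1r; apply: le_trans yY; apply: le_trans y_le.
  by rewrite ler_expR lerN2 ler_wpM2l ?(ltW t0)// ler_nat ltnW.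
have x1 : 0 < 1 - x m j by rewrite subr_gt0 (le_lt_trans xY).
apply: (@le_trans _ _ (expR (- (x m j / (1 - x m j))))).
  rewrite ler_expR lerN2 ler_wpM2l// lef_pV2 ?posrE// lerD2l lerN2//.
rewrite expRN -[leRHS]invrK lef_pV2 ?posrE ?invr_gt0 ?expR_gt0//.
apply: le_trans (expR_ge1Dx _).
by rewrite le_eqVlt; apply/orP; left; apply/eqP; field; rewrite gt_eqF.
Qed.

Lemma erdos_lehner_bounds :
  [/\ Lambda n m <= expR (- z) * expR t,
      \sum_(m.+1 <= j < n.+1) j%:R * expR (- (t * j%:R)) <=
        expR (- z) * expR t * (mu n z + 4 / t),
      \prod_(j < n.+1) (1 - x m j) <=
        expR (- (expR (- t) * (expR (- z) - expR (- (t * n%:R)) / t))) &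
      t * expR (- z) * expR t < 1 ->
        expR (- (expR (- z) * expR t / (1 - t * expR (- z) * expR t))) <=
        \prod_(j < n.+1) (1 - x m j) ].
Proof.
split => //.
  by apply: le_trans prod_le _; rewrite ler_expR lerN2.
move=> Y1; apply: le_trans (prod_ge (Y := t * expR (- z) * expR t) _); last first.
  by rewrite lexx.
by rewrite ler_expR lerN2 ler_wpM2r// invr_ge0 subr_ge0 ltW.
Qed.

End bounds.

Lemma rt_near (X : R) : \forall n \near \oo, X <= rt R n.
Proof.
exists (Num.truncn (X ^+ 2)).+1 => // n /= Xn.
have [/ltW r0|r0] := ltP X 0; first exact: le_trans r0 (sqrtr_ge0 _).
rewrite -(@ler_pXn2r _ 2) ?nnegrE ?sqrtr_ge0// rt_sqr.
apply: (@le_trans _ _ (Num.truncn (X ^+ 2)).+1%:R); last by rewrite ler_nat.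
by apply/ltW; rewrite truncnS_gt.
Qed.

Lemma near_gt0 : \forall n \near \oo, (0 < n)%N.
Proof. by exists 1%N. Qed.

Lemma temp_cvg0 : temp R n @[n --> \oo] --> (0 : R).
Proof.
apply/cvgrPdist_le => e e0; near=> n.
have n0 : (0 < n)%N by near: n; exact: near_gt0.
rewrite sub0r normrN gtr0_norm ?temp_gt0// /temp ler_pdivrMr; last first.
  by apply: (lt_le_trans ltr01); rewrite rt_ge1.
rewrite mulrC -ler_pdivrMr//; near: n; exact: rt_near.
Unshelve. all: by end_near. Qed.

Let temp_inv_near (X : R) : \forall n \near \oo, X <= (temp R n)^-1.
Proof.
near=> n; rewrite /temp invf_div ler_pdivlMr ?pconst_gt0//.
near: n; exact: rt_near.
Unshelve. all: by end_near. Qed.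

Let cvg_expR (f : nat -> R) (l : R) : f n @[n --> \oo] --> l ->
  expR (f n) @[n --> \oo] --> expR l.
Proof. by move=> fl; apply: (cvg_comp _ _ fl); exact: continuous_expR. Qed.

Let cvg_cstM (f : nat -> R) (a l : R) : f n @[n --> \oo] --> l ->
  a * f n @[n --> \oo] --> a * l.
Proof. by move=> fl; apply: cvgM => //; exact: cvg_cst. Qed.

Let expR_temp_cvg (a : R) : expR (a * temp R n) @[n --> \oo] --> (1 : R).
Proof.
have := cvg_expR (cvg_cstM (a := a) temp_cvg0).
by rewrite mulr0 expR0.
Qed.

Let expR_temp_cvg1 : expR (temp R n) @[n --> \oo] --> (1 : R).
Proof. by have := expR_temp_cvg 1; under eq_fun do rewrite mul1r. Qed.

Let tail_cvg0 : expR (- (temp R n * n%:R)) / temp R n @[n --> \oo] --> (0 : R).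
Proof.
have h0 : (fun=> 0) @ \oo --> (0 : R) by exact: cvg_cst.
have h1 : 2 / pconst R ^+ 4 * temp R n @[n --> \oo] --> (0 : R).
  by have := cvg_cstM (a := 2 / pconst R ^+ 4) temp_cvg0; rewrite mulr0.
apply: (squeeze_cvgr _ h0 h1); near=> n.
have n0 : (0 < n)%N by near: n; exact: near_gt0.
have t0 := temp_gt0 R n0.
have r0 : 0 < rt R n by apply: (lt_le_trans ltr01); rewrite rt_ge1.
have c0 := pconst_gt0 R.
rewrite divr_ge0 ?expR_ge0 ?(ltW t0)//= ler_pdivrMr//.
have tn : temp R n * n%:R = pconst R * rt R n.
  by rewrite -(rt_sqr R n) expr2 mulrA temp_rt.
have := @expRN_le_pow R _ 2 (mulr_gt0 c0 r0); rewrite -tn => /le_trans; apply.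
rewrite tn /temp (_ : 2`! = 2)%N// le_eqVlt; apply/orP; left; apply/eqP.
move: (gt_eqF r0) (gt_eqF c0).
by move: (rt R n) (pconst R) => a b /negbT a0 /negbT b0; field; rewrite a0 b0.
Unshelve. all: by end_near. Qed.

Let kappa_near (delta z eps : R) : 0 < delta -> 0 < eps ->
  \forall n \near \oo, (Num.sqrt (delta * rt R n ^+ 3))^-1 *
    (mu n z + 4 / temp R n) <= eps.
Proof.
move=> d0 e0; have c0 := pconst_gt0 R.
pose K := (Num.sqrt (delta * pconst R ^+ 3))^-1.
have dc0 : 0 < delta * pconst R ^+ 3 by rewrite mulr_gt0// exprn_gt0.
have K0 : 0 < K by rewrite invr_gt0 sqrtr_gt0.
pose X := 1 + K * (8 + `|z|) / eps.
have q0 : 0 < K * (8 + `|z|) by rewrite mulr_gt0// ltr_wpDr.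
have X0 : 0 <= X by rewrite addr_ge0// divr_ge0// ltW.
near=> n.
have n0 : (0 < n)%N by near: n; exact: near_gt0.
have t0 := temp_gt0 R n0; have tV0 : 0 < (temp R n)^-1 by rewrite invr_gt0.
have tX : X ^+ 4 <= (temp R n)^-1 by near: n; exact: temp_inv_near.
pose w := Num.sqrt (Num.sqrt (temp R n)^-1).
have w2E : w ^+ 2 = Num.sqrt (temp R n)^-1 by rewrite sqr_sqrtr ?sqrtr_ge0.
have w4E : w ^+ 4 = (temp R n)^-1.
  by rewrite (exprM w 2 2) w2E sqr_sqrtr// ltW.
have wX : X <= w.
  by rewrite -(@ler_pXn2r _ 4) ?nnegrE ?sqrtr_ge0// w4E.
have w1 : 1 <= w.
  by apply: le_trans wX; rewrite lerDl divr_ge0// ltW.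
have w0 : 0 < w by apply: lt_le_trans w1.
have rE : rt R n = pconst R * w ^+ 4 by rewrite w4E -(temp_rt R n0) mulrC mulKf ?gt_eqF.
have -> : Num.sqrt (delta * rt R n ^+ 3) = K^-1 * w ^+ 6.
  have -> : delta * rt R n ^+ 3 = delta * pconst R ^+ 3 * (w ^+ 6) ^+ 2.
    by rewrite rE; ring.
  by rewrite sqrtrM ?(ltW dc0)// sqrtr_sqr ger0_norm ?exprn_ge0 ?(ltW w0)// /K invrK.
rewrite /mu -w4E.
have lnE : ln (w ^+ 4) <= 4 * w.
  by rewrite lnXn// -[leLHS]mulr_natl ler_wpM2l// ltW// ln_sublinear.
have zz : z <= `|z| * w.
  by apply: le_trans (ler_norm z) _; rewrite ler_peMr.
have h : ln (w ^+ 4) + z + 4 <= (8 + `|z|) * w by rewrite mulrDl; lra.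
have -> : (K^-1 * w ^+ 6)^-1 * (w ^+ 4 * (ln (w ^+ 4) + z) + 4 * w ^+ 4) =
    K * w ^- 2 * (ln (w ^+ 4) + z + 4).
  move: (ln _) => l; move: (gt_eqF K0) (gt_eqF w0) => /negbT k0 /negbT w'0.
  by clearbody K w; field; rewrite k0 w'0.
apply: (@le_trans _ _ (K * w ^- 2 * ((8 + `|z|) * w))).
  by rewrite ler_wpM2l// mulr_ge0 ?(ltW K0)// invr_ge0 exprn_ge0// ltW.
have -> : K * w ^- 2 * ((8 + `|z|) * w) = K * (8 + `|z|) / w.
  move: (gt_eqF w0) => /negbT w'0; clearbody K w; field; exact: w'0.
rewrite ler_pdivrMr// -ler_pdivrMl// [leLHS]mulrC.
by apply: le_trans wX; rewrite lerDr.
Unshelve. all: by end_near. Qed.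

Definition size_cdf n (y : R) : R :=
  #|[pred k : intpart n | (size k)%:R <= y]|%:R / (npart n)%:R.

(** The Erdos-Lehner theorem. At m = (log (1/t) + z) / t the sum of e^(-tj) over
    j > m tends to e^(-z) while each term tends to 0, so the product of the
    1 - e^(-tj) tends to exp (-e^(-z)); the inclusion-exclusion error vanishes
    because the mean weight of a set of parts is O(sqrt n log n), well below
    n^(3/4). *)
Lemma erdos_lehner (z : R) :
  size_cdf n ((temp R n)^-1 * (ln (temp R n)^-1 + z)) @[n --> \oo]
  --> expR (- expR (- z)).
Proof.
pose P n : R := \prod_(j < n.+1) (1 - x (Num.truncn (mu n z)) j).
have mu_near : \forall n \near \oo, 0 <= mu n z.
  near=> n; have n0 : (0 < n)%N by near: n; exact: near_gt0.
  rewrite mulr_ge0 ?invr_ge0 ?(ltW (temp_gt0 R n0))//.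
  rewrite -lerBlDr sub0r -ler_expR lnK ?posrE ?invr_gt0 ?temp_gt0//.
  near: n; exact: temp_inv_near.
have t1_near : \forall n \near \oo, temp R n <= 1.
  near=> n; have n0 : (0 < n)%N by near: n; exact: near_gt0.
  rewrite -[temp _ _]invrK invf_le1 ?invr_gt0 ?temp_gt0//.
  near: n; exact: temp_inv_near.
have bounds n : (0 < n)%N -> 0 <= mu n z ->
  (Num.truncn (mu n z))%:R <= mu n z < (Num.truncn (mu n z)).+1%:R.
  by move=> n0 mu0; exact: truncn_itv.
pose Y n := temp R n * expR (- z) * expR (temp R n).
have Y_cvg : Y n @[n --> \oo] --> (0 : R).
  have -> : 0 = 0 * expR (- z) * 1 :> R by rewrite !mul0r.
  by apply: cvgM expR_temp_cvg1; apply: cvgM; [exact: temp_cvg0|exact: cvg_cst].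
have P_cvg : P n @[n --> \oo] --> expR (- expR (- z)).
  have upper : expR (- (expR (- temp R n) *
      (expR (- z) - expR (- (temp R n * n%:R)) / temp R n))) @[n --> \oo]
      --> expR (- expR (- z)).
    apply: cvg_expR.
    apply: cvgN; rewrite -[X in _ --> X]mul1r; apply: cvgM.
      by have := expR_temp_cvg (-1); under eq_fun do rewrite mulN1r.
    rewrite -[X in _ --> X]subr0; apply: cvgB tail_cvg0; exact: cvg_cst.
  have lower : expR (- (expR (- z) * expR (temp R n) / (1 - Y n))) @[n --> \oo]
      --> expR (- expR (- z)).
    apply: cvg_expR.
    have limE : expR (- z) * 1 / (1 - 0) = expR (- z) :> R.
      by rewrite subr0 divr1 mulr1.
    apply: cvgN; rewrite -[X in _ --> X]limE.
    apply: cvgM; first exact: cvg_cstM expR_temp_cvg1.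
    apply: cvgV; first by rewrite subr0 oner_neq0.
    by apply: cvgB Y_cvg; exact: cvg_cst.
  apply: (squeeze_cvgr _ lower upper); near=> n.
  have n0 : (0 < n)%N by near: n; exact: near_gt0.
  have mu0 : 0 <= mu n z by near: n; exact: mu_near.
  have [_ _ h1 h2] := erdos_lehner_bounds n0 (bounds n n0 mu0).
  rewrite -/(P n) in h1 h2; rewrite h1 andbT; apply: h2.
  have : `|0 - Y n| <= 2^-1.
    by near: n; move/cvgrPdist_le : Y_cvg; apply; rewrite invr_gt0.
  rewrite sub0r normrN ler_norml /Y; lra.
apply/cvgrPdist_le => e e0.
pose E := expR (expR (- z) * expR 1).
have E0 : 0 < E := expR_gt0 _.
pose eps := Num.min 1 (e / (4 * E)).
have eps0 : 0 < eps by rewrite lt_min ltr01 divr_gt0// mulr_gt0.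
have eps1 : eps <= 1 by rewrite ge_min lexx.
have epsE : eps * E <= e / 4.
  apply: (@le_trans _ _ (e / (4 * E) * E)).
    by rewrite ler_wpM2r ?(ltW E0)// /eps ge_min lexx orbT.
  by rewrite le_eqVlt; apply/orP; left; apply/eqP; field; rewrite gt_eqF.
have [|delta d0 [n1 H]] := @prob_le_error eps; first by rewrite eps0.
pose F := expR (- z) * expR 1.
have F0 : 0 < F by rewrite mulr_gt0 ?expR_gt0.
near=> n.
have n0 : (0 < n)%N by near: n; exact: near_gt0.
have n1n : (n1 <= n)%N by near: n; exact: nbhs_infty_ge.
have mu0 : 0 <= mu n z by near: n; exact: mu_near.
have t1 : temp R n <= 1 by near: n; exact: t1_near.
have t0 := temp_gt0 R n0.
have k1 : (Num.sqrt (delta * rt R n ^+ 3))^-1 * (mu n z + 4 / temp R n) <= eps / F.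
  by near: n; apply: kappa_near => //; rewrite divr_gt0.
have P1 : `|expR (- expR (- z)) - P n| <= e / 2.
  by near: n; move/cvgrPdist_le : P_cvg; apply; rewrite divr_gt0.
have mP := bounds n n0 mu0; set m := Num.truncn (mu n z) in mP.
have -> : size_cdf n ((temp R n)^-1 * (ln (temp R n)^-1 + z)) = prob_le n m.
  rewrite /size_cdf /prob_le; congr (_%:R / _); apply: eq_card => k.
  rewrite !inE -/(mu n z); apply/idP/idP => h.
    rewrite -ltnS -(ltr_nat R); apply: le_lt_trans h _.
    by case/andP: mP.
  by case/andP: mP => + _; apply: le_trans; rewrite ler_nat.
have [L1 L2 _ _] := erdos_lehner_bounds n0 mP.
have FE : expR (- z) * expR (temp R n) <= F.
  by rewrite ler_wpM2l ?expR_ge0// ler_expR.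
have LE : expR (Lambda n m) <= E.
  by rewrite ler_expR; apply: le_trans L1 FE.
have err : `|prob_le n m - P n| <= e / 2.
  apply: le_trans (H n m n1n) _.
  apply: (@le_trans _ _ (2 * eps * E)); last by rewrite -mulrA; lra.
  have kk : (Num.sqrt (delta * rt R n ^+ 3))^-1 *
     (\sum_(m.+1 <= j < n.+1) j%:R * expR (- (temp R n * j%:R))) <= eps.
    have s0 : 0 <= (Num.sqrt (delta * rt R n ^+ 3))^-1 by rewrite invr_ge0 sqrtr_ge0.
    have M0 : 0 <= mu n z + 4 / temp R n by rewrite addr_ge0// divr_ge0// ltW.
    apply: le_trans (ler_wpM2l s0 L2) _; rewrite mulrCA.
    apply: (@le_trans _ _ (F * (eps / F))); last first.
      by rewrite mulrC divfK// gt_eqF.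
    by apply: ler_pM => //; rewrite mulr_ge0 ?expR_ge0.
  apply: ler_pM; rewrite ?expR_ge0//; last by lra.
  apply: addr_ge0; first exact: ltW.
  apply: mulr_ge0; first by rewrite invr_ge0 sqrtr_ge0.
  by apply: sumr_ge0 => j _; apply: mulr_ge0 => //; exact: expR_ge0.
have -> : expR (- expR (- z)) - prob_le n m =
  (expR (- expR (- z)) - P n) - (prob_le n m - P n) by ring.
by apply: le_trans (ler_normB _ _) _; lra.
Unshelve. all: by end_near. Qed.

End erdos_lehner.

(** * Two moments of the sum of binom(k_i, 2) *)

Section second_moment.
Variable R : realType.

Definition triangle_sum n (k : intpart n) : R := (\sum_(x <- k) 'C(x, 2))%N%:R.

Section fixed_n.
Variable n : nat.
Let I := ('I_n.+1 * 'I_n.+1)%type.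

(* The pair (l, j) stands for the l-th copy of the part j. *)
Let W (p : I) : R := if (0 < p.1)%N then 'C(p.2, 2)%:R else 0.
Let ind (k : intpart n) (p : I) : R := (p.1 <= count_mem (p.2 : nat) k)%N%:R.
Let size_of (p : I) : nat := (p.2 * p.1)%N.

Let W0 p : 0 <= W p. Proof. by rewrite /W; case: ifP. Qed.

Let sum_pairs (F : nat -> nat -> R) :
  \sum_(p : I) (if (0 < p.1)%N then F p.1 p.2 else 0) =
  \sum_(1 <= l < n.+1) \sum_(0 <= j < n.+1) F l j.
Proof.
rewrite -(pair_bigA _ (fun l j : 'I_n.+1 => if (0 < l)%N then F l j else 0))/=.
rewrite -(big_mkord xpredT (fun l => \sum_(j < n.+1) if (0 < l)%N then F l j else 0)).
rewrite big_ltn// big1 ?add0r//; apply: eq_big_nat => l /andP[l0 _].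
by rewrite big_mkord; apply: eq_bigr => j _; rewrite l0.
Qed.

Let triangle_sumE (k : intpart n) : triangle_sum k = \sum_p W p * ind k p.
Proof.
transitivity (\sum_(1 <= l < n.+1) \sum_(0 <= j < n.+1)
   'C(j, 2)%:R * (l <= count_mem j k)%N%:R : R); last first.
  rewrite -sum_pairs; apply: eq_bigr => p _; rewrite /W.
  by case: ifP; rewrite ?mul0r.
rewrite /triangle_sum (sum_parts k (fun x => 'C(x, 2)) (leqnn n)) natr_sum.
rewrite exchange_big/= [RHS]big_ltn// [X in _ = X + _]big1 ?add0r; last first.
  by move=> l _; rewrite bin0n mul0r.
apply: eq_big_nat => j _; rewrite natrM -mulr_sumr; congr (_ * _).
by rewrite {1}(count_intpartE k j (leqnn n)) natr_sum.
Qed.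

Let ind_count p : W p * \sum_k ind k p = W p * (npart_sub n (size_of p))%:R.
Proof.
rewrite /W /ind /size_of; case: p => l j /=; case: ifP => // l0; last by rewrite !mul0r.
have [->|j0] := posnP j; first by rewrite bin0n !mul0r.
by rewrite -natr_sum sum_count_ge.
Qed.

Lemma sum_triangle_sum : \sum_(k : intpart n) triangle_sum k =
  \sum_(p : I) W p * (npart_sub n (size_of p))%:R.
Proof.
under eq_bigr do rewrite triangle_sumE.
rewrite exchange_big/=; apply: eq_bigr => p _.
by rewrite -mulr_sumr ind_count.
Qed.

Let diag (p q : I) : nat :=
  if p.2 == q.2 then npart_sub n (p.2 * maxn p.1 q.1) else 0%N.

(** For p.2 = q.2 the two events are nested, so the count is the diagonal term. *)
Let ind_count2 p q : W p * W q * \sum_k ind k p * ind k q <=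
  W p * W q * ((npart_sub n (size_of p + size_of q))%:R + (diag p q)%:R).
Proof.
rewrite /W /ind /size_of /diag; case: p => l j; case: q => l' j' /=.
case: ifP => // l0; last by rewrite !mul0r.
case: ifP => // l'0; last by rewrite mulr0 !mul0r.
have [->|j0] := posnP j; first by rewrite bin0n !mul0r.
have [->|j'0] := posnP j'; first by rewrite bin0n mulr0 !mul0r.
rewrite ler_wpM2l ?mulr_ge0//.
under eq_bigr do rewrite -natrM mulnb.
rewrite -natr_sum -natrD ler_nat.
have [jj'|jj'] := eqVneq j j'; last by rewrite sum_count_ge2// leq_addr.
rewrite -jj' (leq_trans _ (leq_addl _ _))// -sum_count_ge//.
by apply: leq_sum => k _; rewrite geq_max.
Qed.

Lemma sum_triangle_sum_sqr : \sum_(k : intpart n) triangle_sum k ^+ 2 <=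
  \sum_(p : I) \sum_(q : I) W p * W q *
    ((npart_sub n (size_of p + size_of q))%:R + (diag p q)%:R).
Proof.
have E (k : intpart n) : triangle_sum k ^+ 2 =
    \sum_p \sum_q W p * W q * (ind k p * ind k q).
  rewrite expr2 triangle_sumE big_distrlr/=; apply: eq_bigr => p _.
  by apply: eq_bigr => q _; rewrite mulrACA.
under eq_bigr do rewrite E.
rewrite exchange_big/=; apply: ler_sum => p _.
rewrite exchange_big/=; apply: ler_sum => q _.
by rewrite -mulr_sumr ind_count2.
Qed.

Definition triangle_model : R :=
  \sum_(1 <= l < n.+1) \sum_(0 <= j < n.+1)
    'C(j, 2)%:R * expR (- (temp R n * l%:R * j%:R)).

Let t := temp R n.
Let gibbs (s : nat) : R := expR (- (t * s%:R)).

Let modelE : triangle_model = \sum_p W p * gibbs (size_of p).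
Proof.
rewrite /triangle_model -sum_pairs; apply: eq_bigr => p _; rewrite /W /gibbs.
case: ifP => _; last by rewrite mul0r.
have -> // : t * (size_of p)%:R = temp R n * p.1%:R * p.2%:R.
by rewrite /size_of natrM /t; ring.
Qed.

Section bounds.
Variables (eps delta : R).
Hypothesis n0 : (0 < n)%N.
Hypothesis eps01 : 0 < eps <= 1.
Hypothesis delta0 : 0 < delta.
Hypothesis npart_sub_le : forall s,
  (npart_sub n s)%:R <= (1 + eps) * gibbs s * (npart n)%:R.
Hypothesis npart_sub_ge : forall s, s%:R ^+ 2 <= delta * rt R n ^+ 3 ->
  (1 - eps) * gibbs s * (npart n)%:R <= (npart_sub n s)%:R :> R.

Let t0 : 0 < t := temp_gt0 R n0.
Let r0 : 0 < rt R n.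
Proof. by apply: (lt_le_trans ltr01); rewrite rt_ge1. Qed.
Let p0 : 0 < (npart n)%:R :> R.
Proof. by rewrite ltr0n npart_gt0. Qed.
Let c0 := pconst_gt0 R.

(** Used with Markov's inequality to discard the pairs beyond the range of the
    lower ratio estimate. *)
Let tail_le : \sum_(p : I) W p * ((size_of p)%:R ^+ 2 * gibbs (size_of p)) <=
  768 * pconst R ^+ 2 / t ^+ 5.
Proof.
apply: (@le_trans _ _ (\sum_(1 <= l < n.+1) \sum_(0 <= j < n.+1)
    l%:R ^+ 2 * (j%:R ^+ 4 * expR (- (t * l%:R * j%:R))))).
  rewrite -sum_pairs; apply: ler_sum => -[l j] _; rewrite /W /gibbs /size_of/=.
  case: ifP => _; last by rewrite mul0r.
  have -> : t * (j * l)%:R = t * l%:R * j%:R by rewrite natrM; ring.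
  have -> : l%:R ^+ 2 * (j%:R ^+ 4 * expR (- (t * l%:R * j%:R))) =
      j%:R ^+ 2 * ((j * l)%:R ^+ 2 * expR (- (t * l%:R * j%:R))).
    by rewrite natrM; ring.
  rewrite ler_wpM2r ?mulr_ge0 ?expR_ge0 ?exprn_ge0// -natrX ler_nat.
  exact: leq_bin_exp.
apply: (@le_trans _ _ (\sum_(1 <= l < n.+1) 768 / t ^+ 5 * l%:R ^- 2)); last first.
  rewrite -mulr_sumr.
  rewrite pconst_sqr.
  rewrite [leRHS]mulrAC.
  apply: ler_wpM2l; last exact: zeta2_part_le.
  apply: divr_ge0; first exact: ler0n.
  by apply: exprn_ge0; exact: ltW.
apply: ler_sum_nat => l /andP[l0 _]; rewrite -mulr_sumr.
have l0' : 0 < l%:R :> R by rewrite ltr0n.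
have l1 : 1 <= l%:R :> R by rewrite ler1n.
rewrite big_ltn// expr0n/= mul0r add0r.
apply: le_trans (ler_wpM2l _ (pow_expR_sum_le 4 n.+1 (mulr_gt0 t0 l0'))) _.
  by rewrite exprn_ge0.
have -> : l%:R ^+ 2 * (2 ^+ 5 * 4`!%:R / (t * l%:R) ^+ 5) =
    768 / t ^+ 5 * l%:R ^- 3 :> R.
  rewrite (_ : 4`! = 24)%N//; move: (gt_eqF t0) (gt_eqF l0') => /negbT t'0 /negbT.
  by move: (l%:R : R) (t) t'0 => L u u0 L0; field; rewrite L0 u0.
apply: ler_wpM2l.
  by apply: divr_ge0; [exact: ler0n|apply: exprn_ge0; exact: ltW].
by rewrite lef_pV2 ?posrE ?exprn_gt0// ler_weXn2l.
Qed.

Lemma mean_triangle_ge :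
  (1 - eps) * (triangle_model - 768 / (delta * rt R n * t ^+ 3)) * (npart n)%:R <=
  \sum_(k : intpart n) triangle_sum k.
Proof.
have /andP[e0 e1] := eps01.
have dr0 : 0 < delta * rt R n ^+ 3 by rewrite mulr_gt0// exprn_gt0.
rewrite sum_triangle_sum modelE.
have key p : (1 - eps) * (W p * gibbs (size_of p) -
    (delta * rt R n ^+ 3)^-1 * (W p * ((size_of p)%:R ^+ 2 * gibbs (size_of p))))
    * (npart n)%:R <= W p * (npart_sub n (size_of p))%:R.
  have g0 : 0 <= gibbs (size_of p) := expR_ge0 _.
  have e1' : 0 <= 1 - eps by lra.
  have [/npart_sub_ge h|/ltW h] :=
      leP ((size_of p)%:R ^+ 2) (delta * rt R n ^+ 3).
    apply: le_trans (ler_wpM2l (W0 p) h).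
    have -> : W p * ((1 - eps) * gibbs (size_of p) * (npart n)%:R) =
      (1 - eps) * (W p * gibbs (size_of p)) * (npart n)%:R by ring.
    rewrite ler_wpM2r ?(ltW p0)// ler_wpM2l//.
    by rewrite gerBl mulr_ge0 ?invr_ge0 ?(ltW dr0)// mulr_ge0// mulr_ge0// exprn_ge0.
  apply: (@le_trans _ _ 0); last by rewrite mulr_ge0.
  rewrite pmulr_lle0// mulr_ge0_le0// subr_le0.
  rewrite mulrCA ler_wpM2l// mulrA ler_peMl// ler_pdivlMl// mulr1.
  exact: h.
apply: le_trans (ler_sum _ (fun p _ => key p)).
rewrite -mulr_suml -mulr_sumr sumrB -mulr_sumr ler_wpM2r ?(ltW p0)//.
rewrite ler_wpM2l; [|by lra|]; last first.
  rewrite lerD2l lerN2.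
  have dV : 0 <= (delta * rt R n ^+ 3)^-1 by rewrite invr_ge0 ltW.
  apply: le_trans (ler_wpM2l dV tail_le) _.
  rewrite le_eqVlt; apply/orP; left; apply/eqP.
  rewrite /t /temp; move: (gt_eqF r0) (gt_eqF c0) (gt_eqF delta0).
  move: (rt R n) (pconst R) delta => a b d /negbT a0 /negbT b0 /negbT d'0.
  by field; rewrite a0 b0 d'0.
by [].
Qed.

(** The diagonal is of order t^(-5), against t^(-6) for the square of the mean. *)
Let diag_model_le : \sum_(p : I) \sum_(q : I) W p * W q *
    (if p.2 == q.2 then gibbs (p.2 * maxn p.1 q.1) else 0) <= 2048 / t ^+ 5.
Proof.
pose G (l j : nat) : R :=
  if (0 < l)%N then 'C(j, 2)%:R * expR (- (t / 2 * j%:R * l%:R)) else 0.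
have G0 l j : 0 <= G l j by rewrite /G; case: ifP => // _; rewrite mulr_ge0 ?expR_ge0.
(* max(l, l') is at least the average of l and l' *)
apply: (@le_trans _ _ (\sum_(p : I) \sum_(q : I)
    (if p.2 == q.2 then G p.1 p.2 * G q.1 q.2 else 0))).
  apply: ler_sum => -[l j] _; apply: ler_sum => -[l' j'] _ /=.
  case: eqP => [<-|_]; last by rewrite mulr0.
  rewrite /W /G /=; case: ifP => _; last by rewrite !mul0r.
  case: ifP => _; last by rewrite mulr0 mul0r mulr0.
  rewrite mulrACA ler_wpM2l ?mulr_ge0// -expRD ler_expR -opprD lerN2.
  rewrite natrM.
  have -> : t / 2 * j%:R * l%:R + t / 2 * j%:R * l'%:R =
     t * (j%:R * ((l%:R + l'%:R) / 2)) by field.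
  rewrite ler_wpM2l ?(ltW t0)// ler_wpM2l//.
  have : l%:R <= (maxn l l')%:R :> R by rewrite ler_nat leq_maxl.
  have : l'%:R <= (maxn l l')%:R :> R by rewrite ler_nat leq_maxr.
  move: (l%:R : R) (l'%:R : R) ((maxn l l')%:R : R) => a b c; lra.
have -> : \sum_(p : I) \sum_(q : I)
    (if p.2 == q.2 then G p.1 p.2 * G q.1 q.2 else 0) =
    \sum_(j < n.+1) (\sum_(l < n.+1) G l j) ^+ 2.
  rewrite -(pair_bigA _ (fun l j : 'I_n.+1 => \sum_(q : I)
    (if j == q.2 then G l j * G q.1 q.2 else 0)))/= exchange_big/=.
  apply: eq_bigr => j _; rewrite expr2 big_distrlr/=; apply: eq_bigr => l _.
  rewrite -(pair_bigA _ (fun l' j' : 'I_n.+1 =>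
    (if j == j' then G l j * G l' j' else 0)))/=.
  apply: eq_bigr => l' _; rewrite (bigD1 j)//= eqxx big1 ?addr0// => j'.
  by rewrite eq_sym => /negbTE ->.
have t20 : 0 < t / 2 by rewrite divr_gt0.
have sumG j : (0 < j)%N -> (\sum_(l < n.+1) G l j) ^+ 2 <=
    16 / t ^+ 2 * (j%:R ^+ 2 * expR (- (t / 2 * j%:R))).
  move=> j0; have j0' : 0 < j%:R :> R by rewrite ltr0n.
  set u := t / 2 * j%:R; have u0 : 0 < u by rewrite mulr_gt0.
  have u20 : 0 < u / 2 by rewrite divr_gt0.
  have h : \sum_(l < n.+1) G l j <= j%:R ^+ 2 * expR (- (u / 2)) * (u / 2)^-1.
    rewrite -(big_mkord xpredT (fun l => G l j)) big_ltn// {1}/G/= add0r.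
    apply: le_trans (ler_wpM2l _ (geometric_expR_le n.+1 u20)); last first.
      by rewrite mulr_ge0 ?exprn_ge0 ?expR_ge0.
    rewrite mulr_sumr; apply: ler_sum_nat => l /andP[l0 _]; rewrite /G l0 -[leRHS]mulrA.
    apply: ler_pM; rewrite ?expR_ge0//; first by rewrite -natrX ler_nat leq_bin_exp.
    rewrite -expRD ler_expR -opprD lerN2 -/u.
    have : u * 1 <= u * l%:R by rewrite ler_wpM2l ?(ltW u0)// ler1n.
    have -> : u / 2 + u / 2 * l%:R = (u + u * l%:R) / 2 by ring.
    by rewrite mulr1; move: (u * l%:R) => ul h; rewrite ler_pdivrMr//; lra.
  apply: (@le_trans _ _ ((j%:R ^+ 2 * expR (- (u / 2)) * (u / 2)^-1) ^+ 2)).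
    apply: lerXn2r => //; rewrite nnegrE; first by apply: sumr_ge0.
    by rewrite mulr_ge0 ?invr_ge0 ?(ltW u20)// mulr_ge0 ?exprn_ge0 ?expR_ge0.
  have -> : expR (- u) = expR (- (u / 2)) * expR (- (u / 2)).
    by rewrite -expRD; congr expR; field.
  rewrite le_eqVlt; apply/orP; left; apply/eqP.
  move: (expR _) => E; rewrite /u.
  move: (gt_eqF t0) (gt_eqF j0') => /negbT t'0 /negbT.
  by move: (j%:R : R) (t) t'0 => J v v0 J0; field; rewrite J0 v0.
rewrite -(big_mkord xpredT (fun j => (\sum_(l < n.+1) G l j) ^+ 2)) big_ltn//.
rewrite [X in X ^+ 2 + _]big1 ?expr0n ?add0r//=; last first.
  by move=> l _; rewrite /G bin0n mul0r if_same.
apply: (@le_trans _ _ (\sum_(1 <= j < n.+1)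
    16 / t ^+ 2 * (j%:R ^+ 2 * expR (- (t / 2 * j%:R))))).
  by apply: ler_sum_nat => j /andP[j0 _]; exact: sumG.
rewrite -mulr_sumr; apply: (@le_trans _ _ (16 / t ^+ 2 * (2 ^+ 3 * 2`!%:R / (t / 2) ^+ 3))).
  rewrite ler_wpM2l ?divr_ge0 ?exprn_ge0 ?(ltW t0)//; exact: pow_expR_sum_le.
rewrite (_ : 2`! = 2)%N// le_eqVlt; apply/orP; left; apply/eqP.
by move: (gt_eqF t0) => /negbT; move: (t) => v v0; field.
Qed.

Lemma second_moment_triangle_le :
  \sum_(k : intpart n) triangle_sum k ^+ 2 <=
  (1 + eps) * (triangle_model ^+ 2 + 2048 / t ^+ 5) * (npart n)%:R.
Proof.
have /andP[e0 e1] := eps01.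
apply: le_trans sum_triangle_sum_sqr _.
apply: (@le_trans _ _ (\sum_(p : I) \sum_(q : I) W p * W q *
   ((1 + eps) * (npart n)%:R * (gibbs (size_of p) * gibbs (size_of q)) +
    (1 + eps) * (npart n)%:R *
    (if p.2 == q.2 then gibbs (p.2 * maxn p.1 q.1) else 0)))).
  apply: ler_sum => p _; apply: ler_sum => q _.
  rewrite ler_wpM2l ?mulr_ge0//; apply: lerD.
    apply: le_trans (npart_sub_le _) _.
    rewrite le_eqVlt; apply/orP; left; apply/eqP.
    by rewrite /gibbs natrD mulrDr opprD expRD; ring.
  rewrite /diag; case: eqP => _; last by rewrite mulr0.
  by apply: le_trans (npart_sub_le _) _; rewrite mulrAC.
have -> : \sum_(p : I) \sum_(q : I) W p * W q *
   ((1 + eps) * (npart n)%:R * (gibbs (size_of p) * gibbs (size_of q)) +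
    (1 + eps) * (npart n)%:R *
    (if p.2 == q.2 then gibbs (p.2 * maxn p.1 q.1) else 0)) =
   (1 + eps) * (npart n)%:R * (triangle_model ^+ 2 + \sum_(p : I) \sum_(q : I) W p * W q *
    (if p.2 == q.2 then gibbs (p.2 * maxn p.1 q.1) else 0)).
  rewrite modelE expr2 big_distrlr/= -big_split mulr_sumr/=.
  apply: eq_bigr => p _; rewrite -big_split mulr_sumr/=; apply: eq_bigr => q _.
  by move: (if _ then _ else _) => d; ring.
rewrite [leRHS]mulrAC ler_wpM2l//; first by rewrite mulr_ge0 ?(ltW p0)//; lra.
by rewrite lerD2l diag_model_le.
Qed.

End bounds.
End fixed_n.
End second_moment.

(** * The law of large numbers *)

Section law_of_large_numbers.
Variable R : realType.

Let zeta3_part n : R := \sum_(1 <= l < n.+1) l%:R ^- 3.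

Let zeta3_partE : zeta3_part = series (riemannR (3 : R)).
Proof.
apply/funext => n; rewrite /zeta3_part /series /= big_add1/=.
by apply: eq_bigr => k _; rewrite /riemannR powR_mulrn.
Qed.

Let zeta3_part_ndecr : nondecreasing_seq zeta3_part.
Proof.
move=> m n mn; rewrite /zeta3_part [leRHS](big_cat_nat (n := m.+1))//=.
by rewrite lerDl sumr_ge0// => l _; rewrite invr_ge0 exprn_ge0.
Qed.

Let zeta3_cvg : zeta3_part n @[n --> \oo] --> zeta (3 : R).
Proof.
rewrite /zeta -zeta3_partE; apply: (@nondecreasing_is_cvgn R) => //.
exists (pi ^+ 2 / 6) => _ [n _ <-]; apply: le_trans (zeta2_part_le R n).
apply: ler_sum_nat => l /andP[l0 _].
have l1 : 1 <= l%:R :> R by rewrite ler1n.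
have l0' : 0 < l%:R :> R by rewrite ltr0n.
by rewrite lef_pV2 ?posrE ?exprn_gt0// ler_weXn2l.
Qed.

Let zeta3_part_le n : zeta3_part n <= zeta (3 : R).
Proof.
rewrite /zeta -zeta3_partE; apply: nondecreasing_cvgn_le => //.
by apply/cvg_ex; exists (zeta 3); exact: zeta3_cvg.
Qed.

Let zeta3_ge0 : 0 <= zeta (3 : R).
Proof.
apply: le_trans (zeta3_part_le 0); rewrite /zeta3_part big_geq//.
Qed.

Let cvg_cstM (f : nat -> R) (a l : R) : f n @[n --> \oo] --> l ->
  a * f n @[n --> \oo] --> a * l.
Proof. by move=> fl; apply: cvgM => //; exact: cvg_cst. Qed.

Let temp_cvgM (a : R) : a * temp R n @[n --> \oo] --> (0 : R).
Proof. by have := cvg_cstM (a := a) (@temp_cvg0 R); rewrite mulr0. Qed.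

Let model_scaled n : R := temp R n ^+ 3 * triangle_model R n.

(** The model sum is t^(-3) sum_l l^(-3) up to relative errors O(t). *)
Let model_cvg : model_scaled n @[n --> \oo] --> zeta (3 : R).
Proof.
pose a : R := 3 * (4 * (720 / pconst R ^+ 8)).
pose lower n : R := (1 - a * temp R n * temp R n) * zeta3_part n -
   2 * (pi ^+ 2 / 6) * temp R n.
have lower_cvg : lower n @[n --> \oo] --> zeta (3 : R).
  have limE : (1 - 0 * 0) * zeta (3 : R) - 0 = zeta 3.
    by rewrite mulr0 !subr0 mul1r.
  rewrite -[X in _ --> X]limE; apply: cvgB (temp_cvgM _).
  apply: cvgM zeta3_cvg; apply: cvgB; first exact: cvg_cst.
  by apply: cvgM; [exact: temp_cvgM|exact: temp_cvg0].
apply: (squeeze_cvgr _ lower_cvg zeta3_cvg); near=> n.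
have n0 : (0 < n)%N by near: n; exact: near_gt0.
have t0 := temp_gt0 R n0; have t3 : 0 < temp R n ^+ 3 by rewrite exprn_gt0.
have c0 := pconst_gt0 R.
have r1 := rt_ge1 R n0; have r0 : 0 < rt R n by exact: lt_le_trans r1.
have tn : temp R n * n%:R = pconst R * rt R n.
  by rewrite -(rt_sqr R n) expr2 mulrA temp_rt.
apply/andP; split; last first.
  rewrite /model_scaled mulrC -ler_pdivlMr// [leRHS]mulrC.
  exact: binomial_pairs_le.
have := binomial_pairs_ge 2 n t0; rewrite -/(zeta3_part n) -/(triangle_model R n).
move=> h; have {}h := ler_wpM2l (ltW t3) h.
rewrite mulrA divff ?mul1r ?gt_eqF// in h; apply: le_trans h.
rewrite /lower -/(zeta2_part R n); apply: lerB; last first.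
  rewrite mulrAC ler_wpM2r ?(ltW t0)// ler_wpM2l//; exact: zeta2_part_le.
rewrite ler_wpM2r//; first by apply: sumr_ge0 => l _; rewrite invr_ge0 exprn_ge0.
rewrite lerD2l lerN2 tn.
have E : expR (- (pconst R * rt R n)) <= 720 / (pconst R * rt R n) ^+ 6.
  exact: (@expRN_le_pow R _ 6 (mulr_gt0 c0 r0)).
have n2 : n.+1%:R ^+ 2 <= 4 * rt R n ^+ 4.
  have -> : 4 * rt R n ^+ 4 = (2 * rt R n ^+ 2) ^+ 2 by ring.
  apply: lerXn2r; rewrite ?nnegrE ?mulr_ge0 ?exprn_ge0 ?(ltW r0)//.
  by rewrite rt_sqr -natrM ler_nat; lia.
apply: (@le_trans _ _ (3 * (4 * rt R n ^+ 4) * (720 / (pconst R * rt R n) ^+ 6))).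
  apply: ler_pM => //; rewrite ?expR_ge0 ?mulr_ge0 ?exprn_ge0//.
  by rewrite ler_wpM2l.
rewrite le_eqVlt; apply/orP; left; apply/eqP.
rewrite /a /temp; move: (gt_eqF r0) (gt_eqF c0).
by move: (rt R n) (pconst R) => u b /negbT a0 /negbT b0; field; rewrite a0 b0.
Unshelve. all: by end_near. Qed.

(** Chebyshev's inequality. For fixed eps the bounds on the two moments leave a
    scaled variance of at most 3 eps zeta(3)^2 in the limit, and eps is
    arbitrary. *)
Lemma triangle_sum_lln (theta : R) : 0 < theta ->
  #|[pred k : intpart n | theta < `|temp R n ^+ 3 * triangle_sum R k - zeta 3|]|%:R
    / (npart n)%:R @[n --> \oo] --> (0 : R).
Proof.
move=> th0; set z := zeta (3 : R); apply/cvgrPdist_le => e e0.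
have th20 : 0 < theta ^+ 2 by rewrite exprn_gt0.
have z1 : 0 < 6 * z ^+ 2 + 1 by rewrite ltr_wpDl// mulr_ge0// exprn_ge0.
have et0 : 0 < e * theta ^+ 2 by rewrite mulr_gt0.
pose eps := Num.min 1 (e * theta ^+ 2 / (6 * z ^+ 2 + 1)).
have eps0 : 0 < eps by rewrite lt_min ltr01 divr_gt0.
have eps1 : eps <= 1 by rewrite ge_min lexx.
have epsE : eps * (6 * z ^+ 2 + 1) <= e * theta ^+ 2.
  by rewrite -ler_pdivlMr// /eps ge_min lexx orbT.
have eps01 : 0 < eps <= 1 by rewrite eps0.
have [delta d0 [n1 H]] := npart_ratio eps01.
pose X n := (1 + eps) * (model_scaled n * model_scaled n + 2048 * temp R n)
  - 2 * z * (1 - eps) * (model_scaled n - 768 / (delta * pconst R) * temp R n) + z ^+ 2.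
have X_cvg : X n @[n --> \oo] --> 3 * eps * z ^+ 2.
  have limE : (1 + eps) * (z * z + 0) - 2 * z * (1 - eps) * (z - 0) + z ^+ 2 =
      3 * eps * z ^+ 2 by ring.
  rewrite -[X in _ --> X]limE; apply: cvgD; last exact: cvg_cst.
  apply: cvgB; apply: cvg_cstM.
    by apply: cvgD (temp_cvgM _); apply: cvgM; exact: model_cvg.
  by apply: cvgB (temp_cvgM _); exact: model_cvg.
near=> n.
have n0 : (0 < n)%N by near: n; exact: near_gt0.
have n1n : (n1 <= n)%N by near: n; exact: nbhs_infty_ge.
have Xn : `|3 * eps * z ^+ 2 - X n| <= e * theta ^+ 2 / 2.
  by near: n; move/cvgrPdist_le : X_cvg; apply; rewrite divr_gt0.
have [H1 H2] := H n n1n.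
have t0 := temp_gt0 R n0; have c0 := pconst_gt0 R.
have r1 := rt_ge1 R n0; have r0 : 0 < rt R n by exact: lt_le_trans r1.
have p0 : 0 < (npart n)%:R :> R by rewrite ltr0n npart_gt0.
have M1 := mean_triangle_ge n0 eps01 d0 H2.
have M2 := second_moment_triangle_le n0 eps01 H1.
rewrite sub0r normrN ger0_norm ?divr_ge0// ler_pdivrMr// -(ler_pM2l th20).
set t := temp R n in t0 M1 M2 *.
have cheb : theta ^+ 2 * #|[pred k : intpart n |
      theta < `|t ^+ 3 * triangle_sum R k - z|]|%:R <=
    \sum_(k : intpart n) (t ^+ 3 * triangle_sum R k - z) ^+ 2.
  rewrite -sum1_card natr_sum mulr_sumr big_mkcond/=; apply: ler_sum => k _.
  rewrite inE; case: ifP => [h|_]; last by rewrite sqr_ge0.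
  rewrite mulr1 -[leRHS]real_normK ?num_real//.
  by apply: lerXn2r; rewrite ?nnegrE ?(ltW th0)// ltW.
apply: le_trans cheb _.
have -> : \sum_(k : intpart n) (t ^+ 3 * triangle_sum R k - z) ^+ 2 =
    t ^+ 6 * (\sum_(k : intpart n) triangle_sum R k ^+ 2)
    - 2 * z * t ^+ 3 * (\sum_(k : intpart n) triangle_sum R k)
    + z ^+ 2 * (npart n)%:R.
  have -> : z ^+ 2 * (npart n)%:R = \sum_(k : intpart n) z ^+ 2.
    by rewrite sumr_const mulr_natr.
  rewrite !mulr_sumr -sumrB -big_split/=; apply: eq_bigr => k _; ring.
apply: (@le_trans _ _ (X n * (npart n)%:R)); last first.
  rewrite mulrA [theta ^+ 2 * e]mulrC ler_wpM2r ?(ltW p0)//.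
  have q0 : 0 <= eps by exact: ltW.
  move: Xn epsE; rewrite ler_norml; move: (X n) (z ^+ 2) (e * theta ^+ 2) => x zz et.
  by rewrite mulrDr mulr1; lra.
have t6 : 0 <= t ^+ 6 by rewrite exprn_ge0// ltW.
have zt3 : 0 <= 2 * z * t ^+ 3.
  by apply: mulr_ge0; [exact: mulr_ge0|apply: exprn_ge0; exact: ltW].
have := ler_wpM2l t6 M2; have := ler_wpM2l zt3 M1.
have -> : t ^+ 6 * ((1 + eps) * (triangle_model R n ^+ 2 + 2048 / t ^+ 5) * (npart n)%:R)
  = (1 + eps) * (model_scaled n * model_scaled n + 2048 * t) * (npart n)%:R.
  rewrite /model_scaled -/t; move: (triangle_model R n) => A.
  by clearbody t; field; rewrite gt_eqF.
have -> : 2 * z * t ^+ 3 * ((1 - eps) * (triangle_model R n -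
    768 / (delta * rt R n * t ^+ 3)) * (npart n)%:R) =
  2 * z * (1 - eps) * (model_scaled n - 768 / (delta * pconst R) * t) * (npart n)%:R.
  rewrite /model_scaled /t /temp; move: (triangle_model R n) => A.
  move: (gt_eqF r0) (gt_eqF c0) (gt_eqF d0).
  move: (rt R n) (pconst R) => u b /negbT a0 /negbT b0 /negbT d'0.
  by field; rewrite a0 b0 d'0.
rewrite /X -/t; move: (\sum_k _) (\sum_k _ ^+ 2) => S1 S2 h1 h2.
rewrite [leRHS]mulrDl [X in _ <= X + _]mulrBl; apply: lerD => //; exact: lerB.
Unshelve. all: by end_near. Qed.

End law_of_large_numbers.

(** * The Gumbel limit *)

Section weak_limit.
Variable R : realType.

(** Everything is expressed through t: c n^(-3/2) is t^3 / c^2, and c / sqrt n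
    is t. *)
Let statE (alpha : R) n (k : intpart n) : (0 < n)%N ->
  pi / Num.sqrt 6 * n%:R `^ (- (3 / 2)) * partition_eigenvalue alpha k
    - ln (Num.sqrt n%:R / (pi / Num.sqrt 6)) =
  (temp R n * (size k)%:R - ln (temp R n)^-1) +
  ((alpha * (temp R n ^+ 3 * triangle_sum R k)
    - temp R n ^+ 3 * triangle_sum R (conj_part k)) / pconst R ^+ 2 - temp R n).
Proof.
move=> n0; rewrite -/(pconst R) -/(rt R n).
have r1 := rt_ge1 R n0; have r0 : 0 < rt R n by exact: lt_le_trans r1.
have c0 := pconst_gt0 R.
have -> : n%:R `^ (- (3 / 2)) = rt R n ^- 3 :> R.
  rewrite powRN; congr (_^-1).
  have -> : 3 / 2 = 2^-1 * 3 :> R by rewrite mulrC.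
  by rewrite powRrM powR12_sqrt// -/(rt R n) powR_mulrn// ltW.
have -> : (temp R n)^-1 = rt R n / pconst R by rewrite /temp invf_div.
rewrite /partition_eigenvalue (part_a_conj_part k) (part_aE k).
rewrite -/(triangle_sum R k) -/(triangle_sum R (conj_part k)).
rewrite -{1}(rt_sqr R n) /temp; move: (ln _) => l.
move: (triangle_sum R k) (triangle_sum R (conj_part k)) (size k)%:R => Y Y' m.
move: (gt_eqF r0) (gt_eqF c0).
by move: (rt R n) (pconst R) => u b /negbT a0 /negbT b0; field; rewrite a0 b0.
Qed.

Lemma cdf_part_RV n (f : intpart n -> R) (x : R) :
  cdf (part_RV f) x = (#|[pred k | f k <= x]|%:R / (npart n)%:R)%:E.
Proof.
rewrite /cdf /distribution /pushforward -(uniform_partE R [pred k | f k <= x]).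
by congr (uniform_part _ _); apply/seteqP; split => k /=; rewrite in_itv.
Qed.

Let deviant n (theta : R) : R :=
  #|[pred k : intpart n |
     theta < `|temp R n ^+ 3 * triangle_sum R k - zeta 3|]|%:R / (npart n)%:R.

Let card_le3 (T : finType) (p q r s : pred T) :
  (forall k, p k -> [|| q k, r k | s k]) -> (#|p| <= #|q| + #|r| + #|s|)%N.
Proof.
move=> H; rewrite -!sum1_card [X in (X <= _)%N]big_mkcond.
rewrite [X in (_ <= X + _ + _)%N]big_mkcond [X in (_ <= _ + X + _)%N]big_mkcond.
rewrite [X in (_ <= _ + X)%N]big_mkcond/= -!big_split/=; apply: leq_sum => k _.
by have := H k; rewrite !unfold_in; case: (p k) (q k) (r k) (s k) => [] [] [] [] // /(_ isT).
Qed.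

(** Unless a triangular sum deviates by more than theta, the statistic is within
    C theta of the recentred number of parts shifted by -K; theta is chosen from
    the continuity of the Gumbel distribution function. *)
Lemma eigenvalue_cdf_cvg (alpha x : R) : 0 < alpha ->
  let c : R := pi / Num.sqrt 6 in
  let K : R := 6 * zeta 3 / pi ^+ 2 * (1 - alpha) in
  #|[pred k : intpart n | c * n%:R `^ (- (3 / 2)) * partition_eigenvalue alpha k
     - ln (Num.sqrt n%:R / c) <= x]|%:R / (npart n)%:R @[n --> \oo]
  --> expR (- expR (- (x + K))).
Proof.
move=> alpha0 c K; have c0 := pconst_gt0 R.
have KE : K = (1 - alpha) * zeta 3 / pconst R ^+ 2.
  rewrite /K pconst_sqr; have := pi_gt0 R; move: (zeta 3 : R) (pi : R) => z p p0.
  by field; rewrite gt_eqF.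
pose C := (alpha + 1) / pconst R ^+ 2 + 1.
have C0 : 0 < C by rewrite addr_gt0// divr_gt0 ?addr_gt0// exprn_gt0.
pose G (z : R) := expR (- expR (- z)).
have G_cont : {for x + K, continuous G}.
  apply: continuous_comp; last exact: continuous_expR.
  apply: continuousN; apply: continuous_comp; last exact: continuous_expR.
  exact: opp_continuous.
apply/cvgrPdist_le => e e0; rewrite -/(G (x + K)).
have e30 : 0 < e / 3 by rewrite divr_gt0.
have [d /= d0 Gd] : exists2 d : R, 0 < d & forall z, `|(x + K) - z| < d ->
    `|G (x + K) - G z| <= e / 3.
  by have /cvgrPdist_le/(_ _ e30)[d /= d0 H] := G_cont; exists d.
pose theta := d / (2 * C).
have th0 : 0 < theta by rewrite divr_gt0// mulr_gt0.
have thC : C * theta = d / 2 by rewrite /theta; field; rewrite gt_eqF.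
have e60 : 0 < e / 6 by rewrite divr_gt0.
have S_near z : \forall n \near \oo,
    `|G z - size_cdf n ((temp R n)^-1 * (ln (temp R n)^-1 + z))| <= e / 3.
  by have /cvgrPdist_le/(_ _ e30) := @erdos_lehner R z.
near=> n.
have n0 : (0 < n)%N by near: n; exact: near_gt0.
have t0 := temp_gt0 R n0.
have p0 : 0 < (npart n)%:R :> R by rewrite ltr0n npart_gt0.
have tth : temp R n <= theta.
  have : `|0 - temp R n| <= theta.
    by near: n; move/cvgrPdist_le : (@temp_cvg0 R); apply.
  by rewrite sub0r normrN gtr0_norm.
have dev : deviant n theta <= e / 6.
  have : `|0 - deviant n theta| <= e / 6.
    by near: n; move/cvgrPdist_le : (triangle_sum_lln th0); apply.
  by rewrite sub0r normrN ger0_norm// divr_ge0.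
pose S z := size_cdf n ((temp R n)^-1 * (ln (temp R n)^-1 + z)).
have S_up : `|G (x + K + C * theta) - S (x + K + C * theta)| <= e / 3.
  by rewrite /S; near: n; exact: S_near.
have S_lo : `|G (x + K - C * theta) - S (x + K - C * theta)| <= e / 3.
  by rewrite /S; near: n; exact: S_near.
have G_up : `|G (x + K) - G (x + K + C * theta)| <= e / 3.
  by apply: Gd; rewrite opprD addNKr normrN thC gtr0_norm; lra.
have G_lo : `|G (x + K) - G (x + K - C * theta)| <= e / 3.
  by apply: Gd; rewrite opprB addrCA subrr addr0 thC gtr0_norm; lra.
set P : R := _ / _.
pose bad (k : intpart n) := theta < `|temp R n ^+ 3 * triangle_sum R k - zeta 3|.
pose W (k : intpart n) : R := (alpha * (temp R n ^+ 3 * triangle_sum R k)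
    - temp R n ^+ 3 * triangle_sum R (conj_part k)) / pconst R ^+ 2 - temp R n.
have W_near k : ~~ bad k -> ~~ bad (conj_part k) -> `|W k + K| <= C * theta.
  rewrite /bad -!leNgt KE /W; set Y := _ * triangle_sum R k.
  set Y' := _ * triangle_sum R (conj_part k) => h h'.
  have -> : (alpha * Y - Y') / pconst R ^+ 2 - temp R n +
      (1 - alpha) * zeta 3 / pconst R ^+ 2 =
      (alpha * (Y - zeta 3) - (Y' - zeta 3)) / pconst R ^+ 2 - temp R n.
    by ring.
  apply: le_trans (ler_normB _ _) _; rewrite /C [leRHS]mulrDl mul1r.
  apply: lerD; last by rewrite gtr0_norm.
  rewrite normrM [`|(_ ^+ 2)^-1|]gtr0_norm ?invr_gt0 ?exprn_gt0// [leRHS]mulrAC.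
  rewrite ler_wpM2r ?invr_ge0 ?exprn_ge0 ?(ltW c0)//.
  apply: le_trans (ler_normB _ _) _; rewrite [leRHS]mulrDl mul1r; apply: lerD => //.
  by rewrite normrM gtr0_norm// ler_wpM2l ?(ltW alpha0).
have sizeE z (k : intpart n) :
    ((size k)%:R <= (temp R n)^-1 * (ln (temp R n)^-1 + z)) =
    (temp R n * (size k)%:R - ln (temp R n)^-1 <= z).
  by rewrite ler_pdivlMl// lerBlDl.
have card_bad : #|[pred k | bad (conj_part k)]| = #|[pred k | bad k]|.
  exact: (card_conj_part [pred k | bad k]).
have devE : deviant n theta = #|[pred k | bad k]|%:R / (npart n)%:R by [].
have up : P <= S (x + K + C * theta) + deviant n theta + deviant n theta.
  rewrite devE /P /S /size_cdf -!mulrDl ler_wpM2r ?invr_ge0 ?(ltW p0)//.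
  rewrite -!natrD ler_nat -{2}card_bad; apply: card_le3 => k; rewrite !inE.
  rewrite /c statE// -/(W k) sizeE.
  have [//|nb] := boolP (bad k); first by rewrite !orbT.
  have [//|nb'] := boolP (bad (conj_part k)); first by rewrite !orbT.
  rewrite !orbF => h; have := W_near k nb nb'; rewrite ler_norml; lra.
have lo : S (x + K - C * theta) <= P + deviant n theta + deviant n theta.
  rewrite devE /P /S /size_cdf -!mulrDl ler_wpM2r ?invr_ge0 ?(ltW p0)//.
  rewrite -!natrD ler_nat -{2}card_bad; apply: card_le3 => k; rewrite !inE.
  rewrite /c statE// -/(W k) sizeE.
  have [//|nb] := boolP (bad k); first by rewrite !orbT.
  have [//|nb'] := boolP (bad (conj_part k)); first by rewrite !orbT.
  rewrite !orbF => h; have := W_near k nb nb'; rewrite ler_norml; lra.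
move: S_up S_lo G_up G_lo dev up lo; rewrite !ler_norml.
move: (deviant n theta) (S _) (S _) (G _) (G _) (G _) => D s1 s2 g1 g2 g3; lra.
Unshelve. all: by end_near. Qed.

End weak_limit.

Theorem theorem3 (R : realType) (alpha : R) (alpha_gt0 : 0 < alpha) :
  let c : R := pi / Num.sqrt 6 in
  let K : R := 6 * zeta 3 / pi ^+ 2 * (1 - alpha) in
  converges_weakly
    (fun n => part_RV (fun kappa : intpart n =>
       c * n%:R `^ (- (3 / 2)) * partition_eigenvalue alpha kappa
       - ln (Num.sqrt n%:R / c)))
    (gumbel_cdf K).
Proof.
move=> c K x _; under eq_fun do rewrite cdf_part_RV.
apply: cvg_EFin; first exact: nearW.
exact: eigenvalue_cdf_cvg.
Qed.
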